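(* Let $X\subset\mathbb{CP}^N$ be a projective algebraic surface of degree $8$ admitting a projective degeneration into a union of $8$ planes whose shadow is the complex $X^4$ described in the context (a triangulation of the sphere $S^2$ with all vertices of degree $4$), and let $X_{\mathrm{Gal}}$ be the Galois cover of $X$ with respect to a generic projection $X\to\mathbb{CP}^2$. Then the fundamental group $\pi_1(X_{\mathrm{Gal}})$ is an abelian-by-abelian (i.e. metabelian) group of order $2^{23}$. In fact, it is a central extension $$1\to(\mathbb{Z}/2)^3\to\pi_1(X_{\mathrm{Gal}})\to(\mathbb{Z}/2)^{20}\to1 .$$
   Context: **Degeneration and shadow.** A generic projection $p':X_0\to\mathbb{CP}^2$ is a projective degeneration of a generic projection $p:Y\to\mathbb{CP}^2$ if there are a flat family $\pi:V\to\Delta$ over the unit disc and a map $F:V\to\Delta\times\mathbb{CP}^2$ (called an embedding in the source) whose composition with the first projection is $\pi$, such that $\pi^{-1}(0)\simeq X_0$, $\pi^{-1}(t_0)\simeq Y$ for some $t_0\neq0$, the family is smooth over $\Delta\setminus\{0\}$, and $F$ restricts to $0\times p'$ on $\pi^{-1}(0)$ and to $t_0\times p$ on $\pi^{-1}(t_0)$. Here the degenerate fibre is a union of planes ($\cong\mathbb{CP}^2$), with only two planes meeting along any line. The shadow of the degeneration is the 2-dimensional complex with one triangle for each plane; two triangles share an edge (resp. a vertex) if the corresponding planes meet in a line (resp. a point). An edge belonging to a single triangle is redundant; only non-redundant edges are numbered $1,\dots,q$. The degree (multiplicity) of a vertex is the number of non-redundant edges at it. **Shadow $X^4$.** The octahedral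 triangulation of $S^2$ (cut the round sphere by three orthogonal planes through the origin): vertices $V_1,\dots,V_6$; triangles $V_1V_6V_5$, $V_1V_5V_3$, $V_1V_3V_2$, $V_1V_2V_6$, $V_4V_5V_3$, $V_4V_5V_6$, $V_4V_6V_2$, $V_4V_2V_3$. All $q=12$ edges are non-redundant: $1=V_1V_6$, $2=V_1V_5$, $3=V_1V_2$, $4=V_1V_3$, $5=V_3V_5$, $6=V_2V_3$, $7=V_3V_4$, $8=V_2V_6$, $9=V_5V_6$, $10=V_4V_5$, $11=V_2V_4$, $12=V_4V_6$. **Galois cover.** For a generic projection $f:X\to\mathbb{CP}^2$ of degree $n$ (here $n=8$), $X_{\mathrm{Gal}}=\overline{(X\times_{\mathbb{CP}^2}\cdots\times_{\mathbb{CP}^2}X)\setminus\triangle}$ ($n$ factors), where $\triangle$ is the extended diagonal $\{(x_1,\dots,x_n): x_i=x_j \text{ for some } i\ne j\}$. Let $S\subset\mathbb{CP}^2$ be the branch curve of $f$ and $G=\pi_1(\mathbb{CP}^2\setminus S)$. The group $G$ is generated by $\gamma_i,\gamma_{i'}$ ($1\le i\le q$). There is an exact sequence $$1\to\pi_1(X_{\mathrm{Gal}})\to G/\langle\langle\gamma^2\rangle\rangle\to S_n\to1,$$ where $\langle\langle\gamma^2\rangle\rangle$ is the normal subgroup generated by all $\gamma_i^2,\gamma_{i'}^2$, and $\gamma_i,\gamma_{i'}$ both map to the transposition exchanging the two triangles that share edge $i$. **Presentation of $G$ (the standard Van Kampen presentation from the regeneration technique).** Write $[x,y]=xyx^{-1}y^{-1}$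 and $\langle x,y\rangle=xyxy^{-1}x^{-1}y^{-1}$. The group $G$ is presented on the generators above with the following relations. (R4) For each $(i,j,k,l)\in\{(1,2,3,4),(3,6,8,11),(4,5,6,7),(7,10,11,12),(2,5,9,10),(1,8,9,12)\}$, writing $a,a',b,b',c,c',d,d'$ for $\gamma_i,\gamma_{i'},\gamma_j,\gamma_{j'},\gamma_k,\gamma_{k'},\gamma_l,\gamma_{l'}$: - $\langle a',b\rangle=\langle a',b'\rangle=\langle a',b^{-1}b'b\rangle=e$; - $\langle c,d\rangle=\langle c',d\rangle=\langle c^{-1}c'c,d\rangle=e$; - $[b'ba'b^{-1}b'^{-1},d]=e$; - $[b'ba'b^{-1}b'^{-1},c^{-1}c'^{-1}d^{-1}d'dc'c]=e$; - $\langle a,b\rangle=\langle a,b'\rangle=\langle a,b^{-1}b'b\rangle=e$; - $\langle c,d^{-1}d'd\rangle=\langle c',d^{-1}d'd\rangle=\langle c^{-1}c'c,d^{-1}d'd\rangle=e$; - $[b'bab^{-1}b'^{-1},d^{-1}d'd]=e$; - $[b'bab^{-1}b'^{-1},c^{-1}c'^{-1}d^{-1}d'^{-1}dd'dc'c]=e$; - $b'ba'ba'^{-1}b^{-1}b'^{-1}=dc'd^{-1}$; - $b'ba'b'a'^{-1}b^{-1}b'^{-1}=dc'cc'^{-1}d^{-1}$; - $b'baba^{-1}b^{-1}b'^{-1}=d^{-1}d'dc'd^{-1}d'^{-1}d$; - $b'bab'a^{-1}b^{-1}b'^{-1}=d^{-1}d'dc'cc'^{-1}d^{-1}d'^{-1}d$.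 (R5) $[x,y]=e$ for all $x\in\{\gamma_i,\gamma_{i'}\}$, $y\in\{\gamma_j,\gamma_{j'}\}$, whenever edges $i,j$ have no common vertex, i.e. $(i,j)\in(\{1\}\times\{5,6,7,10,11\})\cup(\{2\}\times\{6,7,8,11,12\})\cup(\{3\}\times\{5,7,9,10,12\})\cup(\{4\}\times\{8,9,10,11,12\})\cup(\{5\}\times\{8,11,12\})\cup(\{6\}\times\{9,10,12\})\cup(\{7\}\times\{8,9\})\cup(\{8\}\times\{10\})\cup(\{9\}\times\{11\})$. (RP) $\gamma_{12'}\gamma_{12}\gamma_{11'}\gamma_{11}\cdots\gamma_{1'}\gamma_1=e$. *)

(* Defs.v *)
From HB Require Import structures.
From mathcomp Require Import all_boot all_order all_algebra all_fingroup.
From mathcomp Require Import generic_quotient complex.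
From mathcomp Require Import all_classical all_reals all_analysis.
(* The notations of mpoly clash with those of MathComp-Analysis. *)
From mathcomp Require Import -(notations) mpoly.

Set Implicit Arguments.
Unset Strict Implicit.
Unset Printing Implicit Defensive.

Import Order.TTheory GRing.Theory Num.Theory numFieldNormedType.Exports.

Local Open Scope classical_set_scope.
Local Open Scope ring_scope.
Local Open Scope quotient_scope.

(** * Group theory *)

Section Groups.
Local Open Scope group_scope.

(* MathComp's [~ x, y] is x^-1 * y^-1 * x * y, hence these two definitions. *)
Definition commw (G : groupType) (x y : G) : G := x * y * x^-1 * y^-1.
Definition braidw (G : groupType) (x y : G) : G :=
  x * y * x * y^-1 * x^-1 * y^-1.

Definition subgroup (G : groupType) (K : set G) : Prop :=
  [/\ K 1, forall x y, K x -> K y -> K (x * y) & forall x, K x -> K x^-1].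

Definition normal_subgroup (G : groupType) (K : set G) : Prop :=
  subgroup K /\ forall x y, K x -> K (y * x * y^-1).

Definition normal_closure (G : groupType) (A : set G) : set G :=
  [set x | forall K, normal_subgroup K -> A `<=` K -> K x].

Definition generated_by (G : groupType) (I : Type) (g : I -> G) : Prop :=
  forall K, subgroup K -> (forall i, K (g i)) -> K = [set: G].

(* A system of relations on a family of generators indexed by I is given as
   the property, for a family of elements of any group, of satisfying it; a
   presentation is expressed by its universal property. *)
Definition presented_by (I : Type) (rel : forall H : groupType, (I -> H) -> Prop)
    (G : groupType) (g : I -> G) : Prop :=
  [/\ generated_by g, rel G g &
      forall (H : groupType) (h : I -> H), rel H h ->
        exists phi : {multiplicative G -> H}, forall i, phi (g i) = h i].

(* q exhibits Q as the quotient of G by the normal closure of A *)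
Definition quotient_by (G Q : groupType) (A : set G)
    (q : {multiplicative G -> Q}) : Prop :=
  (forall y, exists x, q x = y) /\
  (forall x, q x = 1 <-> normal_closure A x).

Definition short_exact (K G H : groupType)
    (i : {multiplicative K -> G}) (p : {multiplicative G -> H}) : Prop :=
  [/\ injective i, forall y, exists x, p x = y &
      forall x, p x = 1 <-> exists z, i z = x].

Definition abelian_group (G : groupType) : Prop :=
  forall x y : G, x * y = y * x.

Definition metabelian (G : groupType) : Prop :=
  exists (K H : groupType)
         (i : {multiplicative K -> G}) (p : {multiplicative G -> H}),
    [/\ abelian_group K, abelian_group H & short_exact i p].

Definition central_extension (K G H : groupType) : Prop :=
  exists (i : {multiplicative K -> G}) (p : {multiplicative G -> H}),
    short_exact i p /\ forall z x, i z * x = x * i z.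

End Groups.

(** * The shadow and the presentation of the group of the branch curve *)

(* Vertices are numbered 1 to 6 and edges 1 to 12; the index i : 'I_12 stands
   for the edge number i.+1. *)
Definition triangles : seq (seq nat) :=
  [:: [:: 1; 6; 5]; [:: 1; 5; 3]; [:: 1; 3; 2]; [:: 1; 2; 6];
      [:: 4; 5; 3]; [:: 4; 5; 6]; [:: 4; 6; 2]; [:: 4; 2; 3]]%N.
Definition triangle (s : 'I_8) : seq nat := nth [::] triangles s.

Definition edges : seq (seq nat) :=
  [:: [:: 1; 6]; [:: 1; 5]; [:: 1; 2]; [:: 1; 3]; [:: 3; 5]; [:: 2; 3];
      [:: 3; 4]; [:: 2; 6]; [:: 5; 6]; [:: 4; 5]; [:: 2; 4]; [:: 4; 6]]%N.
Definition edge (i : 'I_12) : seq nat := nth [::] edges i.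

Definition edge_of_triangle (i : 'I_12) (s : 'I_8) : bool :=
  all (mem (triangle s)) (edge i).

Definition common_vertices (s t : 'I_8) : nat :=
  count (mem (triangle t)) (triangle s).

Definition disjoint_edges (i j : 'I_12) : bool :=
  ~~ has (mem (edge j)) (edge i).

Lemma disjoint_edges_list (i j : 'I_12) : (i < j)%N ->
  disjoint_edges i j =
  ((i.+1, j.+1) \in
   [:: (1, 5); (1, 6); (1, 7); (1, 10); (1, 11);
       (2, 6); (2, 7); (2, 8); (2, 11); (2, 12);
       (3, 5); (3, 7); (3, 9); (3, 10); (3, 12);
       (4, 8); (4, 9); (4, 10); (4, 11); (4, 12);
       (5, 8); (5, 11); (5, 12);
       (6, 9); (6, 10); (6, 12);
       (7, 8); (7, 9); (8, 10); (9, 11)]%N).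
Proof.
case: i j => i hi [j hj]; rewrite /disjoint_edges /edge /=.
by do 12 (case: i hi => [|i] hi;
     first by do 12 (case: j hj => [|j] hj; first by []));
  move: hi; rewrite !ltnS ltn0.
Qed.

(* The generator gamma_i has index (i, false), and gamma_i' index (i, true). *)
Definition gen : Type := ('I_12 * bool)%type.

Section Relations.
Local Open Scope group_scope.

Definition vertex_relations (G : groupType) (a a' b b' c c' d d' : G) : Prop :=
  (braidw a' b = 1 /\ braidw a' b' = 1 /\
     braidw a' (b^-1 * b' * b) = 1) /\
  (braidw c d = 1 /\ braidw c' d = 1 /\
     braidw (c^-1 * c' * c) d = 1) /\
  (commw (b' * b * a' * b^-1 * b'^-1) d = 1) /\
  (commw (b' * b * a' * b^-1 * b'^-1)
         (c^-1 * c'^-1 * d^-1 * d' * d * c' * c) = 1) /\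
  (braidw a b = 1 /\ braidw a b' = 1 /\
     braidw a (b^-1 * b' * b) = 1) /\
  (braidw c (d^-1 * d' * d) = 1 /\ braidw c' (d^-1 * d' * d) = 1 /\
     braidw (c^-1 * c' * c) (d^-1 * d' * d) = 1) /\
  (commw (b' * b * a * b^-1 * b'^-1) (d^-1 * d' * d) = 1) /\
  (commw (b' * b * a * b^-1 * b'^-1)
         (c^-1 * c'^-1 * d^-1 * d'^-1 * d * d' * d * c' * c) = 1) /\
  (b' * b * a' * b * a'^-1 * b^-1 * b'^-1 = d * c' * d^-1) /\
  (b' * b * a' * b' * a'^-1 * b^-1 * b'^-1 = d * c' * c * c'^-1 * d^-1) /\
  (b' * b * a * b * a^-1 * b^-1 * b'^-1 =
     d^-1 * d' * d * c' * d^-1 * d'^-1 * d) /\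
  (b' * b * a * b' * a^-1 * b^-1 * b'^-1 =
     d^-1 * d' * d * c' * c * c'^-1 * d^-1 * d'^-1 * d).

Definition vertex_edges : seq (nat * nat * nat * nat) :=
  [:: (1, 2, 3, 4); (3, 6, 8, 11); (4, 5, 6, 7); (7, 10, 11, 12);
      (2, 5, 9, 10); (1, 8, 9, 12)]%N.

Definition branch_relations (G : groupType) (g : gen -> G) : Prop :=
  [/\ forall i j k l : 'I_12, (i.+1, j.+1, k.+1, l.+1) \in vertex_edges ->
        vertex_relations (g (i, false)) (g (i, true))
          (g (j, false)) (g (j, true)) (g (k, false)) (g (k, true))
          (g (l, false)) (g (l, true)),
      forall i j, disjoint_edges i j ->
        forall s t : bool, commw (g (i, s)) (g (j, t)) = 1 &
      \big[mulg/1]_(i < 12) (g (rev_ord i, true) * g (rev_ord i, false)) = 1].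

End Relations.

(** * Fundamental groups *)

Section FundamentalGroup.
Variables (R : realType) (T : topologicalType) (x : T).

(* A path is a function on the line of which only the restriction to [0, 1]
   matters. *)
Definition is_loop (f : R -> T) : Prop :=
  [/\ {within `[0, 1], continuous f}, f 0 = x & f 1 = x].

Definition loop_concat (f g : R -> T) : R -> T :=
  fun t => if t <= 2^-1 then f (2 * t) else g (2 * t - 1).

Definition loop_homotopic (f g : R -> T) : Prop :=
  exists H : R * R -> T,
    [/\ {within `[0, 1] `*` `[0, 1], continuous H},
        forall t, t \in `[0, 1] -> H (t, 0) = f t,
        forall t, t \in `[0, 1] -> H (t, 1) = g t &
        forall s, s \in `[0, 1] -> H (0, s) = x /\ H (1, s) = x].

(* cl, which sends a loop to its class, exhibits P as the group pi_1(T, x) of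
   homotopy classes of loops, with the product induced by concatenation. *)
Definition is_fundamental_group (P : groupType) (cl : (R -> T) -> P) : Prop :=
  [/\ forall u, exists2 f, is_loop f & cl f = u,
      forall f g, is_loop f -> is_loop g ->
        (cl f = cl g <-> loop_homotopic f g) &
      forall f g, is_loop f -> is_loop g ->
        cl (loop_concat f g) = (cl f * cl g)%g].

End FundamentalGroup.

(** * Complex projective geometry *)

(* The type is given as a numClosedFieldType so as to inherit the topology of
   a normed field. *)
Definition Cplx (R : realType) : numClosedFieldType := complex R.

Section ProjectiveSpace.
Variable R : realType.
Local Notation C := (Cplx R).

Definition nzvec (n : nat) : Type :=
  set_type [set v : 'rV[C]_n.+1 | v != 0].

HB.instance Definition _ n := Topological.on (nzvec n).
HB.instance Definition _ n := Choice.on (nzvec n).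

Definition collinear (n : nat) (u v : nzvec n) : bool :=
  `[< exists2 c : C, c != 0 & val u = c *: val v >].

Lemma collinear_equiv n : equiv_class_of (@collinear n).
Proof.
split.
- by move=> u; apply/asboolP; exists 1; rewrite ?oner_neq0 ?scale1r.
- move=> u v; apply/asboolP/asboolP => -[c c0 ->]; exists c^-1;
    by rewrite ?invr_eq0// scalerA mulVf// scale1r.
- move=> v u w /asboolP[c c0 uv] /asboolP[d d0 vw]; apply/asboolP.
  by exists (c * d); rewrite ?mulf_neq0// uv vw scalerA.
Qed.

Canonical collinear_equivRel n := EquivRelPack (@collinear_equiv n).

Definition CP (n : nat) : Type :=
  quotient_topology {eq_quot (collinear_equivRel n)}.
HB.instance Definition _ n := Topological.on (CP n).
HB.instance Definition _ n := Quotient.on (CP n).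

Definition hvec (n : nat) (x : CP n) : 'rV[C]_n.+1 := val (repr x).

Lemma e0_neq0 n : [set v : 'rV[C]_n.+1 | v != 0] (delta_mx 0 0).
Proof.
apply/negP => /eqP/matrixP/(_ 0 0); rewrite !mxE !eqxx => /eqP.
by rewrite oner_eq0.
Qed.

(* The point with homogeneous coordinates v (junk value if v = 0). *)
Definition hpoint (n : nat) (v : 'rV[C]_n.+1) : CP n :=
  \pi_(CP n) (insubd (SigSub (mem_set (e0_neq0 n)) : nzvec n) v : nzvec n).

(* The linear projection [x] |-> [x A], defined away from its center, that is
   on the points such that hvec x *m A != 0. *)
Definition lin_proj (n m : nat) (A : 'M[C]_(n.+1, m.+1)) (x : CP n) : CP m :=
  hpoint (hvec x *m A).

Definition hpoly (n : nat) : Type := mpoly.mpoly n.+1 C.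

Definition heval (n : nat) (p : hpoly n) (v : 'rV[C]_n.+1) : C :=
  mpoly.meval (fun i => v 0 i) p.

Definition homogeneous (n d : nat) (p : hpoly n) : Prop :=
  forall m, mpoly.mcoeff m p != 0 -> mpoly.mdeg m = d.

Definition zeros (n k : nat) (F : 'I_k -> hpoly n) : set (CP n) :=
  [set x | forall j, heval (F j) (hvec x) = 0].

Definition jacobian (n k : nat) (F : 'I_k -> hpoly n) (v : 'rV[C]_n.+1) :
    'M[C]_(k, n.+1) :=
  \matrix_(j, i) heval (mpoly.mderiv i (F j)) v.

(* Jacobian criterion for the scheme F = 0 to be smooth of pure dimension 2:
   its affine cone has dimension 3, so that the rank is n + 1 - 3. *)
Definition smooth_2dim (n k : nat) (F : 'I_k -> hpoly n) : Prop :=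
  forall x, zeros F x -> (\rank (jacobian F (hvec x)) + 3 = n.+1)%N.

Definition smooth_projective_surface (n : nat) (X : set (CP n)) : Prop :=
  connected X /\
  exists k (F : 'I_k -> hpoly n),
    [/\ forall j, exists d, homogeneous d (F j), smooth_2dim F & X = zeros F].

Definition for_generic (m n : nat) (P : 'M[C]_(m, n) -> Prop) : Prop :=
  exists2 D : mpoly.mpoly (m * n) C, D != 0 &
    forall A, mpoly.meval (fun i => mxvec A 0 i) D != 0 -> P A.

(* A generic linear subspace of codimension 2 meets X in d points. *)
Definition surface_degree (n d : nat) (X : set (CP n)) : Prop :=
  for_generic (fun B : 'M[C]_(n.+1, 2) =>
    (X `&` [set x | hvec x *m B = 0] #= `I_d)%card).

(** * Projective degeneration to a union of planes *)

(* The rows of the matrices P s span the planes. Two planes meet in a line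
   (a point, not at all) if the triangles have an edge (just a vertex,
   nothing) in common: the rank is that of the intersection of the cones. *)
Definition planes_with_shadow (n : nat) (P : 'I_8 -> 'M[C]_(3, n.+1)) : Prop :=
  forall s t, \rank (P s :&: P t)%MS = common_vertices s t.

Definition union_planes (n : nat) (P : 'I_8 -> 'M[C]_(3, n.+1)) : set (CP n) :=
  [set x | exists s, (hvec x <= P s)%MS].

Definition unit_disc : set C := [set t | `|t| < 1].

Definition total_space (n k : nat) (F : 'I_k -> C -> hpoly n) :
    set (C * CP n) :=
  [set z | unit_disc z.1 /\ zeros (F^~ z.1) z.2].

(* The projective degeneration of X = V_t0 to X0 = V_0. The space V is the
   closed analytic subspace of Delta x P^n given by equations F j t, homogeneous
   with coefficients holomorphic in t; the map to Delta x P^2 is induced by the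
   projection A. *)
Record projective_degeneration (n k : nat) (X X0 : set (CP n))
    (A : 'M[C]_(n.+1, 3)) (F : 'I_k -> C -> hpoly n) (t0 : C) : Prop := {
  pd_homogeneous : forall j, exists d,
    forall t, unit_disc t -> homogeneous d (F j t);
  pd_holomorphic : forall j m t, unit_disc t ->
    derivable (fun s : C => mpoly.mcoeff m (F j s) : C) t 1;
  pd_smooth : forall t, unit_disc t -> t != 0 -> smooth_2dim (F^~ t);
  pd_special : zeros (F^~ 0) = X0;
  (* The scheme V_0 is reduced: up to saturation, the equations of V_0 generate
     the homogeneous ideal of X0. *)
  pd_reduced : exists d0, forall d (p : hpoly n), (d0 <= d)%N ->
    homogeneous d p -> (forall x, X0 x -> heval p (hvec x) = 0) ->
    exists H : 'I_k -> hpoly n, p = \sum_j H j * F j 0;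
  (* The fibres being reduced, V is flat over the disc if and only if no
     component of a fibre is a component of V. *)
  pd_flat : forall t x, total_space F (t, x) ->
    closure (total_space F `&` [set z | z.1 != t]) (t, x);
  pd_disc : unit_disc t0;
  pd_neq0 : t0 != 0;
  pd_general : zeros (F^~ t0) = X;
  pd_projection : forall t x, total_space F (t, x) -> hvec x *m A != 0
}.

Definition degenerates_to_X4 (n : nat) (X : set (CP n))
    (A : 'M[C]_(n.+1, 3)) : Prop :=
  exists (P : 'I_8 -> 'M[C]_(3, n.+1)) (k : nat) (F : 'I_k -> C -> hpoly n)
         (t0 : C),
    planes_with_shadow P /\
    projective_degeneration X (union_planes P) A F t0.

(** * Branch curve and Galois cover of the projection of X *)

(* The image of the ramification points, at which the projection restricted to
   X is not locally injective. *)
Definition branch_curve (n : nat) (X : set (CP n)) (A : 'M[C]_(n.+1, 3)) :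
    set (CP 2) :=
  [set b | exists x, [/\ X x, lin_proj A x = b &
    forall U, nbhs x U -> exists y z,
      [/\ (X `&` U) y, (X `&` U) z, y <> z & lin_proj A y = lin_proj A z]]].

Definition galois_cover (n m : nat) (X : set (CP n)) (A : 'M[C]_(n.+1, 3)) :
    set {ptws 'I_m -> CP n} :=
  closure [set u : {ptws 'I_m -> CP n} |
    [/\ forall i, X (u i), forall i j, lin_proj A (u i) = lin_proj A (u j) &
        forall i j, i != j -> u i <> u j]].

End ProjectiveSpace.

(* Main.v *)
Require Import Defs.
From HB Require Import structures.
From mathcomp Require Import all_boot all_order all_algebra all_fingroup.
From mathcomp Require Import all_classical all_reals all_analysis.
Set Implicit Arguments.
Unset Strict Implicit.
Unset Printing Implicit Defensive.
Import GRing.Theory.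

(* The proof is purely group-theoretic. In Q = G / <<gamma^2>> the relations
   at the two ends of an edge combine to show that generators attached to edges
   without common triangle commute and that those attached to two edges of a
   triangle satisfy the braid relation, while (RP) makes gamma_i and gamma_i'
   commute for enough i. The conjugates of the generators are then elements T p q a
   over the transpositions (p q), with a label a in F_2^3, that act on one another
   as transpositions twisted by labels; that there are no more of them follows from
   an enumeration in the manner of Todd and Coxeter, which is run by computation.
   The finite group [twisted] of triples (s, v, c), with s in S_8, v in (F_2^3)^8
   and c in F_2^3, contains such elements too, and a normal form for products of
   elements T p q a shows that every relation between those of [twisted] holds
   between those of Q. Conversely, the relations of G hold in [twisted] modulo the
   subgroup of order 2 generated by the value r of the left-hand side of (RP). So
   pi_1(X_Gal) is the group of the (1, v, c) with sum v = 0, modulo r: here c gives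
   the central (Z/2)^3, and v modulo the constant family of r gives (Z/2)^20. *)

(** The words face, adjacent and parallel refer to the cube dual to the octahedron: its vertices are
    the eight triangles, its edges the twelve transpositions, its faces the six systems (R4). On a
    face, [gamma_i' * gamma_i] has the same label for parallel edges, so there is one independent
    label for each of the three directions of the cube; this is where F_2^3 comes from. Every vertex
    of the cube lies on one edge of each direction, so [r] has the same label (1,1,1) at all eight
    points. The order is 2^21 for [v], times 2^3 for [c], divided by 2. Labels over one
    transposition are not simply additive: the product of the elements labelled 0, a, b, a + b is
    central and alternating in a, b, and the alternating square of F_2^3 is the central (Z/2)^3. The
    obstacle is to map the model to [Q] without a presentation of the model. The normal form is
    therefore proved for an arbitrary family [T] and applied inside the product [twisted * Q], where
    it shows that the pairs of corresponding elements generate the graph of a map. In the other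
    direction the universal property of [G] is enough. *)

Section Involutions.
Local Open Scope group_scope.
Variable G : groupType.
Implicit Types x y z u v : G.

Definition braid x y := x * y * x = y * x * y.

Lemma invol_inv x : x * x = 1 -> x^-1 = x.
Proof. exact: mulg1_eq. Qed.

Lemma involK x u : x * x = 1 -> x * (x * u) = u.
Proof. by move=> xx; rewrite mulgA xx mul1g. Qed.

Lemma braidC x y : braid x y -> braid y x.
Proof. by rewrite /braid => ->. Qed.

Lemma braidA x y u : braid x y -> x * (y * (x * u)) = y * (x * (y * u)).
Proof. by rewrite /braid => b; rewrite !mulgA b. Qed.

Lemma braidw_braid x y : x * x = 1 -> y * y = 1 -> braidw x y = 1 -> braid x y.
Proof.
move=> xx yy; rewrite /braidw !invol_inv// /braid => e.
have := congr1 (fun u => u * (y * x * y)) e; rewrite mul1g => <-.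
by rewrite -!mulgA (involK _ yy) (involK _ xx) yy mulg1.
Qed.

Lemma commw_commute x y : commw x y = 1 <-> commute x y.
Proof.
rewrite /commw /commute; split => e; last by rewrite e mulgK mulgV.
by have := congr1 (fun u => u * y * x) e; rewrite mul1g !mulgVK.
Qed.

Lemma conj_mul_commute u v x : commute u x ->
  v * u * x * (v * u)^-1 = v * x * v^-1.
Proof. by move=> ux; rewrite invgM -(mulgA v) ux !mulgA mulgK. Qed.

Lemma braid_conj u x y :
  braid (u * x * u^-1) (u * y * u^-1) <-> braid x y.
Proof.
rewrite /braid !mulgA !mulgVK; split => [/mulIg|e].
  by rewrite -!mulgA => /mulgI; rewrite !mulgA.
by rewrite -!(mulgA u) e.
Qed.

(** Conjugating the last hypothesis by [y] and the goal by [x * z] turns both into the braid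
    relation between [z] and [x * y * x]. The relations at a vertex involve [b * b' * b], the
    squares below [b' * b * b']; this lemma links the two. *)
Lemma braid_dihedral x y z : x * x = 1 -> y * y = 1 -> z * z = 1 ->
  braid x y -> braid x z -> braid x (y * z * y) -> braid x (z * y * z).
Proof.
move=> xx yy zz xy xz /(braid_conj y); rewrite (invol_inv yy).
have -> : y * x * y = x * y * x by rewrite xy.
rewrite -!mulgA (involK _ yy) yy mulg1 !mulgA => wz.
apply/(braid_conj (x * z)); rewrite invgM !invol_inv// -!mulgA.
rewrite (involK _ zz) (involK _ zz).
have -> : x * (z * (x * (z * x))) = z.
  have -> : z * (x * (z * x)) = x * z by rewrite -(braidA _ xz) xx mulg1.
  exact: involK.
by rewrite !mulgA; apply: braidC.
Qed.

(** * Consequences of the relations (R4) at one vertex for involutions *)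

Section Face.
Variables a a' b b' c c' d d' : G.
Hypothesis invol : [/\ a * a = 1, a' * a' = 1, b * b = 1 & b' * b' = 1] /\
  [/\ c * c = 1, c' * c' = 1, d * d = 1 & d' * d' = 1].
Hypothesis rel : vertex_relations a a' b b' c c' d d'.

Let D := d * d' * d.
Let b2 := b' * b * b'.
Let c2 := c' * c * c'.

Lemma face_involutions : [/\ D * D = 1, b2 * b2 = 1 & c2 * c2 = 1].
Proof.
case: invol => -[_ _ bb b'b'] [cc c'c' dd d'd'].
by split; rewrite /D /b2 /c2 -!mulgA !(involK _ bb, involK _ b'b', involK _ cc,
  involK _ c'c', involK _ dd, involK _ d'd').
Qed.

Lemma face_braids : [/\ [/\ braid a b, braid a b', braid a' b & braid a' b'],
  braid a b2 /\ braid a' b2,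
  [/\ braid c d, braid c' d & braid c2 d] &
  [/\ braid c D, braid c' D & braid c2 D]].
Proof.
have [DD b2b2 c2c2] := face_involutions.
case: invol => -[aa a'a' bb b'b'] [cc c'c' dd d'd'].
case: rel; rewrite !(invol_inv bb) !(invol_inv cc) !(invol_inv dd).
have invol_conj x y : x * x = 1 -> y * y = 1 -> x * y * x * (x * y * x) = 1.
  by move=> xx yy; rewrite -!mulgA (involK _ xx) (involK _ yy).
have bb'b := invol_conj _ _ bb b'b'; have cc'c := invol_conj _ _ cc c'c'.
have swap x y : x * x = 1 -> y * y = 1 -> braidw x y = 1 -> braid y x.
  by move=> xx yy e; apply/braidC/braidw_braid.
move=> [e1 [e2 e3]] [[e4 [e5 e6]] [_ [_ [[e7 [e8 e9]] [[e10 [e11 e12]] _]]]]].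
split; split; try by apply: braidw_braid.
- by apply: braid_dihedral => //; apply: braidw_braid.
- by apply: braid_dihedral => //; apply: braidw_braid.
- by apply/braidC/braid_dihedral => //; apply: swap.
- by apply/braidC/braid_dihedral => //; apply: swap.
Qed.

(* In these relations a, a' correspond to D, d, and b', b2 to c', c2. *)
Lemma face_squares :
  [/\ b' * a' * b' = d * c' * d, b2 * a' * b2 = d * c2 * d,
      b' * a * b' = D * c' * D & b2 * a * b2 = D * c2 * D].
Proof.
have [[ab ab' a'b a'b'] _ _ _] := face_braids.
case: invol => -[aa a'a' bb b'b'] [cc c'c' dd d'd'].
have e1 x : braid x b -> b' * b * x * b * x * b * b' = b' * x * b'.
  by move=> /braidA xb; rewrite -!mulgA xb !(involK _ bb).
have e2 x : braid x b' -> b' * b * x * b' * x * b * b' = b2 * x * b2.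
  by move=> /braidA xb'; rewrite /b2 -!mulgA xb'.
case: rel => _ [_ [_ [_ [_ [_ [_ [_]]]]]]].
rewrite !invol_inv// e1// e1// e2// e2// => -[-> [-> [-> ->]]].
by split; rewrite /D /c2 ?mulgA.
Qed.

Lemma conjugate_eq x y z w : x * x = 1 -> x * y * x = z * w * z ->
  y = x * (z * w * z) * x.
Proof. by move=> xx <-; rewrite -!mulgA xx mulg1 involK. Qed.

Let commutes u x y := commute u x /\ commute u y.

(* Each edge of a face is in the group generated by the other three. *)
Lemma face_centralizer u :
  [/\ commutes u b b' -> commutes u c c' -> commutes u d d' -> commutes u a a',
      commutes u a a' -> commutes u c c' -> commutes u d d' -> commutes u b b',
      commutes u a a' -> commutes u b b' -> commutes u d d' -> commutes u c c' &
      commutes u a a' -> commutes u b b' -> commutes u c c' ->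
      commutes u d d'].
Proof.
have [DD b2b2 c2c2] := face_involutions.
have [[ab ab' a'b a'b'] [ab2 a'b2] [cd c'd c2d] [cD c'D c2D]] := face_braids.
case: invol => -[aa a'a' bb b'b'] [cc c'c' dd d'd'].
have [e1 e2 e3 e4] := face_squares.
have com3 x y : commute u x -> commute u y -> commute u (x * y * x).
  by move=> ux uy; do !apply: commuteM.
have comD : commute u d -> commute u d' -> commute u D by move=> ? ?; apply: (com3).
split=> -[u1 u2] [u3 u4] [u5 u6].
- have uD := comD u5 u6.
  by rewrite (conjugate_eq b'b' e1) (conjugate_eq b'b' e3); split; do !apply: (com3).
- have ub' : commute u b'.
    by rewrite (conjugate_eq a'a' (etrans a'b' e1)); do !apply: (com3).
  have ub2 : commute u b2.
    by rewrite (conjugate_eq a'a' (etrans a'b2 e2)); do !apply: (com3).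
  split=> //; have -> : b = b' * b2 * b' by rewrite /b2 -!mulgA b'b' mulg1 involK.
  exact: (com3).
- have uc' : commute u c'.
    by rewrite (conjugate_eq dd (esym e1)); do !apply: (com3).
  have uc2 : commute u c2.
    rewrite (conjugate_eq dd (esym e2)); apply: (com3) => //.
    by apply: (com3) => //; apply: (com3).
  split=> //; have -> : c = c' * c2 * c' by rewrite /c2 -!mulgA c'c' mulg1 involK.
  exact: (com3).
- have ud : commute u d.
    rewrite (conjugate_eq c'c' (etrans c'd (esym e1))).
    by apply: (com3) => //; apply: (com3).
  have uD : commute u D.
    rewrite (conjugate_eq c'c' (etrans c'D (esym e3))).
    by apply: (com3) => //; apply: (com3).
  split=> //; have -> : d' = d * D * d by rewrite /D -!mulgA dd mulg1 involK.
  exact: (com3).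
Qed.

Hypothesis ad : [/\ commute a d, commute a d', commute a' d & commute a' d'].
Hypothesis bc : [/\ commute b c, commute b c', commute b' c & commute b' c'].

Let delta_a := a' * a.
Let delta_b := b' * b.
Let delta_c := c' * c.
Let delta_d := d' * d.

(* Comparing the relations for two elements in the same position, as in
   y = x x^ y^ x^ x = z z^ y^ z^ z. *)
Lemma face_deltas :
  [/\ commutes (delta_a * delta_d) b b', commutes (delta_a * delta_d) c c',
      commutes (delta_b * delta_c) a a' & commutes (delta_b * delta_c) d d'].
Proof.
have [DD b2b2 c2c2] := face_involutions.
have [[ab ab' a'b a'b'] [ab2 a'b2] [cd c'd c2d] [cD c'D c2D]] := face_braids.
case: invol => -[aa a'a' bb b'b'] [cc c'c' dd d'd'].
have [e1 e2 e3 e4] := face_squares.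
have [[ad_ ad' a'd a'd'] [bc_ bc' b'c b'c']] := (ad, bc).
have com3 u x y : commute u x -> commute u y -> commute u (x * y * x).
  by move=> ux uy; do !apply: commuteM.
have main x xh z zh y yh : x * x = 1 -> xh * xh = 1 -> z * z = 1 ->
    zh * zh = 1 -> commute x xh -> commute x zh -> commute z zh ->
    x * y * x = xh * yh * xh -> z * y * z = zh * yh * zh ->
    commutes (z * x * (zh * xh)) y yh.
  move=> xx xhxh zz zhzh xxh xzh zzh ex ez.
  have e x0 xh0 y0 yh0 : x0 * x0 = 1 -> xh0 * xh0 = 1 ->
      x0 * y0 * x0 = xh0 * yh0 * xh0 ->
      y0 * (x0 * xh0) = x0 * xh0 * yh0 /\ yh0 * (xh0 * x0) = xh0 * x0 * y0.
    move=> x0x0 xh0xh0 e; rewrite -!mulgA; split.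
      by rewrite {1}(conjugate_eq x0x0 e) -!mulgA !(involK _ x0x0) xh0xh0 mulg1.
    by rewrite {1}(conjugate_eq xh0xh0 (esym e)) -!mulgA !(involK _ xh0xh0) x0x0
      mulg1.
  have [x1 x2] := e _ _ _ _ xx xhxh ex; have [z1 z2] := e _ _ _ _ zz zhzh ez.
  split; rewrite /commute.
    have -> : z * x * (zh * xh) = z * zh * (xh * x).
      by rewrite -!mulgA (mulgA x) xzh -mulgA xxh.
    by rewrite -mulgA -x2 !mulgA -(mulgA y) z1.
  have -> : z * x * (zh * xh) = zh * z * (x * xh).
    by rewrite -!mulgA (mulgA x) xzh !mulgA zzh.
  by rewrite -mulgA -x1 !mulgA -(mulgA yh) z2.
have aDd : a' * a * (d * D) = delta_a * delta_d.
  by rewrite /D -!mulgA (involK _ dd).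
have b2c2E : b2 * b' * (c2 * c') = delta_b * delta_c.
  by rewrite /b2 /c2 -!mulgA (involK _ b'b') c'c' mulg1.
have aD : commute a D by exact: (com3).
have [b2c' b'c2] : commute b2 c' /\ commute b' c2.
  by split; [apply/commute_sym/(com3); apply/commute_sym | apply: (com3)].
have b2c2 : commute b2 c2.
  apply: (com3) => //; apply/commute_sym/(com3); exact/commute_sym.
have uncon x y : y * y = 1 -> x = y * (y * x * y) * y.
  by move=> yy; rewrite -!mulgA yy mulg1 involK.
have bE : b = b' * b2 * b' by exact: uncon.
have cE : c = c' * c2 * c' by exact: uncon.
have d'E : d' = d * D * d by exact: uncon.
have [ub' uc'] := main _ _ _ _ _ _ aa DD a'a' dd aD ad_ a'd
  (etrans ab' e3) (etrans a'b' e1).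
have [ub2 uc2] := main _ _ _ _ _ _ aa DD a'a' dd aD ad_ a'd
  (etrans ab2 e4) (etrans a'b2 e2).
have [ua' ud] := main _ _ _ _ _ _ b'b' c'c' b2b2 c2c2 b'c' b'c2 b2c2
  (etrans e1 (esym c'd)) (etrans e2 (esym c2d)).
have [ua uD] := main _ _ _ _ _ _ b'b' c'c' b2b2 c2c2 b'c' b'c2 b2c2
  (etrans e3 (esym c'D)) (etrans e4 (esym c2D)).
rewrite -aDd -b2c2E; split; split=> //.
- by rewrite bE; exact: (com3).
- by rewrite cE; exact: (com3).
- by rewrite d'E; exact: (com3).
Qed.

Lemma braid_commute u x y : braid x y -> commute u x ->
  braid x (u * y * u^-1).
Proof.
by move=> xy ux; have /(braid_conj u) := xy; rewrite (_ : u * x * u^-1 = x)// ux mulgK.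
Qed.

(** (R4) gives braid relations only between the generators [a, b] and between the generators [c, d],
    partly through the conjugates [b2], [c2] and [D]. The squares carry them over to the other two
    corners of the face. *)
Lemma face_adjacent :
  [/\ [/\ braid a b, braid a b', braid a' b & braid a' b'],
      [/\ braid a c, braid a c', braid a' c & braid a' c'],
      [/\ braid d b, braid d b', braid d' b & braid d' b'] &
      [/\ braid d c, braid d c', braid d' c & braid d' c']].
Proof.
have [DD b2b2 c2c2] := face_involutions.
have [abs [ab2 a'b2] [cd c'd c2d] [cD c'D c2D]] := face_braids.
case: invol => -[aa a'a' bb b'b'] [cc c'c' dd d'd'].
have [e1 e2 e3 e4] := face_squares.
have [[ad_ ad' a'd a'd'] [bc_ bc' b'c b'c']] := (ad, bc).
have [[adb adb'] [adc adc'] [bca bca'] [bcd bcd']] := face_deltas.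
have aD : commute a D by do !apply: commuteM.
(* From x y x = x^ y^ x^, both <x, y^> and <x^, y> are conjugates of
   <x, y> and <x^, y^>. *)
have main x xh y yh : x * x = 1 -> xh * xh = 1 -> commute x xh ->
    x * y * x = xh * yh * xh -> braid x y -> braid xh yh ->
    braid x yh /\ braid xh y.
  have half x0 xh0 y0 yh0 : x0 * x0 = 1 -> xh0 * xh0 = 1 -> commute x0 xh0 ->
      x0 * y0 * x0 = xh0 * yh0 * xh0 -> braid x0 y0 -> braid x0 yh0.
    move=> x0x0 xh0xh0 x0xh0 e0 /(braid_conj x0); rewrite (invol_inv x0x0) e0.
    rewrite -mulgA x0x0 mulg1 => ?; apply/(braid_conj xh0).
    by rewrite (invol_inv xh0xh0) -x0xh0 -(mulgA x0) xh0xh0 mulg1.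
  move=> xx xhxh xxh e xy xhyh; split; first exact: half e _.
  by apply: (half xh x yh y).
have [[ab ab' a'b a'b'] c'D' c'd'] := And3 abs (braidC c'D) (braidC c'd).
have [[ac' Db'] [ac2 Db2]] := (main _ _ _ _ aa DD aD (etrans ab' e3) ab' (braidC c'D),
  main _ _ _ _ aa DD aD (etrans ab2 e4) ab2 (braidC c2D)).
have [[a'c' db'] [a'c2 db2]] :=
  (main _ _ _ _ a'a' dd a'd (etrans a'b' e1) a'b' (braidC c'd),
   main _ _ _ _ a'a' dd a'd (etrans a'b2 e2) a'b2 (braidC c2d)).
pose u := (delta_b * delta_c)^-1; pose v := delta_a * delta_d.
have commV x y z : commute x z -> (x * y)^-1 * z * (x * y) = y^-1 * z * y.
  by move=> xz; rewrite invgM -!mulgA (mulgA z) -xz -mulgA mulKg.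
have dihedral x y : x * x = 1 -> y * y = 1 ->
    (y * x)^-1 * (y * x * y) * (y * x) = x.
  by move=> xx yy; rewrite mulKg (involK _ yy).
have mulC x y z : commute x z -> commute y z -> commute (x * y) z.
  by move=> xz yz; apply/commute_sym/commuteM; exact/commute_sym.
have dbc x : commute b x -> commute b' x -> commute delta_b x.
  by move=> bx b'x; exact: mulC.
have db_c : commute delta_b c by exact: dbc.
have db_c' : commute delta_b c' by exact: dbc.
have dbdc : commute delta_b delta_c by exact: commuteM.
have uc2 : u * c2 * u^-1 = c.
  rewrite /u invgK commV; first exact: dihedral.
  by do !apply: commuteM.
have ub2 : u * b2 * u^-1 = b.
  rewrite /u dbdc invgK commV; first exact: dihedral.
  by apply/commute_sym; do !apply: mulC => //; exact: commuteM.
have vD : v * D * v^-1 = d'.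
  have daD : commute delta_a D by do !apply: commuteM; exact: mulC.
  have daV : commute delta_a delta_d by apply: commuteM; exact: mulC.
  have -> : v * D * v^-1 = delta_d * D * delta_d^-1.
    by rewrite /v daV conj_mul_commute.
  by rewrite /delta_d invgM !invol_inv// -!mulgA !(involK _ dd) (involK _ d'd').
have ux x y : commute (delta_b * delta_c) x -> braid x y -> braid x (u * y * u^-1).
  by move=> ux xy; apply: braid_commute => //; apply/commute_sym/commuteV/commute_sym.
have Db : braid D b.
  by rewrite -ub2; apply: ux => //; do !apply: commuteM.
have vx x : commute v x -> braid D x -> braid d' x.
  by move=> vx /braidC xD; rewrite -vD; apply/braidC/braid_commute.
split; split=> //; try exact: braidC.
- by rewrite -uc2; apply: ux.
- by rewrite -uc2; apply: ux.
- by rewrite -ub2; apply: ux.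
- exact: vx.
- exact: vx.
- by apply: vx => //; apply: braidC.
- by apply: vx => //; apply: braidC.
Qed.
End Face.
End Involutions.

(** * Commutation and braid relations between the generators *)

(* The two triangles that share the edge k.+1, as indices in [triangles]. *)
Definition edge_ends : seq (nat * nat) :=
  [:: (0, 3); (0, 1); (2, 3); (1, 2); (1, 4); (2, 7); (4, 7); (3, 6); (0, 5);
      (4, 5); (6, 7); (5, 6)].

Definition ends (k : nat) : nat * nat := nth (0, 0) edge_ends k.

(** The values 0, 1 and 2 correspond to commuting, braiding and equal transpositions. *)
Definition shared_ends (k l : nat) : nat :=
  let: (p, q) := ends k in let: (r, s) := ends l in
  (p == r) + (p == s) + (q == r) + (q == s).

Section BranchGroup.
Local Open Scope group_scope.
Variables (G : groupType) (g : gen -> G).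
Hypothesis invol : forall x, g x * g x = 1.
Hypothesis rel : branch_relations g.

Let w (k : nat) (s : bool) : G := g (inord k, s).

Let pcom k l := forall s t, commute (w k s) (w l t).

Let pcomC k l : pcom k l -> pcom l k.
Proof. by move=> kl s t; apply/commute_sym/kl. Qed.

Lemma disjoint_commute k l : (k < 12)%N -> (l < 12)%N ->
  ~~ has (mem (nth [::] edges l)) (nth [::] edges k) -> pcom k l.
Proof.
move=> kn ln kl s t; apply/commw_commute; case: rel => _ R _; apply: R.
by rewrite /disjoint_edges /edge !inordK.
Qed.

Lemma vertexP i j k l : (i.+1, j.+1, k.+1, l.+1) \in vertex_edges ->
  vertex_relations (w i false) (w i true) (w j false) (w j true)
    (w k false) (w k true) (w l false) (w l true).
Proof.
move=> ijkl; case: rel => R _ _; apply: R.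
have /allP/(_ _ ijkl)/and4P[? ? ? ?] :
  all (fun t => let: (i, j, k, l) := t in [&& i <= 12, j <= 12, k <= 12 & l <= 12])%N
    vertex_edges by [].
by rewrite !inordK.
Qed.

Let invol8 i j k l : [/\ w i false * w i false = 1, w i true * w i true = 1,
    w j false * w j false = 1 & w j true * w j true = 1] /\
    [/\ w k false * w k false = 1, w k true * w k true = 1,
      w l false * w l false = 1 & w l true * w l true = 1].
Proof. by split; split; apply: invol. Qed.

Let face_commute i j k l (ijkl : (i.+1, j.+1, k.+1, l.+1) \in vertex_edges) m :
  [/\ pcom m j -> pcom m k -> pcom m l -> pcom m i,
      pcom m i -> pcom m k -> pcom m l -> pcom m j,
      pcom m i -> pcom m j -> pcom m l -> pcom m k &
      pcom m i -> pcom m j -> pcom m k -> pcom m l].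
Proof.
have H s := face_centralizer (invol8 _ _ _ _) (vertexP ijkl) (w m s).
by split=> h1 h2 h3 s t; have [Hi Hj Hk Hl] := H s;
  [have := Hi | have := Hj | have := Hk | have := Hl];
  move=> /(_ (conj (h1 _ _) (h1 _ _)) (conj (h2 _ _) (h2 _ _))
     (conj (h3 _ _) (h3 _ _))) []; case: t.
Qed.

Local Open Scope nat_scope.

(* Parallel edges of a face: one of them belongs to the group generated by the
   other three edges of its second face, with which the other one commutes. *)
Lemma nonadjacent_commute k l : (k < 12)%N -> (l < 12)%N ->
  shared_ends k l = 0%N -> forall s t, commute (w k s) (w l t).
Proof.
have D := disjoint_commute.
have F i j m n := @face_commute i j m n.
have p0_3 : pcom 0 3.
  by apply: pcomC; have [] := F 0 7 8 11 isT 3 => + _ _ _; apply; apply: D.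
have p1_2 : pcom 1 2.
  by apply: pcomC; have [] := F 1 4 8 9 isT 2 => + _ _ _; apply; apply: D.
have p2_10 : pcom 2 10.
  by apply: pcomC; have [] := F 0 1 2 3 isT 10 => _ _ + _; apply; apply: D.
have p5_7 : pcom 5 7.
  by apply: pcomC; have [] := F 3 4 5 6 isT 7 => _ _ + _; apply; apply: D.
have p3_6 : pcom 3 6.
  by apply: pcomC; have [] := F 0 1 2 3 isT 6 => _ _ _; apply; apply: D.
have p4_5 : pcom 4 5.
  by apply: pcomC; have [] := F 1 4 8 9 isT 5 => _ + _ _; apply; apply: D.
have p6_11 : pcom 6 11.
  by apply: pcomC; have [] := F 3 4 5 6 isT 11 => _ _ _; apply; apply: D.
have p9_10 : pcom 9 10.
  by apply: pcomC; have [] := F 1 4 8 9 isT 10 => _ _ _; apply; apply: D.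
have p1_9 : pcom 1 9.
  by apply: pcomC; have [] := F 0 1 2 3 isT 9 => _ + _ _; apply; apply: D.
have p4_8 : pcom 4 8.
  by apply: pcomC; have [] := F 3 4 5 6 isT 8 => _ + _ _; apply; apply: D.
have p0_11 : pcom 0 11.
  by apply: pcomC; have [] := F 0 1 2 3 isT 11 => + _ _ _; apply; apply: D.
have p7_8 : pcom 7 8.
  by apply: pcomC; have [] := F 2 5 7 10 isT 8 => _ _ + _; apply; apply: D.
(* The two pairs of opposite edges at each of the six vertices. All other pairs without common
   triangle are disjoint edges, which (R5) covers. *)
pose par := [:: (0, 3); (1, 2); (2, 10); (5, 7); (3, 6); (4, 5); (6, 11);
  (9, 10); (1, 9); (4, 8); (0, 11); (7, 8)].
have parallel m n : (m, n) \in par -> pcom m n.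
  by rewrite !inE !xpair_eqE; do ?case/orP; case/andP => /eqP-> /eqP->.
move=> kn ln kl.
have /allP/(_ (k, l)) : all (fun t => let: (k, l) := t in
    (shared_ends k l == 0) ==>
    [|| ~~ has (mem (nth [::] edges l)) (nth [::] edges k), (k, l) \in par
     | (l, k) \in par]) [seq (k, l) | k <- iota 0 12, l <- iota 0 12] by [].
rewrite kl allpairs_f ?mem_iota// => /(_ isT)/or3P.
by case=> [|/parallel//|/parallel/pcomC//]; exact: D.
Qed.

Let face_par i j k l : (i.+1, j.+1, k.+1, l.+1) \in vertex_edges ->
  pcom i l /\ pcom j k.
Proof.
move=> ijkl.
have /allP/(_ _ ijkl)/and4P[i12 j12 k12 /andP[l12 /andP[/eqP il /eqP jk]]] :
  all (fun t => let: (i, j, k, l) := t in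
    [&& i <= 12, j <= 12, k <= 12, l <= 12, shared_ends i.-1 l.-1 == 0
      & shared_ends j.-1 k.-1 == 0]) vertex_edges by [].
by split; exact: nonadjacent_commute.
Qed.

Lemma adjacent_braid k l : k < 12 -> l < 12 -> shared_ends k l = 1 ->
  forall s t, braid (w k s) (w l t).
Proof.
pose pbraid m n := forall s t, braid (w m s) (w n t).
have F i j m n (ijmn : (i.+1, j.+1, m.+1, n.+1) \in vertex_edges) :
    [/\ pbraid i j, pbraid i m, pbraid n j & pbraid n m].
  have [pi pj] := face_par ijmn.
  have [||[? ? ? ?] [? ? ? ?] [? ? ? ?] [? ? ? ?]] :=
    face_adjacent (invol8 _ _ _ _) (vertexP ijmn); first by split; exact: pi.
    by split; exact: pj.
  by split=> -[] [].
move=> kn ln kl.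
have /allP/(_ (k, l)) : all (fun t => let: (k, l) := t in
    (shared_ends k l == 1) ==>
    has (fun f => let: (a, b, c, d) := f in
      (k.+1, l.+1) \in [:: (a, b); (a, c); (d, b); (d, c); (b, a); (c, a);
        (b, d); (c, d)]) vertex_edges) [seq (k, l) | k <- iota 0 12, l <- iota 0 12]
  by [].
rewrite kl allpairs_f ?mem_iota// => /(_ isT)/hasP[[[[a b] c] d] abcd].
have /allP/(_ _ abcd)/and4P[a0 b0 c0 d0] :
  all (fun t => let: (i, j, k, l) := t in [&& 0 < i, 0 < j, 0 < k & 0 < l])
    vertex_edges by [].
case: a b c d a0 b0 c0 d0 abcd => [|a] [|b] [|c] [|d]// _ _ _ _ /F[ab ac db dc].
rewrite !inE !xpair_eqE !eqSS.
by do ?case/orP; case/andP => /eqP-> /eqP-> s t => //; exact: braidC.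
Qed.

Definition edge_delta k : G := (w k true * w k false)%g.

Lemma face_delta i j k l : (i.+1, j.+1, k.+1, l.+1) \in vertex_edges ->
  [/\ forall s, commute (edge_delta i * edge_delta l)%g (w j s),
      forall s, commute (edge_delta i * edge_delta l)%g (w k s),
      forall s, commute (edge_delta j * edge_delta k)%g (w i s) &
      forall s, commute (edge_delta j * edge_delta k)%g (w l s)].
Proof.
move=> ijkl; have [pi pj] := face_par ijkl.
have [||[? ?] [? ?] [? ?] [? ?]] :=
  face_deltas (invol8 _ _ _ _) (vertexP ijkl); first by split; exact: pi.
  by split; exact: pj.
by split=> -[].
Qed.

Lemma face_square i j k l : (i.+1, j.+1, k.+1, l.+1) \in vertex_edges ->
  let d' := (w l false * w l true * w l false)%g in
  let b' := (w j true * w j false * w j true)%g in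
  let c' := (w k true * w k false * w k true)%g in
  [/\ (w j true * w i true * w j true = w l false * w k true * w l false)%g,
      (b' * w i true * b' = w l false * c' * w l false)%g,
      (w j true * w i false * w j true = d' * w k true * d')%g &
      (b' * w i false * b' = d' * c' * d')%g].
Proof. by move=> ijkl; exact: (face_squares (invol8 _ _ _ _) (vertexP ijkl)). Qed.

Local Notation delta := edge_delta.

Lemma prod_edge_delta : (delta 11 * (delta 10 * (delta 9 * (delta 8 * (delta 7 *
  (delta 6 * (delta 5 * (delta 4 * (delta 3 * (delta 2 * (delta 1 * delta 0))))
  )))))))%g = 1%g.
Proof.
case: rel => _ _ <-; rewrite !big_ord_recl big_ord0 mulg1.
do !congr mul; rewrite /edge_delta /w.
all: by congr (g (_, _)); apply/val_inj; rewrite /= inordK.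
Qed.

Let delta_commute k l : k < 12 -> l < 12 -> shared_ends k l = 0 ->
  commute (delta k) (delta l).
Proof.
move=> kn ln /(nonadjacent_commute kn ln) kl.
by apply: commuteM; apply/commute_sym/commuteM; exact/commute_sym/kl.
Qed.

Let delta_commute1 k l s : k < 12 -> l < 12 -> shared_ends k l = 0 ->
  commute (w k s) (delta l).
Proof.
move=> kn ln /(nonadjacent_commute kn ln) kl.
by apply: commuteM.
Qed.

Let delta_commute_generators k : commute (w k false) (delta k) ->
  commute (w k false) (w k true).
Proof.
move=> e; have {}e : (w k false * (w k true * w k false) = w k true)%g.
  by rewrite e -mulgA invol mulg1.
by rewrite /commute -{1}e (involK _ (invol _)).
Qed.

(* Moving around its factors, one writes the product of all delta l as a product
   of delta k and of elements that commute with both generators attached to k. *)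
Lemma edge_generators_commute k : k \in [:: 0; 1; 4] ->
  commute (w k false) (w k true).
Proof.
have comm_factor (x A y B : G) : (A * y * B = 1)%g -> commute x A -> commute x B ->
    commute x y.
  move=> AyB xA xB; have -> : y = (A^-1 * B^-1)%g.
    by rewrite -[y](mulKg A) -[X in (_ * X)%g](mulgK B) AyB mul1g.
  by apply: commuteM; exact: commuteV.
suff H : k \in [:: 0; 1; 4] -> forall s, commute (w k s) (delta k).
  by move=> /H/(_ false)/delta_commute_generators.
(* An abstract family, lest mulgA should unfold its members. *)
have [dl dlE] : exists dl, dl = edge_delta by exists edge_delta.
have C := delta_commute1; have D := delta_commute.
have E x m : (forall s, commute x (w m s)) -> commute x (edge_delta m).
  by move=> xw; exact: commuteM.
have P := prod_edge_delta; rewrite -!dlE in C D E P *.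
have := @face_delta 0 1 2 3 isT; rewrite -!dlE => -[F1j F1k F1i F1l].
have := @face_delta 3 4 5 6 isT; rewrite -!dlE => -[F3j F3k F3i F3l].
have := @face_delta 1 4 8 9 isT; rewrite -!dlE => -[F5j F5k F5i F5l].
have := @face_delta 0 7 8 11 isT; rewrite -!dlE => -[F6j F6k F6i F6l].
have mv (x y z : G) : commute x y -> (x * (y * z) = y * (x * z))%g.
  by move=> xy; rewrite mulgA xy mulgA.
have swap (x y z : G) : commute y z -> commute (y * z)%g x -> commute x (z * y)%g.
  by move=> yz; rewrite yz => /commute_sym.
rewrite !inE => /or3P[] /eqP-> s.
(* The deltas of the other sides of the two triangles at edge 0 are not known to commute with its
   generators one by one. They are paired off as in [face_delta]: 8 with 7 and 2 with 1. *)
- apply: (comm_factor _ (dl 11 * dl 10 * dl 9 * (dl 8 * dl 7) *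
    dl 6 * dl 5 * dl 4 * dl 3 * (dl 2 * dl 1%N))%g _ 1%g) => //.
    by rewrite mulg1 -P !mulgA.
  have c87 := swap _ _ _ (D 7 8 isT isT erefl) (F6i s).
  have c21 := swap _ _ _ (D 1 2 isT isT erefl) (F1i s).
    by do ?[exact: C | exact: c87 | exact: c21 | apply: commuteM].
  exact: commute1.
- have c84 := swap _ _ _ (D 4 8 isT isT erefl) (F5i s).
  have c30 := swap _ _ _ (D 0 3 isT isT erefl) (F1j s).
  apply: (comm_factor _ (dl 11 * dl 10 * dl 9 * (dl 7 * (dl 6 *
    (dl 5 * (dl 8 * dl 4)))) * dl 2)%g _ (dl 3 * dl 0)%g).
  + rewrite -P.
    rewrite (mv _ (dl 7) _ (D 8 7 isT isT erefl)).
    rewrite (mv _ (dl 6) _ (D 8 6 isT isT erefl)).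
    rewrite (mv _ (dl 5) _ (D 8 5 isT isT erefl)).
    have c321 : commute (dl 3) (dl 2 * dl 1%N)%g.
      by rewrite (D 2 1)//; exact/commute_sym/E.
    have -> : (dl 3 * (dl 2 * (dl 1%N * dl 0)) =
               dl 2 * (dl 1%N * (dl 3 * dl 0)))%g.
      by rewrite (mulgA (dl 2)) (mv _ _ _ c321) !mulgA.
    by rewrite !mulgA.
  + by do ?[exact: C | exact: c84 | apply: commuteM].
  + exact: c30.
- have c19 := commute_sym (F5j s).
  have c63 := swap _ _ _ (D 3 6 isT isT erefl) (F3j s).
  apply: (comm_factor _ (dl 11 * (dl 1%N * dl 9) * dl 0 * dl 10 *
    dl 8 * dl 7 * dl 5)%g _ (dl 6 * dl 3 * dl 2)%g).
  (* The product is first rotated cyclically so that [dl 1] can be brought next to [dl 9]: for edge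
     4, only the product of these two is known to commute. *)
  + have : (dl 1%N * (dl 0 * (dl 11 * (dl 10 * (dl 9 * (dl 8 *
      (dl 7 * (dl 6 * (dl 5 * (dl 4 * (dl 3 * dl 2))))))
      )))))%g = 1%g.
      rewrite mulgA; apply: (mulgI (dl 1%N * dl 0)^-1%g).
      rewrite mulKg mulg1; apply: (mulIg (dl 1%N * dl 0)%g).
      by rewrite mulVg -P !mulgA.
    rewrite (mv (dl 10) (dl 9) _ (D 10 9 isT isT erefl)).
    rewrite (mv (dl 0) (dl 11) _ (D 0 11 isT isT erefl)).
    rewrite (mv (dl 1%N) (dl 11) _ (D 1%N 11 isT isT erefl)).
    rewrite (mv (dl 0) (dl 9) _ (D 0 9 isT isT erefl)).
    have c654 : commute (dl 6) (dl 5 * dl 4)%g.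
      by rewrite (D 5 4)//; exact/commute_sym/E.
    rewrite (mulgA (dl 5)) (mv _ _ _ c654) => e.
    by rewrite -[RHS]e !mulgA.
  + by do ?[exact: C | exact: c19 | apply: commuteM].
  + by do ?[exact: C | exact: c63 | apply: commuteM].
Qed.
End BranchGroup.

(** * The conjugates of the generators *)

(* The node (p, q, a) with p < q stands for a conjugate of a generator that is
   mapped to the transposition of p and q, with a label a in F_2^3 written in
   binary. Letters number the generators: 2 * k + s stands for (k, s). *)
Definition node : Type := nat * nat * nat.

Definition xor_table : seq (seq nat) :=
  [:: [:: 0; 1; 2; 3; 4; 5; 6; 7]; [:: 1; 0; 3; 2; 5; 4; 7; 6];
      [:: 2; 3; 0; 1; 6; 7; 4; 5]; [:: 3; 2; 1; 0; 7; 6; 5; 4];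
      [:: 4; 5; 6; 7; 0; 1; 2; 3]; [:: 5; 4; 7; 6; 1; 0; 3; 2];
      [:: 6; 7; 4; 5; 2; 3; 0; 1]; [:: 7; 6; 5; 4; 3; 2; 1; 0]].

Definition xor3 (a b : nat) : nat := nth 0 (nth [::] xor_table a) b.

Definition swapn (u v p : nat) : nat :=
  if eqn p u then v else if eqn p v then u else p.

Definition meetn (u v p q : nat) : bool :=
  (eqn p u || eqn p v) (+) (eqn q u || eqn q v).

Definition sort_node (n : node) : node :=
  let: (p, q, a) := n in if p <= q then n else (q, p, a).

(** A computable form of the conjugation rule that [tfamily] states for group elements;
    [act_label_node] identifies the two. *)
Definition act (m n : node) : node :=
  let: (u, v, c) := m in let: (p, q, a) := n in
  sort_node (swapn u v p, swapn u v q, if meetn u v p q then xor3 c a else a).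

Definition node_eq (m n : node) : bool :=
  let: (u, v, c) := m in let: (p, q, a) := n in
  [&& eqn u p, eqn v q & eqn c a].

Lemma node_eqP m n : node_eq m n -> m = n.
Proof.
by case: m n => [[u v] c] [[p q] a] /and3P[] /eqnP-> /eqnP-> /eqnP->.
Qed.

Section Tables.
Variables (T : Type) (d : T).
Implicit Types (t : seq (seq (seq T))) (m n : node) (x : T).

Definition getn t n : T :=
  let: (p, q, a) := n in nth d (nth [::] (nth [::] t p) q) a.

Definition setn t n x : seq (seq (seq T)) :=
  let: (p, q, a) := n in
  let tp := nth [::] t p in
  set_nth [::] t p (set_nth [::] tp q (set_nth d (nth [::] tp q) a x)).

Lemma getn_setn t m n x : getn (setn t m x) n = if n == m then x else getn t n.
Proof.
case: m n => [[u v] c] [[p q] a]; rewrite /getn /setn nth_set_nth /=.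
rewrite !xpair_eqE; case: (eqVneq p u) => //= ->; rewrite nth_set_nth /=.
by case: (eqVneq q v) => //= ->; rewrite nth_set_nth /=; case: eqVneq.
Qed.
End Tables.

(* A table of the pairs (n, k) for which conjugation by the letter k is known to
   send the element attached to n to the one attached to act (letter_node k) n. *)
Definition facts : Type := seq (seq (seq (seq bool))).

Definition known (t : facts) (n : node) (k : nat) : bool :=
  nth false (getn [::] t n) k.

Definition mark (t : facts) (n : node) (k : nat) : facts :=
  setn [::] t n (set_nth false (getn [::] t n) k true).

Lemma known_mark t m j n k : known (mark t m j) n k ->
  n = m /\ k = j \/ known t n k.
Proof.
rewrite /known getn_setn; case: eqVneq => [->|]; last by right.
by rewrite nth_set_nth /=; case: eqVneq => [->|]; [left | right].
Qed.

Definition letter : Type := nat * node.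

(** The gap is crossed by the expected action [act l.2]: unlike in a usual coset enumeration, the
    whole table is conjectured in advance and only its entries have to be established. Thus no new
    cosets and no coincidences arise. *)
Fixpoint scan (t : facts) (n : node) (u : option (node * letter))
    (w : seq letter) : option (node * option (node * letter)) :=
  if w is l :: w' then
    if known t n l.1 then scan t (act l.2 n) u w'
    else if u is None then scan t (act l.2 n) (Some (n, l)) w' else None
  else Some (n, u).

(* If the word w fixes the element attached to n
   and if all its steps but one are known, then so is the remaining one. *)
Definition deduce (n : node) (t : facts) (w : seq letter) : facts :=
  if scan t n None w is Some (m, Some (m1, l)) then
    let m2 := act l.2 m1 in
    if node_eq m n && node_eq (act l.2 m2) m1
    then mark (mark t m1 l.1) m2 l.1 else t
  else t.

Definition saturate (base : node) (nodes : seq node)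
    (base_rels rels : seq (seq letter)) (t : facts) : facts :=
  foldl (fun t w => foldl (fun t n => deduce n t w) t nodes)
    (foldl (deduce base) t base_rels) rels.

(** * Soundness of the enumeration *)

Section Soundness.
Local Open Scope group_scope.
Variables (G : groupType) (g : nat -> G) (L : nat -> node) (D : node -> G).
Hypothesis invol : forall k, g k * g k = 1.

Definition conj_word (x : G) (w : seq nat) : G :=
  foldl (fun x k => g k * x * g k) x w.

Definition resolve (w : seq nat) : seq letter := [seq (k, L k) | k <- w].

Definition valid (t : facts) : Prop :=
  forall n k, known t n k -> g k * D n * g k = D (act (L k) n).

Lemma conj_word_inj w : injective (conj_word ^~ w).
Proof.
elim: w => [//|k w IH] x y /IH; rewrite -!mulgA => /mulgI.
exact: mulIg.
Qed.

Lemma scan_known t n u w m : valid t -> scan t n (Some u) (resolve w) = Some (m, Some u) ->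
  conj_word (D n) w = D m.
Proof.
move=> vt; elim: w n => [|k w IH] n /=; first by case=> ->.
by case: ifP => // /vt-> /IH.
Qed.

Lemma scan_some t n u w m v : scan t n (Some u) w = Some (m, v) -> v = Some u.
Proof. by elim: w n => [|l w IH] n /=; [case | case: ifP => // _ /IH]. Qed.

(** The steps after the gap send both the actual and the expected image of [D m1] to [D m]; as
    conjugation is injective, the two images agree. *)
Lemma scan_unknown t n w m m1 l : valid t ->
  scan t n None (resolve w) = Some (m, Some (m1, l)) ->
  conj_word (D n) w = D m ->
  l.2 = L l.1 /\ g l.1 * D m1 * g l.1 = D (act (L l.1) m1).
Proof.
move=> vt; elim: w n => [//|k w IH] n /=.
case: ifP => [/vt-> /IH//|_].
move=> e; have [u1 u2] := scan_some e; rewrite u1 u2 in e *.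
by rewrite -(scan_known vt e) => /conj_word_inj.
Qed.

Lemma valid_mark t n k : valid t -> g k * D n * g k = D (act (L k) n) ->
  valid (mark t n k).
Proof. by move=> vt e m j /known_mark[[-> ->]|/vt]. Qed.

Lemma valid_deduce n t w : valid t -> conj_word (D n) w = D n ->
  valid (deduce n t (resolve w)).
Proof.
move=> vt nw; rewrite /deduce; case e: scan => [[m [[m1 l]|]]|] //.
case: ifP => // /andP[/node_eqP mn /node_eqP l2].
have [lL e1] : l.2 = L l.1 /\ g l.1 * D m1 * g l.1 = D (act (L l.1) m1).
  by apply: scan_unknown e _ => //; rewrite mn.
rewrite lL in l2 *; apply: valid_mark; first exact: valid_mark.
by rewrite l2 -e1 -!mulgA invol mulg1 (involK _ (invol _)).
Qed.

(** [base_words] play the role of the subgroup generators of a coset enumeration, as they only have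
    to centralize the base element; [words] play that of the relators, which act trivially on
    everything. *)
Lemma valid_saturate base nodes base_words words t :
  (forall w, w \in base_words -> conj_word (D base) w = D base) ->
  (forall w, w \in words -> forall x, conj_word x w = x) ->
  valid t ->
  valid (saturate base nodes (map resolve base_words) (map resolve words) t).
Proof.
move=> bw rw vt; rewrite /saturate.
have : valid (foldl (deduce base) t (map resolve base_words)).
  elim: base_words bw t vt => [//|w ws IH] bw t vt /=; apply: IH.
    by move=> v vws; apply: bw; rewrite inE vws orbT.
  by apply: valid_deduce => //; apply: bw; rewrite mem_head.
move: (foldl _ _ _) => {vt}t.
elim: words rw t => [//|w ws IH] rw t vt /=; apply: IH.
  by move=> v vws; apply: rw; rewrite inE vws orbT.
elim: nodes t vt => [//|n ns IHn] t vt /=; apply: IHn.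
by apply: valid_deduce => //; apply: rw; rewrite mem_head.
Qed.
End Soundness.

(** * Data of the enumeration: labels, spanning tree and words *)

Definition nodes : seq node :=
  [seq (pq, a) | pq <- [seq (p, q) | p <- iota 0 8, q <- iota p.+1 (7 - p)],
    a <- iota 0 8].

Definition base_labels : seq nat := [:: 0; 0; 0; 4; 0; 0; 0; 0; 0; 2; 2; 4].
(** The labels of the products [gamma_i' * gamma_i]: one basis vector of F_2^3 for each of the three
    great circles of the octahedron. They are constant along a circle because [face_deltas] forces
    equal labels on opposite edges at a vertex. *)
Definition delta_labels : seq nat := [:: 4; 2; 2; 4; 1; 1; 4; 1; 1; 2; 2; 4].

(* Modulo 2, the labels below are the solution of the relations at the vertices
   where gamma_i vanishes on a maximal set of edges. *)
Definition letter_node (k : nat) : node :=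
  let a := nth 0 base_labels k./2 in
  (ends k./2, if odd k then xor3 a (nth 0 delta_labels k./2) else a).

Definition path_table : Type := seq (seq (seq (option (seq nat)))).

Definition grow (letters : seq letter) (t : path_table) : path_table :=
  foldl (fun t n =>
    if getn None t n is Some w then
      foldl (fun t l => let m := act l.2 n in
        if getn None t m is None then setn None t m (Some (rcons w l.1)) else t)
        t letters
    else t) t nodes.

(** Seven rounds reach all nodes, as [paths_reach] confirms: a node left out would get the empty
    path. *)
Definition paths (letters : seq letter) (base : node) : path_table :=
  iter 7 (grow letters) (setn None [::] base (Some [::])).

Definition path_to (t : path_table) (n : node) : seq nat :=
  odflt [::] (getn None t n).

(** Along the spanning tree the action holds by definition, the element of a node being the base
    element conjugated along its path. *)
Definition tree_facts (letters : seq letter) (pt : path_table) : facts :=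
  foldl (fun t n => foldl (fun t l => let m := act l.2 n in
    if (path_to pt m == rcons (path_to pt n) l.1) && node_eq (act l.2 m) n
    then mark (mark t n l.1) m l.1 else t) t letters) [::] nodes.

Definition pair_words : seq (seq nat) :=
  flatten [seq [seq (if shared_ends k./2 l./2 == 0 then [:: k; l; k; l]
                    else [:: k; l; k; l; k; l])
               | l <- [seq l <- iota k.+1 (23 - k) | shared_ends k./2 l./2 < 2]]
          | k <- iota 0 24].

Definition face_words : seq (seq nat) :=
  flatten [seq (let: (i, j, k, l) := f in
    let a := i.-1.*2 in let b := j.-1.*2 in
    let c := k.-1.*2 in let d := l.-1.*2 in
    let a' := a.+1 in let b' := b.+1 in let c' := c.+1 in let d' := d.+1 in
    let comm x w := [:: x] ++ w ++ [:: x] ++ rev w in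
    [:: [:: b'; a'; b'; d; c'; d];
        [:: b'; b; b'; a'; b'; b; b'; d; c'; c; c'; d];
        [:: b'; a; b'; d; d'; d; c'; d; d'; d];
        [:: b'; b; b'; a; b'; b; b'; d; d'; d; c'; c; c'; d; d'; d]] ++
    [seq comm x [:: b'; b; c'; c] | x <- [:: a; a'; d; d']] ++
    [seq comm x [:: a'; a; d'; d] | x <- [:: b; b'; c; c']])
    | f <- vertex_edges].

(** The last three words say that [gamma_i] and [gamma_i'] commute for i = 1, 2, 5, one edge on each
    great circle. They are the only trace of (RP) among the relators. *)
Definition rel_words : seq (seq nat) :=
  pair_words ++ face_words ++ [:: [:: 0; 1; 0; 1]; [:: 2; 3; 2; 3]; [:: 8; 9; 8; 9]].

(** The base is the letter 2, that is [gamma_2]. It commutes with itself, with [gamma_2'] by (RP),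
    with two products of opposite deltas by [face_delta], and with all generators on edges without
    common triangle. *)
Definition base_words : seq (seq nat) :=
  [:: [:: 2]; [:: 3]; [:: 1; 0; 7; 6]; [:: 9; 8; 17; 16]] ++
  [seq [:: l] | l <- [seq l <- iota 0 24 | shared_ends 1 l./2 == 0]].

Definition letters : seq letter := resolve letter_node (iota 0 24).
Definition tree : path_table := paths letters (letter_node 2).

Definition all_facts : facts :=
  iter 7 (saturate (letter_node 2) nodes (map (resolve letter_node) base_words)
    (map (resolve letter_node) rel_words)) (tree_facts letters tree).

(** The enumeration proper: seven rounds of saturation fill the table of 28 * 8 nodes by 24
    letters. *)
Lemma all_facts_known :
  all (fun n => all (known all_facts n) (iota 0 24)) nodes.
Proof. by vm_cast_no_check (erefl true). Qed.

Lemma valid_tree_facts (G : groupType) (g : nat -> G) (L : nat -> node)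
    (ls : seq letter) (pt : path_table) (x : G) :
  (forall k, g k * g k = 1)%g -> (forall l, l \in ls -> l.2 = L l.1) ->
  valid g L (fun n => conj_word g x (path_to pt n)) (tree_facts ls pt).
Proof.
set D := fun n => _; move=> invol lsP.
have v0 : valid g L D [::] by move=> [[p q] a] k; rewrite /known /= !nth_nil.
rewrite /tree_facts; elim: nodes [::] v0 => [//|n ns IHn] t vt /=; apply: IHn.
elim: ls lsP t vt => [//|l ls' IHl] lP t vt /=; apply: IHl.
  by move=> l' l'ls; apply: lP; rewrite inE l'ls orbT.
case: ifP => // /andP[/eqP e1 /node_eqP e2].
have lL : l.2 = L l.1 by apply: lP; rewrite mem_head.
have e : (g l.1 * D n * g l.1)%g = D (act l.2 n).
  by rewrite /D e1 /conj_word foldl_rcons.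
apply: valid_mark; first by apply: valid_mark => //; rewrite -lL.
by rewrite -lL e2 -e -!mulgA invol mulg1 (involK _ (invol _)).
Qed.

(** * The enumeration applied to involutive generators that satisfy the branch relations *)

Section Closure.
Local Open Scope group_scope.
Variables (G : groupType) (g : gen -> G).
Hypothesis invol : forall x, g x * g x = 1.
Hypothesis rel : branch_relations g.

Definition letter_gen (k : nat) : G := g (inord k./2, odd k).
Let h := letter_gen.

Definition node_elt (n : node) : G := conj_word h (h 2) (path_to tree n).

Let invol_h k : h k * h k = 1.
Proof. exact: invol. Qed.

Let ev (w : seq nat) : G := foldr (fun k x => h k * x) 1 w.

Lemma conj_wordE x w : conj_word h x w = (ev w)^-1 * x * ev w.
Proof.
elim: w x => [|k w IH] x /=; first by rewrite invg1 mul1g mulg1.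
by rewrite IH invgM (invol_inv (invol_h k)) !mulgA.
Qed.

Lemma conj_word_rel w : ev w = 1 -> forall x, conj_word h x w = x.
Proof. by move=> w1 x; rewrite conj_wordE w1 invg1 mul1g mulg1. Qed.

Lemma conj_word_commute x w : commute x (ev w) -> conj_word h x w = x.
Proof. by move=> xw; rewrite conj_wordE -mulgA xw mulKg. Qed.

Lemma ev_cat u v : ev (u ++ v) = ev u * ev v.
Proof. by elim: u => [|k u IH] /=; rewrite ?mul1g// IH mulgA. Qed.

Lemma ev_rev u : ev (rev u) = (ev u)^-1.
Proof.
elim: u => [|k u IH]; first by rewrite invg1.
by rewrite rev_cons -cats1 ev_cat IH /= mulg1 invgM (invol_inv (invol_h k)).
Qed.

Let ev_comm k w : commute (h k) (ev w) -> ev ([:: k] ++ w ++ [:: k] ++ rev w) = 1.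
Proof.
move=> kw; rewrite !ev_cat ev_rev /= mulg1 !mulgA kw -(mulgA (ev w)) invol_h.
by rewrite mulg1 mulgV.
Qed.

Lemma pair_words_rel w : w \in pair_words -> ev w = 1.
Proof.
rewrite /pair_words => /flattenP[ws /mapP[k]]; rewrite mem_iota => /andP[_ k24] ->.
case/mapP => l; rewrite mem_filter mem_iota => /and3P[kl kl' l24] ->.
have k12 : (k./2 < 12)%N by rewrite ltn_half_double.
have l12 : (l./2 < 12)%N.
  by rewrite ltn_half_double (leq_trans l24)// addSn subnKC// -ltnS.
case: eqP => [/(nonadjacent_commute invol rel k12 l12) c|/eqP kl0].
  by apply: (@ev_comm k [:: l]); rewrite /= mulg1; exact: c.
have kl1 : shared_ends k./2 l./2 = 1%N by case: shared_ends kl kl0 => [|[]].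
have b : braid (h k) (h l) by exact: adjacent_braid.
by rewrite /= mulg1 (braidA _ b) !(involK _ (invol_h _)) invol_h.
Qed.

Lemma face_words_rel w : w \in face_words -> ev w = 1.
Proof.
rewrite /face_words => /flattenP[ws /mapP[[[[i j] k] l] ijkl ->]].
have /allP/(_ _ ijkl)/and4P[a0 b0 c0 d0] :
  all (fun t => let: (i, j, k, l) := t in [&& 0 < i, 0 < j, 0 < k & 0 < l])%N
    vertex_edges by [].
case: i j k l a0 b0 c0 d0 ijkl => [|i] [|j] [|k] [|l] // _ _ _ _ ijkl.
have he m : h m.*2 = g (inord m, false) by rewrite /h /letter_gen doubleK odd_double.
have ho m : h m.*2.+1 = g (inord m, true).
  by rewrite /h /letter_gen /= uphalf_double odd_double.
have [d1 d2 d3 d4] := face_delta invol rel ijkl.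
have [s1 s2 s3 s4] := face_square invol rel ijkl.
have sq u v : (rev v = v) -> ev u = ev v -> ev (u ++ v) = 1.
  by move=> vv uv; rewrite ev_cat uv -{1}vv ev_rev mulVg.
rewrite !mem_cat => /or3P[| /mapP[x xs ->] | /mapP[x xs ->]].
- rewrite !inE => /or4P[] /eqP ->.
  + apply: (sq [:: _; _; _] [:: _; _; _]) => //.
    by rewrite /= !he !ho !mulg1 !mulgA.
  + apply: (sq [:: _; _; _; _; _; _; _] [:: _; _; _; _; _]) => //.
    by rewrite /= !he !ho !mulg1 !mulgA -!mulgA; move: s2; rewrite -!mulgA.
  + apply: (sq [:: _; _; _] [:: _; _; _; _; _; _; _]) => //.
    by rewrite /= !he !ho !mulg1 !mulgA; move: s3; rewrite !mulgA.
  + apply: (sq [:: _; _; _; _; _; _; _] [:: _; _; _; _; _; _; _; _; _]) => //.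
    by rewrite /= !he !ho !mulg1 !mulgA; move: s4; rewrite !mulgA.
- apply: (@ev_comm x [:: _; _; _; _]); rewrite /= !he !ho mulg1.
  apply/commute_sym; move: d3 d4; rewrite /edge_delta -!mulgA => d3 d4.
  by move: xs; rewrite !inE => /or4P[] /eqP->; rewrite ?he ?ho.
- apply: (@ev_comm x [:: _; _; _; _]); rewrite /= !he !ho mulg1.
  apply/commute_sym; move: d1 d2; rewrite /edge_delta -!mulgA => d1 d2.
  by move: xs; rewrite !inE => /or4P[] /eqP->; rewrite ?he ?ho.
Qed.

Lemma rel_words_rel w : w \in rel_words -> ev w = 1.
Proof.
rewrite /rel_words (mem_cat w pair_words) (mem_cat w face_words) => /or3P[/pair_words_rel // | /face_words_rel // |].
have c k : (k \in [:: 0; 1; 4])%N -> ev [:: k.*2; k.*2.+1; k.*2; k.*2.+1] = 1.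
  move=> k0; apply: (@ev_comm k.*2 [:: k.*2.+1]) => /=; rewrite mulg1.
  have := edge_generators_commute invol rel k0.
  by rewrite /h /letter_gen doubleK odd_double /= uphalf_double odd_double.
by rewrite !inE => /or3P[] /eqP ->; [exact: (c 0%N) | exact: (c 1%N) | exact: (c 4)].
Qed.

Lemma base_words_rel w : w \in base_words -> commute (h 2) (ev w).
Proof.
rewrite /base_words mem_cat => /orP[|/mapP[l]].
  have [_ _ d1 _] := face_delta invol rel (isT : (1.+1, 4.+1, 8.+1, 9.+1) \in vertex_edges).
  have [d2 _ _ _] := face_delta invol rel (isT : (0.+1, 1.+1, 2.+1, 3.+1) \in vertex_edges).
  rewrite !inE => /or4P[] /eqP-> /=; rewrite ?mulg1.
  - exact: commute_refl.
  - exact: (edge_generators_commute invol rel (isT : 1%N \in [:: 0; 1; 4]%N)).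
  - by apply/commute_sym; move: (d2 false); rewrite /edge_delta -!mulgA.
  - by apply/commute_sym; move: (d1 false); rewrite /edge_delta -!mulgA.
rewrite mem_filter mem_iota => /and3P[/eqP kl _ l24] -> /=; rewrite mulg1.
by apply: nonadjacent_commute => //; rewrite ltn_half_double.
Qed.

(** Together with [letter_gen_node], this bounds the number of conjugates of the generators by 28 *
    8. *)
Lemma node_elt_act n k : n \in nodes -> (k < 24)%N ->
  h k * node_elt n * h k = node_elt (act (letter_node k) n).
Proof.
move=> nn k24.
have v : valid h letter_node node_elt all_facts.
  rewrite /all_facts.
  have : valid h letter_node node_elt (tree_facts letters tree).
    by apply: valid_tree_facts => // l /mapP[? _ ->].
  move: (tree_facts _ _) => t; elim: 7 t => [//|m IH] t vt.
  rewrite iterS; apply: valid_saturate; last exact: IH.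
  - exact: invol_h.
  - move=> w /base_words_rel c.
    rewrite (_ : node_elt _ = h 2); last by [].
    exact: conj_word_commute.
  - by move=> w /rel_words_rel/conj_word_rel.
apply: v; have /allP/(_ _ nn)/allP := all_facts_known.
by apply; rewrite mem_iota.
Qed.
End Closure.

Fixpoint reach (n : nat) : seq nat :=
  if n is n'.+1 then
    let s := reach n' in
    s ++ [seq l <- iota 0 24 | has (fun k => shared_ends k./2 l./2 == 1) s]
  else [:: 2].

Section LetterNodes.
Local Open Scope group_scope.
Variables (G : groupType) (g : gen -> G).
Hypothesis invol : forall x, g x * g x = 1.
Hypothesis rel : branch_relations g.

Lemma node_elt_base : node_elt g (letter_node 2) = letter_gen g 2.
Proof.
have base : path_to tree (letter_node 2) = [::] by vm_cast_no_check (erefl ([::] : seq nat)).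
by rewrite /node_elt base.
Qed.

(** If the generators [h k] and [h l] braid, then [h l = h k * (h l * h k * h l) * h k], so the
    claim passes from a letter to all those on adjacent edges. Four such steps from the base letter
    reach all 24. *)
Lemma letter_gen_node k : (k < 24)%N -> letter_gen g k = node_elt g (letter_node k).
Proof.
have h2 k' : letter_gen g k' * letter_gen g k' = 1 by exact: invol.
have step k' l : (k' < 24)%N -> (l < 24)%N -> shared_ends k'./2 l./2 = 1%N ->
    letter_gen g k' = node_elt g (letter_node k') ->
    letter_gen g l = node_elt g (letter_node l).
  move=> k24 l24 kl kE.
  have k12 : (k'./2 < 12)%N by rewrite ltn_half_double.
  have l12 : (l./2 < 12)%N by rewrite ltn_half_double.
  have b : braid (letter_gen g k') (letter_gen g l) by exact: adjacent_braid.
  have /allP/(_ (k', l)) : all (fun t => let: (k, l) := t in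
      (shared_ends k./2 l./2 == 1%N) ==>
      [&& letter_node k \in nodes, act (letter_node l) (letter_node k) \in nodes &
        act (letter_node k) (act (letter_node l) (letter_node k)) == letter_node l])
      [seq (k, l) | k <- iota 0 24, l <- iota 0 24] by vm_cast_no_check (erefl true).
  rewrite kl allpairs_f ?mem_iota//= => /(_ isT)/and3P[kn ln /eqP <-].
  rewrite -(node_elt_act invol rel ln k24) -(node_elt_act invol rel kn l24) -kE.
  by rewrite -!mulgA (braidA _ b) !(involK _ (h2 _)) h2 mulg1.
have all_reach n l : l \in reach n -> (l < 24)%N /\
    letter_gen g l = node_elt g (letter_node l).
  elim: n l => [|n IH] l; first by rewrite inE => /eqP->; rewrite node_elt_base.
  have -> : reach n.+1 = reach n ++ [seq l <- iota 0 24 |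
      has (fun k => shared_ends k./2 l./2 == 1%N) (reach n)] by [].
  rewrite mem_cat mem_filter mem_iota => /orP[/IH//|].
  case/andP=> /hasP[k' /IH[k24 kE] /eqP kl] l24; split=> //.
  exact: step kE.
move=> k24; apply: (proj2 (all_reach 4 k _)).
have /allP : all (mem (reach 4)) (iota 0 24) by vm_cast_no_check (erefl true).
by apply; rewrite mem_iota.
Qed.
End LetterNodes.

Lemma Z2_cases (x : 'Z_2) : x = 0%R \/ x = 1%R.
Proof. by case: x => -[|[|//]] ?; [left|right]; exact/val_inj. Qed.

Lemma addvv (n : nat) (a : 'rV['Z_2]_n) : (a + a = 0)%R.
Proof.
by apply/rowP=> i; rewrite !mxE; case: (Z2_cases (a ord0 i)) => ->; exact/val_inj.
Qed.

Lemma mulrb_addb (n : nat) (a : 'rV['Z_2]_n) (x y : bool) :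
  (a *+ (x (+) y) = a *+ x + a *+ y)%R.
Proof. by case: x y => -[]; rewrite /= ?addr0 ?add0r ?addvv. Qed.

Definition meets (p q r : 'I_8) : bool := (r == p) || (r == q).

Definition meets1 (p q r s : 'I_8) : bool := meets p q r (+) meets p q s.

Section TranspositionFamilies.
Local Open Scope group_scope.

(* T p q a behaves as the permutation matrix of the transposition of p and q,
   with entries twisted by a. *)
Definition tfamily (G : groupType) (T : 'I_8 -> 'I_8 -> 'rV['Z_2]_3 -> G) : Prop :=
  [/\ forall p q a, T p q a = T q p a,
      forall p q a, p != q -> T p q a * T p q a = 1 &
      forall p q r s a b, p != q -> r != s ->
        T p q a * T r s b * T p q a =
        T (tperm p q r) (tperm p q s) (b + a *+ meets1 p q r s)%R].
End TranspositionFamilies.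

Lemma meets_tperm p q u v r :
  meets (tperm p q u) (tperm p q v) r = meets u v (tperm p q r).
Proof. by rewrite /meets !(can2_eq (tpermK p q) (tpermK p q)). Qed.

Lemma meets_id p q r : meets p q (tperm p q r) = meets p q r.
Proof.
rewrite -meets_tperm tpermL tpermR /meets; exact: orbC.
Qed.

Lemma meets_addb u v p q r : meets u v r (+) meets u v (tperm p q r) =
  meets p q r && meets1 u v p q.
Proof.
rewrite /meets1; case: tpermP => [->|->|/eqP/negPf rp /eqP/negPf rq].
- by rewrite {3}/meets eqxx.
- by rewrite {3}/meets eqxx orbT /= addbC.
- by rewrite {3}/meets rp rq addbb.
Qed.

Definition label_code (a : 'rV['Z_2]_3) : nat :=
  (a ord0 (inord 0) != 0%R) + ((a ord0 (inord 1) != 0%R) + (a ord0 (inord 2) != 0%R).*2).*2.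

Definition code_label (c : nat) : 'rV['Z_2]_3 :=
  \row_i (nth false [:: odd c; odd c./2; odd c./2./2] i)%:R%R.

Lemma ord3P (P : 'I_3 -> Prop) : P (inord 0) -> P (inord 1) -> P (inord 2) ->
  forall i, P i.
Proof.
move=> P0 P1 P2 [i i3]; case: i i3 => [|[|[|//]]] i3.
- by rewrite (_ : Ordinal i3 = inord 0)//; apply/val_inj; rewrite /= inordK.
- by rewrite (_ : Ordinal i3 = inord 1)//; apply/val_inj; rewrite /= inordK.
- by rewrite (_ : Ordinal i3 = inord 2)//; apply/val_inj; rewrite /= inordK.
Qed.

Lemma label_codeK : cancel label_code code_label.
Proof.
move=> a; have [a0 a1 a2] := And3 (Z2_cases (a ord0 (inord 0)))
  (Z2_cases (a ord0 (inord 1))) (Z2_cases (a ord0 (inord 2))).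
apply/rowP; apply: ord3P; rewrite !mxE inordK// /label_code.
- by case: a0 a1 a2 => -> [] -> [] ->; exact/val_inj.
- by case: a0 a1 a2 => -> [] -> [] ->; exact/val_inj.
- by case: a0 a1 a2 => -> [] -> [] ->; exact/val_inj.
Qed.

Lemma label_code_lt a : (label_code a < 8)%N.
Proof. by rewrite /label_code; do 3 case: (_ != _). Qed.

Lemma code_labelK c : (c < 8)%N -> label_code (code_label c) = c.
Proof.
rewrite /label_code !mxE !inordK//.
by do 8 (case: c => [//|c]).
Qed.

Lemma label_codeD a b : label_code (a + b)%R = xor3 (label_code b) (label_code a).
Proof.
rewrite /label_code !mxE.
have E k := (Z2_cases (a ord0 (inord k)), Z2_cases (b ord0 (inord k))).
by case: (E 0) => -[] -> [] ->; case: (E 1) => -[] -> [] ->;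
   case: (E 2) => -[] -> [] ->.
Qed.

Section Bridge.
Implicit Types (p q r s : 'I_8) (a b c : 'rV['Z_2]_3).

Definition label_node p q a : node := sort_node ((p : nat), (q : nat), label_code a).

Lemma label_nodeC p q a : label_node p q a = label_node q p a.
Proof. by rewrite /label_node /sort_node; case: ltngtP => // ->. Qed.

Lemma swapn_tperm p q r : swapn p q r = tperm p q r.
Proof.
rewrite /swapn -![eqn _ _]/(_ == _); case: tpermP => [->|->|/eqP rp /eqP rq].
- by rewrite eqxx.
- by rewrite eqxx; case: eqP => // ->.
- by rewrite !(inj_eq val_inj) (negPf rp) (negPf rq).
Qed.

Lemma act_label_node p q c r s b : act ((p : nat), (q : nat), label_code c)
    (label_node r s b) =
  label_node (tperm p q r) (tperm p q s) (b + c *+ meets1 p q r s)%R.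
Proof.
have main r' s' : act ((p : nat), (q : nat), label_code c) ((r' : nat), (s' : nat), label_code b) =
    label_node (tperm p q r') (tperm p q s') (b + c *+ meets1 p q r' s')%R.
  rewrite /act /label_node !swapn_tperm; congr (sort_node (_, _, _)).
  rewrite (_ : meetn _ _ _ _ = meets1 p q r' s'); last by [].
  by case: meets1; rewrite ?mulr1n ?mulr0n ?addr0// label_codeD.
rewrite {1}/label_node /sort_node; case: ifP => _; first exact: main.
by rewrite main label_nodeC /meets1 addbC.
Qed.

Lemma label_node_in p q a : p != q -> label_node p q a \in nodes.
Proof.
move=> pq; have a8 := label_code_lt a.
have in_nodes (r s c : nat) : (r < s < 8)%N -> (c < 8)%N -> (r, s, c) \in nodes.
  case/andP=> rs s8 c8; apply: allpairs_f; last by rewrite mem_iota.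
  apply/allpairsPdep; exists r, s; rewrite !mem_iota rs /= add0n.
  rewrite (ltn_trans rs)// addSn subnKC ?s8 // -ltnS.
  exact: leq_trans rs (ltnW s8).
rewrite /label_node /sort_node; case: ltngtP => [pq'|qp|/val_inj/eqP].
- by apply: in_nodes; rewrite // pq' ltn_ord.
- by apply: in_nodes; rewrite // qp ltn_ord.
- by rewrite (negPf pq).
Qed.
End Bridge.

Lemma paths_reach : all (fun n => foldl (fun m k => act (letter_node k) m)
  (letter_node 2) (path_to tree n) == n) nodes.
Proof. by vm_cast_no_check (erefl true). Qed.

Lemma paths_letters : all (fun n => all (fun k => k < 24) (path_to tree n)) nodes.
Proof. by vm_cast_no_check (erefl true). Qed.

Lemma letter_node_label k : k < 24 -> exists u v c,
  u != v /\ letter_node k = ((u : 'I_8) : nat, (v : 'I_8) : nat, label_code c).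
Proof.
move=> k24.
have /allP/(_ k) : all (fun k => let: (u, v, c) := letter_node k in
  [&& u != v, u < 8, v < 8 & c < 8]) (iota 0 24) by [].
rewrite mem_iota => /(_ k24); case: letter_node => -[u v] c /and4P[uv u8 v8 c8].
by exists (Ordinal u8), (Ordinal v8), (code_label c); rewrite code_labelK.
Qed.

Lemma label_node_inj (p q u v : 'I_8) a c : label_node p q a = label_node u v c ->
  a = c /\ (p = u /\ q = v \/ p = v /\ q = u).
Proof.
rewrite /label_node /sort_node.
case: ifP => _; case: ifP => _ [] /val_inj-> /val_inj-> /(can_inj label_codeK)->;
  by split=> //; auto.
Qed.

Section Family.
Local Open Scope group_scope.
Variables (G : groupType) (g : gen -> G).
Hypothesis invol : forall x, g x * g x = 1.
Hypothesis rel : branch_relations g.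

Definition class_elt (p q : 'I_8) (a : 'rV['Z_2]_3) : G :=
  node_elt g (label_node p q a).

Let T := class_elt.
Let h := letter_gen g.

Lemma class_eltC p q a : T p q a = T q p a.
Proof. by rewrite /T /class_elt label_nodeC. Qed.

Lemma letter_class k u v c : (k < 24)%N -> u != v ->
  letter_node k = ((u : 'I_8) : nat, (v : 'I_8) : nat, label_code c) ->
  h k = T u v c.
Proof.
move=> k24 uv kE; rewrite /h (letter_gen_node invol rel k24) kE; congr node_elt.
have /allP/(_ k) : all (fun k => let: (u, v, c) := letter_node k in (u <= v)%N)
  (iota 0 24) by [].
by rewrite mem_iota => /(_ k24); rewrite kE /label_node /sort_node => ->.
Qed.

Let acts x p q a := forall r s b, r != s ->
  x * T r s b * x = T (tperm p q r) (tperm p q s) (b + a *+ meets1 p q r s)%R.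

Lemma letter_acts k u v c : (k < 24)%N ->
  letter_node k = ((u : 'I_8) : nat, (v : 'I_8) : nat, label_code c) ->
  acts (h k) u v c.
Proof.
move=> k24 kE r s b rs.
by rewrite /T /class_elt (node_elt_act invol rel (label_node_in b rs) k24) kE
  act_label_node.
Qed.

(** The rule holds for letters by the enumeration. Each [T p q a] is obtained from the base letter
    by conjugation along a path, and conjugates inherit the rule. *)
Lemma class_acts p q a : p != q -> acts (T p q a) p q a.
Proof.
move=> pq.
have reached w : all (fun k => k < 24)%N w -> exists p q a, [/\ p != q,
    foldl (fun m k => act (letter_node k) m) (letter_node 2) w = label_node p q a
    & acts (T p q a) p q a].
  elim/last_ind: w => [_|w k IH] {p q a pq}.
    have [u [v [c [uv kE]]]] := @letter_node_label 2 isT.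
    exists u, v, c; split=> //; last first.
      by rewrite -(letter_class _ uv kE)//; exact: letter_acts.
    rewrite [LHS]/= kE /label_node /sort_node ifT//.
    by case: kE => eu ev _; rewrite -eu -ev.
  rewrite all_rcons => /andP[k24 /IH[p [q [a [pq pqE pqacts]]]]].
  have [u [v [c [uv kE]]]] := letter_node_label k24.
  have hacts := letter_acts k24 kE.
  exists (tperm u v p), (tperm u v q), (a + c *+ meets1 u v p q)%R.
  split; first by rewrite (inj_eq perm_inj).
    by rewrite foldl_rcons pqE kE act_label_node.
  move=> r s b rs; rewrite -(hacts p q a pq).
  have -> : h k * T p q a * h k * T r s b * (h k * T p q a * h k) =
    h k * (T p q a * (h k * T r s b * h k) * T p q a) * h k by rewrite !mulgA.
  rewrite hacts// pqacts ?(inj_eq perm_inj)// hacts ?(inj_eq perm_inj)//.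
  have E r' : tperm u v (tperm p q (tperm u v r')) =
      tperm (tperm u v p) (tperm u v q) r'.
    by rewrite -tpermJ conjgE tpermV !permM.
  rewrite !E; congr (T _ _ _).
  rewrite -!addrA; congr (_ + _)%R.
  (* The two conjugations by [h k] contribute [c] once before and once after the action of
     [T p q a]. By this parity identity, what is left of them is exactly the contribution of [c] to
     the new label [a + c]. *)
  have m13 : meets1 u v r s (+) meets1 u v (tperm p q (tperm u v r))
      (tperm p q (tperm u v s)) =
      meets1 p q (tperm u v r) (tperm u v s) && meets1 u v p q.
    rewrite /meets1 -(meets_id u v r) -(meets_id u v s) addbACA !meets_addb.
    by rewrite -!(andbC (meets1 u v p q)) andb_addr.
  rewrite addrCA -mulrb_addb m13 /meets1 !meets_tperm -/(meets1 _ _ _ _).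
  by case: meets1; case: meets1; rewrite /= ?addr0 ?mulr0n ?mulr1n.
have [p1 [q1 [a1 [pq1 e acts1]]]] : exists p1 q1 a1, [/\ p1 != q1,
    label_node p q a = label_node p1 q1 a1 & acts (T p1 q1 a1) p1 q1 a1].
  have /allP/(_ _ (label_node_in a pq))/eqP <- := paths_reach.
  have /allP/(_ _ (label_node_in a pq)) := paths_letters.
  exact: reached.
have [-> pq1E] := label_node_inj e.
case: pq1E => -[-> ->] //.
move=> r s b rs; rewrite class_eltC acts1// tpermC; congr (T _ _ (_ + _ *+ _)%R).
by rewrite /meets1 /meets ![(_ == p1) || _]orbC.
Qed.

Lemma class_family : tfamily T.
Proof.
split; [exact: class_eltC | | by move=> p q r s a b pq; exact: class_acts].
move=> p q a _; rewrite /T /class_elt /node_elt.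
have sq : letter_gen g 2 * letter_gen g 2 = 1 by exact: invol.
elim: (path_to _ _) (letter_gen g 2) sq => [|k w IH] x xx; [exact: xx | apply: IH].
by rewrite -!mulgA (involK _ (invol _)) (involK _ xx); exact: invol.
Qed.
End Family.

Local Notation V := 'rV['Z_2]_3.

(** * The model *)

(* A bilinear form whose alternation beta a b + beta b a is the universal
   alternating map of F_2^3. *)
Definition beta (a b : V) : V :=
  (\row_k (a ord0 (inord (nth 0%N [:: 0; 0; 1]%N k)) *
           b ord0 (inord (nth 0%N [:: 1; 2; 2]%N k))))%R.

Section Beta.
Local Open Scope ring_scope.
Lemma betaDl a b c : beta (a + b) c = beta a c + beta b c.
Proof. by apply/rowP=> k; rewrite !mxE mulrDl. Qed.

Lemma betaDr a b c : beta a (b + c) = beta a b + beta a c.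
Proof. by apply/rowP=> k; rewrite !mxE mulrDr. Qed.

Lemma beta0l c : beta 0 c = 0.
Proof. by apply/rowP=> k; rewrite !mxE mul0r. Qed.

Lemma beta0r c : beta c 0 = 0.
Proof. by apply/rowP=> k; rewrite !mxE mulr0. Qed.

Lemma oppvv (a : V) : - a = a.
Proof. by apply/eqP; rewrite -subr_eq0 -opprD addvv oppr0. Qed.

Lemma betaMbl a b (x : bool) : beta (a *+ x) b = beta a b *+ x.
Proof. by case: x; rewrite ?mulr0n ?beta0l. Qed.

Lemma betaMbr a b (x : bool) : beta a (b *+ x) = beta a b *+ x.
Proof. by case: x; rewrite ?mulr0n ?beta0r. Qed.

Lemma sum_meets (p q : 'I_8) (F : 'I_8 -> V) : p != q ->
  \sum_i F i *+ meets p q i = F p + F q.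
Proof.
move=> pq; rewrite (bigD1 p)//= (bigD1 q) 1?eq_sym//= big1 ?addr0.
  by rewrite /meets !eqxx orbT.
by move=> i /andP[ip iq]; rewrite /meets (negPf ip) (negPf iq).
Qed.
End Beta.

(* The wreath product of S_8 with the extension of F_2^3 by itself that beta
   defines, in which the centers of the eight factors are identified. *)
Definition twisted : Type := ('S_8 * {ffun 'I_8 -> V} * V)%type.
HB.instance Definition _ := Finite.on twisted.

Definition twp (x : twisted) : 'S_8 := x.1.1.
Definition twv (x : twisted) : {ffun 'I_8 -> V} := x.1.2.
Definition twc (x : twisted) : V := x.2.

Section TwistedGroup.
Local Open Scope ring_scope.
Implicit Types x y z : twisted.

Definition tw_mul x y : twisted :=
  ((twp x * twp y)%g, [ffun i => twv x ((twp y)^-1%g i) + twv y i],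
   twc x + twc y + \sum_i beta (twv x ((twp y)^-1%g i)) (twv y i)).

Definition tw_one : twisted := (1%g, [ffun=> 0], 0).

Definition tw_inv x : twisted :=
  ((twp x)^-1%g, [ffun i => twv x (twp x i)],
   twc x + \sum_i beta (twv x i) (twv x i)).

Lemma tw_mulA : associative tw_mul.
Proof.
move=> x y z; congr (_, _, _); rewrite /= ?mulgA//.
  by apply/ffunP=> i; rewrite !ffunE invMg permM addrA.
rewrite {1 4}/twc /=.
have -> : \sum_i beta (twv x ((twp (tw_mul y z))^-1%g i)) (twv (tw_mul y z) i) =
    \sum_i beta (twv x ((twp y)^-1%g i)) (twv y i) +
    \sum_i beta (twv x ((twp y)^-1%g ((twp z)^-1%g i))) (twv z i).
  rewrite [X in X + _](reindex_perm (twp z)^-1%g) -big_split.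
  by apply: eq_bigr => i _; rewrite ffunE invMg permM betaDr.
have -> : \sum_i beta (twv (tw_mul x y) ((twp z)^-1%g i)) (twv z i) =
    \sum_i beta (twv x ((twp y)^-1%g ((twp z)^-1%g i))) (twv z i) +
    \sum_i beta (twv y ((twp z)^-1%g i)) (twv z i).
  by rewrite -big_split; apply: eq_bigr => i _; rewrite ffunE betaDl.
by rewrite !addrA [LHS](ACl (1*2*5*3*6*4)%AC).
Qed.

Lemma tw_mul1 : left_id tw_one tw_mul.
Proof.
move=> [[p v] c]; congr (_, _, _); rewrite /= ?mul1g//.
  by apply/ffunP=> i; rewrite !ffunE add0r.
by rewrite /twc /= add0r big1 ?addr0// => i _; rewrite /twv /= ffunE beta0l.
Qed.

Lemma tw_mulV : left_inverse tw_one tw_inv tw_mul.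
Proof.
move=> x; congr (_, _, _); rewrite /= ?mulVg//.
  by apply/ffunP=> i; rewrite !ffunE /= permKV addvv.
rewrite {1}/twc /=.
have -> : \sum_i beta (twv (tw_inv x) ((twp x)^-1%g i)) (twv x i) =
    \sum_i beta (twv x i) (twv x i).
  by apply: eq_bigr => i _; rewrite {1}/twv /= ffunE permKV.
by rewrite [LHS](ACl ((1*3)*(2*4))%AC) /= !addvv.
Qed.
End TwistedGroup.

HB.instance Definition _ :=
  Finite_isGroup.Build twisted tw_mulA tw_mul1 tw_mulV.

Section TwistedTranspositions.
Local Open Scope ring_scope.
Implicit Types x y z : twisted.

(** The central entry must be a quadratic form refining [beta]: when conjugation turns a label [b]
    into [b + a], it also adds [beta a a + beta a b + beta b a] to the central entry, which yields
    [beta (b + a) (b + a)]. *)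
Definition tw_tr (p q : 'I_8) (a : V) : twisted :=
  (tperm p q, [ffun i => a *+ meets p q i], beta a a).

Lemma twpM x y : twp (x * y)%g = (twp x * twp y)%g.
Proof. by []. Qed.

Lemma twvM x y i : twv (x * y)%g i = twv x ((twp y)^-1%g i) + twv y i.
Proof. by rewrite /twv /= ffunE. Qed.

Lemma twcM x y : twc (x * y)%g =
  twc x + twc y + \sum_i beta (twv x ((twp y)^-1%g i)) (twv y i).
Proof. by []. Qed.

Lemma tw_eq x y : twp x = twp y -> twv x =1 twv y -> twc x = twc y -> x = y.
Proof.
by case: x y => [[p v] c] [[r w] d] /= pr /ffunP vw cd; congr (_, _, _).
Qed.

Lemma twv_tr p q a i : twv (tw_tr p q a) i = a *+ meets p q i.
Proof. by rewrite /twv ffunE. Qed.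

Lemma meets_bool (p q r s : 'I_8) (a : V) :
  a *+ meets p q r + a *+ meets p q s = a *+ meets1 p q r s.
Proof. by rewrite mulrb_addb. Qed.

Lemma meets1C p q r s : p != q -> r != s -> meets1 p q r s = meets1 r s p q.
Proof.
move=> pq rs.
have np : ~~ ((p == r) && (q == r)) by apply: contra pq => /andP[/eqP-> /eqP->].
have ns : ~~ ((p == s) && (q == s)) by apply: contra pq => /andP[/eqP-> /eqP->].
have nr : ~~ ((p == r) && (p == s)) by apply: contra rs => /andP[/eqP<- /eqP<-].
have nq : ~~ ((q == r) && (q == s)) by apply: contra rs => /andP[/eqP<- /eqP<-].
rewrite /meets1 /meets [r == p]eq_sym [r == q]eq_sym [s == p]eq_sym [s == q]eq_sym.
by move: np ns nr nq; do 4 case: (_ == _).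
Qed.

Lemma meets1_tperm p q r s : p != q -> r != s ->
  meets1 p q (tperm r s p) (tperm r s q) = meets1 p q r s.
Proof.
move=> pq rs.
have E (x : 'I_8) : meets p q x -> meets p q (tperm r s x) =
    ~~ (meets r s x && meets1 p q r s).
  by move=> px; have := meets_addb p q r s x; rewrite px => <-; case: meets.
rewrite {1}/meets1 !E /meets ?eqxx ?orbT// -/(meets r s p) -/(meets r s q).
rewrite addbN addNb negbK -andb_addl -/(meets1 r s p q) meets1C// andbb.
by [].
Qed.

Lemma tw_tr_mul p q r s a b : p != q -> r != s ->
  (tw_tr p q a * tw_tr r s b)%g =
  ((tperm p q * tperm r s)%g,
   [ffun i => a *+ meets p q (tperm r s i) + b *+ meets r s i],
   beta a a + beta b b + beta a b *+ meets1 p q r s).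
Proof.
move=> pq rs; apply: tw_eq => [//|i|].
  by rewrite twvM !twv_tr {1}/twp /= tpermV /twv ffunE.
rewrite twcM; congr (_ + _); rewrite -meets_bool.
transitivity (\sum_i beta a b *+ meets p q (tperm r s i) *+ meets r s i).
  by apply: eq_bigr => i _; rewrite !twv_tr betaMbl betaMbr /twp /= tpermV mulrnAC.
by rewrite (sum_meets (fun i => beta a b *+ meets p q (tperm r s i)))// tpermL
  tpermR addrC.
Qed.

Let cancel (x y z t u : V) : x + y + z + x + (t + u) = y + z + (t + u).
Proof. by rewrite addrA [LHS](ACl ((1*4)*(2*3*(5*6)))%AC) /= addvv add0r. Qed.

Lemma tw_tr_family : tfamily tw_tr.
Proof.
split.
- move=> p q a; apply: tw_eq => [|i|//]; first by rewrite /twp /= tpermC.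
  by rewrite !twv_tr /meets orbC.
- move=> p q a pq; rewrite tw_tr_mul//; apply: tw_eq => [|i|].
  + by rewrite /twp /= tperm2.
  + by rewrite /twv !ffunE meets_id addvv.
  + by rewrite /twc /= addvv add0r /meets1 /meets !eqxx orbT.
- move=> p q r s a b pq rs; rewrite tw_tr_mul//.
  pose m := meets1 p q r s.
  apply: tw_eq => [|i|].
  + by rewrite /twp /= -tpermJ conjgE tpermV mulgA.
  + rewrite twvM !twv_tr [twv (_, _)]/twv /= ffunE /twp /= tpermV meets_tperm.
    rewrite -(meets_id p q i) mulrnDl addrAC -mulrb_addb addbC meets_addb addrC.
    by congr (_ + _); case: meets; case: meets1; rewrite ?mulr1n ?mulr0n.
  + rewrite [LHS]twcM.
    transitivity (beta a a + beta b b + beta a b *+ m + beta a a +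
      (beta a a *+ m + beta b a *+ m)).
      congr (_ + _).
      transitivity (\sum_i (beta a a *+ meets p q (tperm r s (tperm p q i)) +
          beta b a *+ meets r s (tperm p q i)) *+ meets p q i).
        apply: eq_bigr => j _; rewrite twv_tr betaMbr {1}/twv /= ffunE betaDl.
        by rewrite !betaMbl /twp /= tpermV.
      rewrite (sum_meets (fun i => beta a a *+ meets p q (tperm r s (tperm p q i)) +
          beta b a *+ meets r s (tperm p q i)))// tpermL tpermR.
      rewrite addrACA !meets_bool /m; congr (_ *+ _ + _ *+ _).
        by rewrite -(meets1_tperm pq rs) /meets1 addbC.
      by rewrite (meets1C pq rs) /meets1 addbC.
    rewrite /twc /= -/m betaDl !betaDr !betaMbl !betaMbr.
    rewrite cancel.
    case: m; rewrite ?mulr1n ?mulr0n ?addr0//.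
    by rewrite -!addrA; congr (_ + _); rewrite addrA addrC.
Qed.
End TwistedTranspositions.

(** * Normal form of the products of twisted transpositions *)

Section FamilyTheory.
Local Open Scope group_scope.
Variables (G : groupType) (T : 'I_8 -> 'I_8 -> V -> G).
Hypothesis famT : tfamily T.
Implicit Types (p q r s n : 'I_8) (a b c d : V).

Let TC p q a : T p q a = T q p a. Proof. by case: famT. Qed.

Let TT p q a : p != q -> T p q a * T p q a = 1.
Proof. by case: famT => _ + _; apply. Qed.

Let TTA p q a x : p != q -> T p q a * (T p q a * x) = x.
Proof. by move=> pq; rewrite involK ?TT. Qed.

Lemma fam_swap p q r s a b : p != q -> r != s ->
  T p q a * T r s b =
  T (tperm p q r) (tperm p q s) (b + a *+ meets1 p q r s)%R * T p q a.
Proof.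
move=> pq rs; have [_ _ /(_ p q r s a b pq rs) <-] := famT.
by rewrite -mulgA TT// mulg1.
Qed.

Lemma fam_comm p q a b : p != q -> T p q a * T p q b = T p q b * T p q a.
Proof.
move=> pq; rewrite fam_swap// tpermL tpermR /meets1 /meets !eqxx orbT addr0.
by rewrite TC.
Qed.

Lemma fam_adj p q s a b : p != q -> q != s -> p != s ->
  T p q a * T q s b = T p s (b + a)%R * T p q a.
Proof.
move=> pq qs ps; rewrite fam_swap// tpermR tpermD// /meets1 /meets.
by rewrite eqxx orbT ![s == _]eq_sym (negPf ps) (negPf qs).
Qed.

Lemma fam_adjr p q s a b : p != q -> q != s -> p != s ->
  T p q a * T q s b = T q s b * T p s (b + a)%R.
Proof.
move=> pq qs ps; apply: (mulgI (T q s b)); rewrite TTA// mulgA.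
rewrite [T q s b]TC [T p q a]TC fam_adj 1?eq_sym// 1?[_ == p]eq_sym//.
by rewrite -mulgA TT 1?eq_sym// mulg1 TC addrC.
Qed.

(** In the model, [T p q x * T p q y] is a translation by [x + y] at [p] and [q]. Translations by
    the same amount over [p, q] and over [q, r] cancel at [q] and leave one over [p, r]; with these
    labels no central factor remains. *)
Lemma fam_double p q r x y w : p != q -> q != r -> p != r ->
  T p q x * T p q y * (T q r (x + y + w)%R * T q r w) =
  T p r (x + w)%R * T p r (y + w)%R.
Proof.
move=> pq qr pr; have qp : q != p by rewrite eq_sym.
have rp : r != p by rewrite eq_sym.
rewrite -mulgA (mulgA (T p q y)) fam_adj// -mulgA (fam_adjr y w)// mulgA.
rewrite [T p q x]TC (fam_adj x _ qp)//.
have -> : (x + y + w + y + x = w)%R.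
  by rewrite [LHS](ACl ((1*5)*(2*4)*3)%AC) /= !addvv !add0r.
rewrite -mulgA [T q p x]TC (mulgA (T p q x)) fam_adjr// !mulgA TT// mul1g.
by rewrite ![(w + _)%R]addrC.
Qed.

(* With T n p a, these elements represent the cosets of the subgroup generated by
   the elements over the first n points in that over the first n + 1 points. *)
Definition double_trans n a := T ord0 n a * T ord0 n 0%R.
Local Notation W := double_trans.

Lemma double_transK n a : ord0 != n -> W n a * W n a = 1.
Proof.
by move=> n0; rewrite /W {2}fam_comm// -mulgA TTA// TT.
Qed.

(** Replaces a translation over [n, r] by the chosen representative over [0, n] and a translation
    that does not involve [n]. *)
Lemma double_transE n r x y : ord0 != n -> ord0 != r -> r != n ->
  T r n x * T r n y = W n (x + y)%R * (T ord0 r x * T ord0 r y).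
Proof.
move=> n0 r0 rn; have nr : n != r by rewrite eq_sym.
have := fam_double (x + y)%R 0%R y n0 nr r0.
have -> : (x + y + 0 + y = x)%R by rewrite addr0 -addrA addvv addr0.
rewrite -/(W n _) add0r -[in RHS](_ : x = x + y + y)%R; last first.
  by rewrite -addrA addvv addr0.
by rewrite ![T n r _]TC => <-; rewrite mulgA double_transK// mul1g.
Qed.

(** No clause for inverses: the generators of a family are involutions. *)
Inductive tgen (n : nat) : G -> Prop :=
| TGen1 : tgen n 1
| TGenM p q a x : (p < n)%N -> (q < n)%N -> p != q -> tgen n x ->
    tgen n (T p q a * x).

Lemma tgen_mul (n : nat) x y : tgen n x -> tgen n y -> tgen n (x * y).
Proof.
move=> gx gy; elim: gx => [|p q a z pn qn pq _ IH]; first by rewrite mul1g.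
by rewrite -mulgA; exact: TGenM.
Qed.

Lemma tgen1 (n : nat) p q a : (p < n)%N -> (q < n)%N -> p != q -> tgen n (T p q a).
Proof. by move=> pn qn pq; rewrite -[T _ _ _]mulg1; apply: TGenM => //; exact: TGen1. Qed.

Let lt_neq (p n : 'I_8) : (p < n)%N -> p != n.
Proof. by rewrite -(inj_eq val_inj) /= ltn_neqAle => /andP[]. Qed.

Lemma pair_normal n r x y : (1 < n)%N -> (r < n)%N ->
  exists2 z, tgen n z & T r n x * T r n y = W n (x + y)%R * z.
Proof.
move=> n1 rn; pose o1 : 'I_8 := inord 1.
have o1n : (o1 < n)%N by rewrite inordK.
have n0 : ord0 != n by apply: lt_neq; exact: ltnW.
have o10 : ord0 != o1 by rewrite -(inj_eq val_inj) /= inordK.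
have [r0|r0] := eqVneq ord0 r; last first.
  exists (T ord0 r x * T ord0 r y); last by rewrite double_transE ?(lt_neq rn).
  by apply: tgen_mul; apply: tgen1 => //; exact: leq_ltn_trans rn.
(* For [r = 0] the product differs from [W n (x + y)] by a central factor, which is expressed over
   the points 0 and 1, both below [n]. *)
have n0' : n != ord0 by rewrite eq_sym.
have o10' : o1 != ord0 by rewrite eq_sym.
have := fam_double (x + y)%R 0%R y (lt_neq o1n) n0' o10'.
have -> : (x + y + 0 + y = x)%R by rewrite addr0 -addrA addvv addr0.
rewrite -r0 add0r ![T n _ _]TC => e.
have g a : tgen n (T ord0 o1 a) by apply: tgen1 => //; exact: ltnW.
exists (T ord0 o1 0%R * T ord0 o1 (x + y)%R *
    (T ord0 o1 (x + y + y)%R * T ord0 o1 y)).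
  by apply: tgen_mul; apply: tgen_mul.
rewrite mulgA -[X in W n X]add0r -double_transE ?(lt_neq o1n)//.
by rewrite ![T ord0 o1 _]TC -e -!mulgA !TTA ?(lt_neq o1n).
Qed.

Lemma double_trans0 n : ord0 != n -> W n 0%R = 1.
Proof. exact: TT. Qed.

Definition is_rep n (t : G) := (exists2 r : 'I_8, (r < n)%N & exists a, t = T r n a) \/
  exists a, t = W n a.

(** Left multiplication by a generator takes a representative to a representative, up to a right
    factor over the first [n] points. In the model, the [8 * (n + 1)] representatives match the
    positions of the point [n] together with a label. *)
Lemma tgen_coset (n : 'I_8) x : (1 < n)%N -> tgen n.+1 x ->
  exists t y, [/\ x = t * y, is_rep n t & tgen n y].
Proof.
move=> n1; have n0 : ord0 != n by apply: lt_neq; exact: ltnW.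
have main p q b t : (p < n.+1)%N -> (q < n.+1)%N -> p != q -> is_rep n t ->
    exists t' y, [/\ T p q b * t = t' * y, is_rep n t' & tgen n y].
  have small p' q' t' : (p' < n)%N -> (q' < n)%N -> p' != q' -> is_rep n t' ->
      exists t'' y, [/\ T p' q' b * t' = t'' * y, is_rep n t'' & tgen n y].
    move=> p'n q'n pq' t'r.
    have zn (z : 'I_8) : (z < n)%N -> (tperm p' q' z < n)%N.
      by case: tpermP => // ->.
    have nn : tperm p' q' n = n by rewrite tpermD ?lt_neq.
    case: t'r => [[r rn [a ->]] | [a ->]].
      rewrite fam_swap ?(lt_neq rn)// nn.
      exists (T (tperm p' q' r) n (a + b *+ meets1 p' q' r n)%R), (T p' q' b).
      by split=> //; [left; exists (tperm p' q' r); [exact: zn | eexists] | exact: tgen1].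
    rewrite /W mulgA fam_swap// -mulgA fam_swap// nn mulgA.
    have z0 : (tperm p' q' ord0 < n)%N by apply: zn; exact: ltnW.
    set x1 := (a + _)%R; set x2 := (0 + _)%R.
    have [z gz ->] := pair_normal x1 x2 n1 z0.
    exists (W n (x1 + x2)%R), (z * T p' q' b); split; first by rewrite mulgA.
      by right; eexists.
    by apply: tgen_mul => //; exact: tgen1.
  have top p' t' : (p' < n)%N -> is_rep n t' ->
      exists t'' y, [/\ T p' n b * t' = t'' * y, is_rep n t'' & tgen n y].
    move=> pn [[r rn [a ->]] | [a ->]].
      have [->|rp] := eqVneq r p'.
        have [z gz ->] := pair_normal b a n1 pn.
        by exists (W n (b + a)%R), z; split=> //; right; eexists.
      exists (T r n a), (T p' r (a + b)%R); split.
      - by rewrite [T r n a]TC fam_adjr// ?(lt_neq pn)// eq_sym// lt_neq.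
      - by left; exists r => //; eexists.
      - by apply: tgen1 => //; rewrite eq_sym.
    (* All three factors lie over [0, n] and commute. Two of them merge into [W n (b + a)], up to a
       factor below [n], and its factor with label 0 cancels the third. *)
    have [->|p0] := eqVneq p' ord0.
      have [z gz e] := pair_normal b a n1 (ltnW n1 : (ord0 < n)%N).
      exists (T ord0 n (b + a)%R), z; split=> //.
        rewrite /W fam_comm// mulgA fam_comm// -mulgA e /W [_ * T _ _ 0%R]fam_comm//.
        by rewrite -!mulgA TTA.
      by left; exists ord0; [exact: ltnW | eexists].
    have p0' : ord0 != p' by rewrite eq_sym.
    exists (T p' n (a + b)%R), (T ord0 p' (a + b)%R * T ord0 p' b); split.
    - have := double_transE b (a + b)%R n0 p0' (lt_neq pn).
      rewrite addrCA addvv addr0 => e.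
      have -> : W n a = T p' n b * (T p' n (a + b)%R *
          (T ord0 p' (a + b)%R * T ord0 p' b)).
        by rewrite !mulgA e -!mulgA !TTA// TT// mulg1.
      by rewrite TTA ?(lt_neq pn).
    - by left; exists p' => //; eexists.
    - by apply: tgen_mul; apply: tgen1 => //; exact: ltnW.
  rewrite ltnS leq_eqVlt => /orP[/eqP/val_inj-> | pn].
    rewrite ltnS leq_eqVlt => /orP[/eqP/val_inj->|qn _]; first by rewrite eqxx.
    by rewrite TC; exact: top.
  by rewrite ltnS leq_eqVlt => /orP[/eqP/val_inj-> _|]; [exact: top | exact: small].
elim=> [|p q b {}x pn qn pq _ [t [y [-> tr yn]]]].
  exists (W n 0%R), 1; split; last exact: TGen1.
    by rewrite double_trans0// mulg1.
  by right; exists 0%R.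
have [t' [y' [e t'r y'n]]] := main p q b t pn qn pq tr.
exists t', (y' * y); split=> //; last exact: tgen_mul.
by rewrite mulgA e mulgA.
Qed.

Let fam_pair p q r a b c : p != q -> q != r -> p != r ->
  T p q c * (T q r a * T q r b) = T q r a * T q r b * T p q (c + a + b)%R.
Proof.
move=> pq qr pr; have rq : r != q by rewrite eq_sym.
rewrite mulgA fam_adjr// -(mulgA (T q r a) (T p r _)) [T q r b]TC.
rewrite (fam_adjr _ b pr rq pq) mulgA.
by rewrite addrC [(a + c)%R]addrC.
Qed.

Let fam_pairl p q r a b c : p != q -> q != r -> p != r ->
  T p q a * T p q b * T q r c = T q r (c + a + b)%R * (T p q a * T p q b).
Proof.
move=> pq qr pr; have qp : q != p by rewrite eq_sym.
rewrite -mulgA (fam_adj b c pq qr pr) mulgA [T p q a]TC (fam_adj a (c + b)%R qp pr qr).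
by rewrite -mulgA -addrA [(b + a)%R]addrC addrA.
Qed.

(* In the twisted group, the central element beta a b + beta b a. *)
Definition pair_center q r a b :=
  T q r 0%R * T q r a * (T q r b * T q r (a + b)%R).

(** Passing through the four factors changes the label [c] by [0 + a + b + (a + b) = 0]. *)
Lemma pair_center_commute p q r a b c : p != q -> q != r -> p != r ->
  commute (T p q c) (pair_center q r a b).
Proof.
move=> pq qr pr; rewrite /commute /pair_center mulgA fam_pair// -mulgA fam_pair//.
rewrite !mulgA; congr (_ * T _ _ _).
by rewrite addr0 -!addrA [X in (c + X)%R]addrA [X in (c + X)%R]addvv addr0.
Qed.

(** The translation [U] commutes with the center and adds [a] to the label of each [T q r]. So the
    product over an affine plane of labels depends only on the direction of the plane. *)
Lemma pair_center_shift p q r a b c : p != q -> q != r -> p != r ->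
  pair_center q r b c = T q r a * T q r (b + a)%R *
    (T q r (c + a)%R * T q r (b + c + a)%R).
Proof.
move=> pq qr pr; pose U := T p q 0%R * T p q a.
have UV x : U * T q r x = T q r (x + a)%R * U by rewrite fam_pairl// addr0.
apply: (mulIg U); have : commute U (pair_center q r b c).
  by apply/commute_sym/commuteM; apply/commute_sym/pair_center_commute.
rewrite /commute => <-; rewrite /pair_center.
by rewrite !mulgA UV add0r -(mulgA _ U) UV mulgA -(mulgA _ U) UV mulgA
   -(mulgA _ U) UV !mulgA.
Qed.
End FamilyTheory.

(** * Words in commuting involutions, compared by computation, and the normal form over two
    points *)

Fixpoint toggle (x : nat) (s : seq nat) : seq nat :=
  if s is y :: s' then 
    if x == y then s' else if (x < y)%N then x :: s else y :: toggle x s'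
  else [:: x].

Definition parity_reduce (s : seq nat) : seq nat := foldr toggle [::] s.

Section InvolutionProducts.
Local Open Scope group_scope.
Variables (G : groupType) (h : nat -> G).
Hypotheses (hh : forall i, h i * h i = 1) (hC : forall i j, h i * h j = h j * h i).

Definition word_prod (s : seq nat) : G := foldr (fun i x => h i * x) 1 s.

Lemma word_prod_cat s t : word_prod (s ++ t) = word_prod s * word_prod t.
Proof. by elim: s => [|i s IH] /=; rewrite ?mul1g// IH mulgA. Qed.

Lemma word_prod_reduce s : word_prod (parity_reduce s) = word_prod s.
Proof.
have tog x t : word_prod (toggle x t) = h x * word_prod t.
  elim: t => //= y t IH; case: eqP => [->|_]; first by rewrite mulgA hh mul1g.
  by case: ifP => // _; rewrite /= IH !mulgA hC.
by elim: s => //= x s IH; rewrite tog IH.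
Qed.

Lemma word_prodC s t : word_prod s * word_prod t = word_prod t * word_prod s.
Proof.
have comm i u : h i * word_prod u = word_prod u * h i.
  by elim: u => [|j u IH] /=; rewrite ?mulg1 ?mul1g// mulgA hC -mulgA IH mulgA.
elim: s => [|i s IH] /=; first by rewrite mulg1 mul1g.
by rewrite -mulgA IH !mulgA comm.
Qed.

Lemma word_prod_sq s : word_prod s * word_prod s = 1.
Proof.
elim: s => [|i s IH] /=; first by rewrite mulg1.
have E : h i * word_prod s = word_prod s * h i by have := word_prodC [:: i] s; rewrite /= mulg1.
by rewrite {1}E -mulgA (mulgA (h i)) hh mul1g.
Qed.

Lemma word_prod_eq s t : parity_reduce s = parity_reduce t ->
  word_prod s = word_prod t.
Proof. by move=> st; rewrite -word_prod_reduce st word_prod_reduce. Qed.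
Lemma word_prod_flatten (g : nat -> G) (t : nat -> seq nat) s :
  {in s, forall i, g i = word_prod (t i)} ->
  foldr (fun i x => g i * x) 1 s = word_prod (flatten (map t s)).
Proof.
elim: s => //= i s IH gt; rewrite word_prod_cat gt ?mem_head// IH// => j js.
by apply: gt; rewrite inE js orbT.
Qed.
End InvolutionProducts.

Definition hom3 (G : groupType) (g : nat -> G) (c : V) : G :=
  word_prod g [seq i <- iota 0 3 | c ord0 (inord i) != 0%R].

Lemma hom3D (G : groupType) (g : nat -> G) (c d : V) :
  (forall i, g i * g i = 1)%g -> (forall i j, g i * g j = g j * g i)%g ->
  hom3 g (c + d)%R = (hom3 g c * hom3 g d)%g.
Proof.
move=> gg gC; rewrite /hom3 -word_prod_cat; apply: word_prod_eq => // /=.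
rewrite !mxE.
have E k := (Z2_cases (c ord0 (inord k)), Z2_cases (d ord0 (inord k))).
by case: (E 0) => -[] -> [] ->; case: (E 1) => -[] -> [] ->;
   case: (E 2) => -[] -> [] ->.
Qed.

Lemma hom3_0 (G : groupType) (g : nat -> G) : hom3 g 0%R = 1%g.
Proof. by rewrite /hom3 /= !mxE. Qed.

Lemma code_labelE c i : (i < 3)%N -> (code_label c ord0 (inord i) != 0%R) =
  nth false [:: odd c; odd c./2; odd c./2./2] i.
Proof. by move=> i3; rewrite mxE inordK//; case: (nth _ _ _); rewrite ?oner_eq0 ?eqxx. Qed.

Lemma betaE (a : V) i : (i < 3)%N -> (beta a a ord0 (inord i) != 0%R) =
  (a ord0 (inord (nth 0%N [:: 0; 0; 1] i)%N) != 0%R) &&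
  (a ord0 (inord (nth 0%N [:: 1; 2; 2] i)%N) != 0%R).
Proof.
have mulb (x y : 'Z_2) : (x * y != 0)%R = (x != 0%R) && (y != 0%R).
  by case: (Z2_cases x) => ->; case: (Z2_cases y) => ->.
by move=> i3; rewrite mxE inordK// mulb.
Qed.

Lemma row3P (a b : V) :
  (forall k, (k < 3)%N -> a ord0 (inord k) = b ord0 (inord k)) -> a = b.
Proof. by move=> ab; apply/rowP; apply: ord3P; exact: ab. Qed.

Lemma sum_basis (w : V) :
  (\sum_(i <- [seq i <- iota 0 3 | w ord0 (inord i) != 0]) code_label (2 ^ i) = w)%R.
Proof.
rewrite big_filter !big_cons big_nil; apply: row3P => k k3.
have E i := Z2_cases (w ord0 (inord i)).
case: (E 0%N) (E 1%N) (E 2%N) => E0 [] E1 [] E2;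
  rewrite E0 E1 E2 ?eqxx ?oner_eq0 /=;
  case: k k3 => [|[|[|//]]] _; rewrite ?E0 ?E1 ?E2 !mxE ?inordK//; exact/val_inj.
Qed.

Lemma code_labelD i j k : (i < 8)%N -> (j < 8)%N -> xor3 j i = k ->
  (code_label i + code_label j = code_label k)%R.
Proof.
move=> i8 j8 <-; apply: (can_inj label_codeK).
rewrite label_codeD !code_labelK//.
by move: j j8 i i8; do 8 (case=> [_|]; first by do 8 case=> //).
Qed.

Section PairNormalForm.
Local Open Scope group_scope.
Variables (G : groupType) (T : 'I_8 -> 'I_8 -> V -> G).
Hypothesis famT : tfamily T.

Let o1 : 'I_8 := inord 1.
Let o2 : 'I_8 := inord 2.
Let o01 : ord0 != o1. Proof. by rewrite -(inj_eq val_inj) /= inordK. Qed.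
Let o21 : o2 != o1. Proof. by rewrite -(inj_eq val_inj) /= !inordK. Qed.
Let o02 : ord0 != o2. Proof. by rewrite -(inj_eq val_inj) /= !inordK. Qed.

Definition pair_elt (i : nat) := T ord0 o1 (code_label i).
Local Notation A := pair_elt.
Let AA i : A i * A i = 1. Proof. by case: famT => _ + _; apply. Qed.
Let AC i j : A i * A j = A j * A i. Proof. exact: fam_comm. Qed.

Definition pair_trans i :=
  word_prod A (nth [::] [:: [:: 0; 1]; [:: 0; 2]; [:: 0; 4]]%N i).
Definition pair_cent i :=
  word_prod A (nth [::] [:: [:: 0; 1; 2; 3]; [:: 0; 1; 4; 5]; [:: 0; 2; 4; 6]]%N i).

Let A0E : T ord0 o1 0%R = A 0.
Proof.
by rewrite /A /pair_elt; congr T; apply/rowP; apply: ord3P; rewrite !mxE ?inordK.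
Qed.

Lemma pair_centE i : (i < 3)%N -> pair_cent i =
  nth 1 [:: pair_center T ord0 o1 (code_label 1) (code_label 2);
            pair_center T ord0 o1 (code_label 1) (code_label 4);
            pair_center T ord0 o1 (code_label 2) (code_label 4)] i.
Proof.
by case: i => [|[|[|//]]] _; rewrite /pair_cent /pair_center /= mulg1 A0E
  ?(@code_labelD 1 2 3) ?(@code_labelD 1 4 5) ?(@code_labelD 2 4 6)// -?mulgA.
Qed.

(** By definition of [pair_cent 2], this means that the eight commuting involutions [A i] have
    product 1. They generate a group of order at most [2 * 2^3 * 2^3], the shape of the normal form.
    A third point is needed to see it. *)
Lemma pair_cent_shift : pair_cent 2 = word_prod A [:: 1; 3; 5; 7]%N.
Proof.
rewrite pair_centE//=.
rewrite (pair_center_shift famT (code_label 1) (code_label 2) (code_label 4) _ o01 o21) 1?eq_sym//.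
rewrite (@code_labelD 2 1 3)// (@code_labelD 4 1 5)// (@code_labelD 2 4 6)//.
by rewrite (@code_labelD 6 1 7)//= mulg1 -!mulgA.
Qed.

Lemma pair_elt_normal a : T ord0 o1 a =
  A 0 * (hom3 pair_trans a * hom3 pair_cent (beta a a)).
Proof.
have k8 := label_code_lt a; rewrite -(label_codeK a).
move: (label_code a) k8 => k k8.
(* The word that defines [pair_cent 2] suffices for all labels but 7, for which [A 7] has to
   occur. *)
pose t := if k == 7 then [:: 1; 3; 5; 7]%N else [:: 0; 2; 4; 6]%N.
pose ts := [:: [:: 0; 1; 2; 3]; [:: 0; 1; 4; 5]; t]%N.
rewrite /hom3 [word_prod pair_trans _](word_prod_flatten (h := A)
  (t := nth [::] [:: [:: 0; 1]; [:: 0; 2]; [:: 0; 4]]%N))//.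
rewrite [word_prod pair_cent _](word_prod_flatten (h := A) (t := nth [::] ts)); last first.
  move=> i; rewrite mem_filter mem_iota => /andP[_ i3]; rewrite /ts /t.
  by case: i i3 => [|[|[|//]]] _ //=; case: eqP => // _; exact: pair_cent_shift.
rewrite -word_prod_cat.
transitivity (word_prod A [:: k]); first by rewrite /= mulg1.
set s := flatten _ ++ _; change (A 0 * word_prod A s) with (word_prod A (0%N :: s)).
apply: word_prod_eq => //; rewrite {}/s /= !betaE//= !code_labelE//.
by rewrite /ts /t {t ts}; do 8 (case: k k8 => [//|k] k8).
Qed.

Lemma tgen2_normal x : tgen T 2 x -> exists (e : bool) v c,
  x = A 0 ^+ e * (hom3 pair_trans v * hom3 pair_cent c).
Proof.
have U v w : hom3 pair_trans (v + w)%R = hom3 pair_trans v * hom3 pair_trans w.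
  by apply: hom3D => *; [exact: word_prod_sq | exact: word_prodC].
have Z v w : hom3 pair_cent (v + w)%R = hom3 pair_cent v * hom3 pair_cent w.
  by apply: hom3D => *; [exact: word_prod_sq | exact: word_prodC].
have UW v : exists s, hom3 pair_trans v = word_prod A s.
  by eexists; apply: (word_prod_flatten (h := A)).
have ZW v : exists s, hom3 pair_cent v = word_prod A s.
  by eexists; apply: (word_prod_flatten (h := A)).
have UZ v w : commute (hom3 pair_trans v) (hom3 pair_cent w).
  by have [[s ->] [t ->]] := (UW v, ZW w); exact: word_prodC.
have main a y : (exists (e : bool) v c, y = A 0 ^+ e * (hom3 pair_trans v * hom3 pair_cent c)) ->
   exists (e : bool) v c, T ord0 o1 a * y = A 0 ^+ e * (hom3 pair_trans v * hom3 pair_cent c).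
  case=> e [v [c ->]]; exists (~~ e), (a + v)%R, (beta a a + c)%R.
  rewrite pair_elt_normal U Z; set u := hom3 _ a; set z := hom3 _ (beta a a).
  have zv : z * hom3 pair_trans v = hom3 pair_trans v * z by exact/esym/UZ.
  have AW s : word_prod A s * A 0 = A 0 * word_prod A s.
    by have := word_prodC AC s [:: 0%N]; rewrite /= mulg1.
  have uzA : u * z * A 0 = A 0 * (u * z).
    by rewrite /u /z; have [[s ->] [t ->]] := (UW a, ZW (beta a a)); rewrite -word_prod_cat.
  have -> : A 0 ^+ (~~ e) * (u * hom3 pair_trans v * (z * hom3 pair_cent c)) =
      A 0 ^+ (~~ e) * (u * z * (hom3 pair_trans v * hom3 pair_cent c)).
    by congr (_ * _); rewrite -!mulgA; congr (_ * _); rewrite !mulgA zv.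
  rewrite !mulgA; congr (_ * _ * _); case: e; last by rewrite !mulg1.
  by rewrite /= -!mulgA (mulgA u) uzA (mulgA (A 0)) AA.
elim=> [|p q a y p2 q2 pq _]; first by exists false, 0%R, 0%R; rewrite !hom3_0 !mulg1.
have cases (r : 'I_8) : (r < 2)%N -> r = ord0 \/ r = o1.
  by case: r => -[|[|//]] ? _; [left | right]; apply/val_inj; rewrite //= inordK.
case: (cases p p2) pq => ->; case: (cases q q2) => ->; rewrite ?eqxx// => _.
- exact: main.
- by have [-> _ _] := famT; exact: main.
Qed.
End PairNormalForm.

Section TwistedPairs.
Local Open Scope ring_scope.
Variables p q : 'I_8.
Hypothesis pq : p != q.

Definition tw_pair (v c : V) : twisted := (1%g, [ffun i => v *+ meets p q i], c).

Lemma tw_pair0 : tw_pair 0 0 = 1%g.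
Proof. by apply: tw_eq => // i; rewrite /twv /= !ffunE mul0rn. Qed.

(** No cocycle term survives, since [beta v w] is counted once at [p] and once at [q]. *)
Lemma tw_pairD v c w d : (tw_pair v c * tw_pair w d)%g = tw_pair (v + w) (c + d).
Proof.
apply: tw_eq => [|i|]; first by rewrite /twp /= mulg1.
  by rewrite twvM /twv /= invg1 perm1 !ffunE mulrnDl.
rewrite twcM /twc /= -[RHS]addr0; congr (_ + _).
transitivity (\sum_i beta v w *+ meets p q i).
  apply: eq_bigr => i _; rewrite /twv /= !ffunE invg1 perm1 betaMbl betaMbr.
  by case: meets.
by rewrite (sum_meets (fun=> beta v w))// addvv.
Qed.

Lemma tw_tr_pair a b : (tw_tr p q a * tw_tr p q b)%g = tw_pair (a + b) (beta a a + beta b b).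
Proof.
rewrite tw_tr_mul//; apply: tw_eq => [|i|]; first by rewrite /twp /= tperm2.
  by rewrite /twv /= !ffunE meets_id mulrnDl.
by rewrite /twc /= /meets1 /meets !eqxx orbT addr0.
Qed.
End TwistedPairs.

(** * A map to the model that respects the families is injective on products of their elements *)

Section Injectivity.
Local Open Scope group_scope.
Variables (P : groupType) (T : 'I_8 -> 'I_8 -> V -> P).
Hypothesis famT : tfamily T.
Variable f : {multiplicative P -> twisted}.
Hypothesis fT : forall p q a, p != q -> f (T p q a) = tw_tr p q a.

Lemma mult1 (G K : groupType) (k : {multiplicative G -> K}) : k 1 = 1.
Proof. by apply: (mulgI (k 1)); rewrite -gmulfM !mulg1. Qed.

Lemma tgen_fixes (n : nat) (i : 'I_8) y : (n <= i)%N -> tgen T n y ->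
  twp (f y) i = i /\ twv (f y) i = 0%R.
Proof.
move=> ni; elim=> [|p q a {}y pn qn pq _ [py vy]].
  by rewrite mult1 /twp /twv /= perm1 ffunE.
have [ip iq] : i != p /\ i != q.
  by rewrite -!(inj_eq val_inj) /= !gtn_eqF// (leq_trans _ ni).
rewrite gmulfM fT// twpM twvM permM /twp /= tpermD 1?eq_sym//; split=> //.
rewrite vy addr0 -[X in (twp (f y))^-1 X]py permK twv_tr /meets.
by rewrite (negPf ip) (negPf iq).
Qed.

Let o1 : 'I_8 := inord 1.

Let o01 : ord0 != o1. Proof. by rewrite -(inj_eq val_inj) /= inordK. Qed.

Let f_word g s : f (word_prod g s) = word_prod (f \o g) s.
Proof. by elim: s => /= [|i s IH]; rewrite ?mult1// gmulfM IH. Qed.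

Lemma tgen2_inj x : tgen T 2 x -> f x = 1 -> x = 1.
Proof.
move=> /(tgen2_normal famT)[e [v [c ->]]].
have fA i : f (pair_elt T i) = tw_tr ord0 o1 (code_label i) by exact: fT.
have word_prod_pairs k l s : word_prod (fun i => tw_pair ord0 o1 (k i) (l i)) s =
    tw_pair ord0 o1 (\sum_(i <- s) k i)%R (\sum_(i <- s) l i)%R.
  elim: s => [|i s IH]; first by rewrite !big_nil tw_pair0.
  by rewrite !big_cons /= IH tw_pairD.
have fU i : (i < 3)%N -> f (pair_trans T i) = tw_pair ord0 o1 (code_label (2 ^ i)) 0%R.
  move=> i3; have -> : pair_trans T i = word_prod (pair_elt T) [:: 0; 2 ^ i]%N.
    by case: i i3 => [|[|[|//]]].
  rewrite f_word /= !fA mulg1 tw_tr_pair//; congr tw_pair; apply: row3P => k k3.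
    by case: i i3 => [|[|[|//]]] _; case: k k3 => [|[|[|//]]] _; rewrite !mxE !inordK//; exact/val_inj.
  by case: i i3 => [|[|[|//]]] _; case: k k3 => [|[|[|//]]] _; rewrite !mxE !inordK//; exact/val_inj.
have fZ i : (i < 3)%N -> f (pair_cent T i) = tw_pair ord0 o1 0%R (code_label (2 ^ i)).
  case: i => [|[|[|//]]] _; rewrite f_word /= !fA mulg1 mulgA !tw_tr_pair// tw_pairD//;
    congr tw_pair; apply: row3P; case=> [|[|[|//]]] _;
    by rewrite !mxE !inordK//; exact/val_inj.
have fhom g (w : V) k l : (forall i, (i < 3)%N -> f (g i) = tw_pair ord0 o1 (k i) (l i)) ->
    let s := [seq i <- iota 0 3 | w ord0 (inord i) != 0%R] in
    f (hom3 g w) = tw_pair ord0 o1 (\sum_(i <- s) k i)%R (\sum_(i <- s) l i)%R.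
  move=> gE s; rewrite -word_prod_pairs -/s f_word.
  have aux t : {subset t <= iota 0 3} -> word_prod (f \o g) t =
      word_prod (fun i => tw_pair ord0 o1 (k i) (l i)) t.
    elim: t => [//|i t IH] s3 /=.
    rewrite IH; last by move=> j js; apply: s3; rewrite inE js orbT.
    by rewrite gE//; have := s3 i (mem_head _ _); rewrite mem_iota.
  by apply: aux => i; rewrite mem_filter => /andP[].
have fUv : f (hom3 (pair_trans T) v) = tw_pair ord0 o1 v 0%R.
  rewrite (fhom _ _ (fun i => code_label (2 ^ i)) (fun=> 0%R))//.
  by rewrite sum_basis big1.
have fZc : f (hom3 (pair_cent T) c) = tw_pair ord0 o1 0%R c.
  rewrite (fhom _ _ (fun=> 0%R) (fun i => code_label (2 ^ i)))//.
  by rewrite sum_basis big1.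
rewrite !gmulfM fUv fZc tw_pairD// addr0 add0r.
case: e => [|] /=; last first.
  rewrite mult1 mul1g => E.
  have -> : v = 0%R by have := congr1 (twv^~ ord0) E; rewrite /twv /= !ffunE.
  have -> : c = 0%R by exact: (congr1 twc E).
  by rewrite !hom3_0 !mulg1.
rewrite fA => /(congr1 twp)/permP/(_ ord0)/eqP.
by rewrite twpM /twp /= mulg1 tpermL perm1 eq_sym (negPf o01).
Qed.

(** Descent along the points: in [x = t * y] the factor [y] fixes the last point with label 0, hence
    so does the representative [t], and then [t = 1]. The normal form over two points ends the
    descent. *)
Lemma tgen_inj (n : nat) x : (1 < n <= 8)%N -> tgen T n x -> f x = 1 -> x = 1.
Proof.
elim: n x => // n IH x /andP[]; rewrite ltnS leq_eqVlt => /orP[/eqP<- _|n1 n8].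
  exact: tgen2_inj.
pose i := Ordinal n8; have i0 : ord0 != i by rewrite -(inj_eq val_inj) /= ltn_eqF// ltnW.
move=> xn; have [t [y [-> tr yn]]] := @tgen_coset _ _ famT i x n1 xn.
have [py vy] := tgen_fixes (leqnn i) yn.
have pyV : (twp (f y))^-1 i = i by rewrite -{1}py permK.
rewrite gmulfM => fty1.
have pt : twp (f t) i = i.
  apply: (@perm_inj _ (twp (f y))).
  by rewrite -permM -twpM fty1 /twp /= perm1 py.
have vt : twv (f t) i = 0%R.
  have := congr1 (fun x => twv x i) fty1; rewrite twvM pyV vy addr0 => ->.
  by rewrite /twv /= ffunE.
have t1 : t = 1.
  case: tr => [[r ri [a tE]]|[a tE]].
    have rni : r != i by rewrite -(inj_eq val_inj) /= ltn_eqF.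
    by move: (rni); rewrite -pt tE fT// /twp /= tpermR eqxx.
  rewrite tE /double_trans.
  move: vt; rewrite tE gmulfM !fT// twvM !twv_tr /twp /= tpermV tpermR /meets.
  rewrite !eqxx orbT /= mulr1n mul0rn addr0 => ->.
  by case: famT => _ + _; apply.
rewrite t1 mul1g; apply: IH => //; first by rewrite n1 ltnW.
by rewrite t1 mult1 mul1g in fty1.
Qed.
End Injectivity.

(** * Verification of (R4) and (R5) in every group with a twisted family *)

Definition conj_node (w : seq node) (n : node) : node := foldr act n w.

(** As the generators are involutions, (R4) only involves conjugates of generators by palindromic
    words, which are attached to nodes. Equality, commutation and braiding can then be tested on
    nodes with [act]. *)
Definition vertex_check (a a' b b' c c' d d' : node) : bool :=
  let com n m := act n m == m in
  let br n m := act n m == act m n in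
  let J := conj_node in
  [&& br a' b, br a' b', br a' (J [:: b] b'),
      br c d, br c' d, br (J [:: c] c') d,
      com (J [:: b'; b] a') d,
      com (J [:: b'; b] a') (J [:: c; c'; d] d') &
  [&& br a b, br a b', br a (J [:: b] b'),
      br c (J [:: d] d'), br c' (J [:: d] d'), br (J [:: c] c') (J [:: d] d'),
      com (J [:: b'; b] a) (J [:: d] d'),
      com (J [:: b'; b] a) (J [:: c; c'; d; d'] d) &
  [&& J [:: b'; b; a'] b == J [:: d] c', J [:: b'; b; a'] b' == J [:: d; c'] c,
      J [:: b'; b; a] b == J [:: d; d'; d] c' &
      J [:: b'; b; a] b' == J [:: d; d'; d; c'] c]]].

Section NodeElements.
Local Open Scope group_scope.
Variables (G : groupType) (T : 'I_8 -> 'I_8 -> V -> G).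
Hypothesis famT : tfamily T.

Definition node_tr (n : node) : G :=
  T (inord n.1.1) (inord n.1.2) (code_label n.2).
Local Notation N := node_tr.

Lemma node_tr_label p q a : N (label_node p q a) = T p q a.
Proof.
have [TC _ _] := famT.
by rewrite /N /label_node /sort_node; case: ifP => _ /=; rewrite !inord_val label_codeK.
Qed.

Lemma nodes_label n : n \in nodes -> exists p q a, [/\ p != q,
  n = ((p : 'I_8) : nat, (q : 'I_8) : nat, label_code a) & n = label_node p q a].
Proof.
have /allP h : all (fun n => [&& n.1.1 < n.1.2, n.1.2 < 8 & n.2 < 8]) nodes.
  by vm_cast_no_check (erefl true).
case: n => -[p q] a /h/= /and3P[pq q8 a8].
exists (Ordinal (ltn_trans pq q8)), (Ordinal q8), (code_label a).
rewrite -(inj_eq val_inj) /= (ltn_eqF pq) code_labelK//; split=> //.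
by rewrite /label_node /sort_node /= (ltnW pq) code_labelK.
Qed.

Lemma node_tr_conj n m : n \in nodes -> m \in nodes ->
  [/\ act n m \in nodes, N n * N n = 1 & N n * N m * N n = N (act n m)].
Proof.
move=> /nodes_label[p [q [a [pq nE nL]]]] /nodes_label[r [s [b [rs _ ->]]]].
have [_ TT TJ] := famT.
split.
- by rewrite nE act_label_node; apply: label_node_in; rewrite (inj_eq perm_inj).
- by rewrite nL node_tr_label TT.
- by rewrite nE act_label_node -nE nL !node_tr_label TJ.
Qed.

Lemma node_tr_pal w n : all (mem nodes) w -> n \in nodes ->
  conj_node w n \in nodes /\
  foldr (fun m x => N m * x * N m) (N n) w = N (conj_node w n).
Proof.
move=> + nn; elim: w => //= m w IH /andP[mn /IH[wn ->]].
by have [? _ ->] := node_tr_conj mn wn.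
Qed.

Lemma vertex_check_relations a a' b b' c c' d d' :
  all (mem nodes) [:: a; a'; b; b'; c; c'; d; d'] ->
  vertex_check a a' b b' c c' d d' ->
  vertex_relations (N a) (N a') (N b) (N b') (N c) (N c') (N d) (N d').
Proof.
move=> ns.
pose L := [:: a; a'; b; b'; c; c'; d; d']; pose l := nth a L.
have ln i : (i < 8)%N -> l i \in nodes by move=> i8; apply: (allP ns); exact: mem_nth.
have NN n : n \in nodes -> N n * N n = 1 by move=> nn; have [] := node_tr_conj nn nn.
have NV i : (i < 8)%N -> (N (l i))^-1 = N (l i) by move=> /ln/NN; exact: invol_inv.
pose pal w i := foldr (fun j x => N (l j) * x * N (l j)) (N (l i)) w.
pose pnode w i := conj_node (map l w) (l i).
have palE w i : all (fun j => j < 8)%N (i :: w) -> pnode w i \in nodes /\ pal w i = N (pnode w i).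
  case/andP=> i8 w8; have [||wn <-] := @node_tr_pal (map l w) (l i); rewrite ?ln//.
    by rewrite all_map; apply: sub_all w8 => j; exact: ln.
  by split=> //; rewrite /pal foldr_map.
have com w i w' j : all (fun j => j < 8)%N (i :: w ++ j :: w') ->
    act (pnode w i) (pnode w' j) == pnode w' j -> commw (pal w i) (pal w' j) = 1.
  rewrite -cat_cons all_cat => /andP[/palE[m ->] /palE[n ->]] /eqP e.
  have [_ _ J] := node_tr_conj m n; apply/commw_commute.
  by rewrite /commute -{2}e -J -mulgA (NN _ m) mulg1.
have br w i w' j : all (fun j => j < 8)%N (i :: w ++ j :: w') ->
    act (pnode w i) (pnode w' j) == act (pnode w' j) (pnode w i) ->
    braidw (pal w i) (pal w' j) = 1.
  rewrite -cat_cons all_cat => /andP[/palE[m ->] /palE[n ->]] /eqP e.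
  have [_ mm J] := node_tr_conj m n; have [_ nn J'] := node_tr_conj n m.
  move: J'; rewrite -e -J {e J}; move: (N (pnode w i)) (N (pnode w' j)) mm nn => x y xx yy E.
  by rewrite /braidw !invol_inv// -E -(mulgA (y * x) y y) yy mulg1 -(mulgA y) xx mulg1 yy.
have same w i w' j : all (fun j => j < 8)%N (i :: w ++ j :: w') ->
    pnode w i == pnode w' j -> pal w i = pal w' j.
  by rewrite -cat_cons all_cat => /andP[/palE[m ->] /palE[n ->]] /eqP->.
have [Va Va' Vb Vb'] := And4 (@NV 0%N isT) (@NV 1%N isT) (@NV 2%N isT) (@NV 3%N isT).
have [Vc Vc' Vd Vd'] := And4 (@NV 4%N isT) (@NV 5%N isT) (@NV 6%N isT) (@NV 7%N isT).
rewrite /l /L /= in Va Va' Vb Vb' Vc Vc' Vd Vd'.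
rewrite /vertex_relations !(Va, Va', Vb, Vb', Vc, Vc', Vd, Vd') -!mulgA.
move/andP=> [r r']; have := (br [::] 1 [::] 2 isT r)%N; rewrite /pal /= -?mulgA => p0 {r}; move: r'.
move/andP=> [r r']; have := (br [::] 1 [::] 3 isT r)%N; rewrite /pal /= -?mulgA => p1 {r}; move: r'.
move/andP=> [r r']; have := (br [::] 1 [:: 2] 3 isT r)%N; rewrite /pal /= -?mulgA => p2 {r}; move: r'.
move/andP=> [r r']; have := (br [::] 4 [::] 6 isT r)%N; rewrite /pal /= -?mulgA => p3 {r}; move: r'.
move/andP=> [r r']; have := (br [::] 5 [::] 6 isT r)%N; rewrite /pal /= -?mulgA => p4 {r}; move: r'.
move/andP=> [r r']; have := (br [:: 4] 5 [::] 6 isT r)%N; rewrite /pal /= -?mulgA => p5 {r}; move: r'.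
move/andP=> [r r']; have := (com [:: 3; 2] 1 [::] 6 isT r)%N; rewrite /pal /= -?mulgA => p6 {r}; move: r'.
move/andP=> [r r']; have := (com [:: 3; 2] 1 [:: 4; 5; 6] 7 isT r)%N; rewrite /pal /= -?mulgA => p7 {r}; move: r'.
move/andP=> [r r']; have := (br [::] 0 [::] 2 isT r)%N; rewrite /pal /= -?mulgA => p8 {r}; move: r'.
move/andP=> [r r']; have := (br [::] 0 [::] 3 isT r)%N; rewrite /pal /= -?mulgA => p9 {r}; move: r'.
move/andP=> [r r']; have := (br [::] 0 [:: 2] 3 isT r)%N; rewrite /pal /= -?mulgA => p10 {r}; move: r'.
move/andP=> [r r']; have := (br [::] 4 [:: 6] 7 isT r)%N; rewrite /pal /= -?mulgA => p11 {r}; move: r'.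
move/andP=> [r r']; have := (br [::] 5 [:: 6] 7 isT r)%N; rewrite /pal /= -?mulgA => p12 {r}; move: r'.
move/andP=> [r r']; have := (br [:: 4] 5 [:: 6] 7 isT r)%N; rewrite /pal /= -?mulgA => p13 {r}; move: r'.
move/andP=> [r r']; have := (com [:: 3; 2] 0 [:: 6] 7 isT r)%N; rewrite /pal /= -?mulgA => p14 {r}; move: r'.
move/andP=> [r r']; have := (com [:: 3; 2] 0 [:: 4; 5; 6; 7] 6 isT r)%N; rewrite /pal /= -?mulgA => p15 {r}; move: r'.
move/andP=> [r r']; have := (same [:: 3; 2; 1] 2 [:: 6] 5 isT r)%N; rewrite /pal /= -?mulgA => p16 {r}; move: r'.
move/andP=> [r r']; have := (same [:: 3; 2; 1] 3 [:: 6; 5] 4 isT r)%N; rewrite /pal /= -?mulgA => p17 {r}; move: r'.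
move/andP=> [r r']; have := (same [:: 3; 2; 0] 2 [:: 6; 7; 6] 5 isT r)%N; rewrite /pal /= -?mulgA => p18 {r}; move: r'.
move=> r; have := (same [:: 3; 2; 0] 3 [:: 6; 7; 6; 5] 4 isT r)%N; rewrite /pal /= -?mulgA => p19 {r}.
by do ! split.
Qed.
End NodeElements.

Section LetterElements.
Local Open Scope group_scope.
Variables (G : groupType) (T : 'I_8 -> 'I_8 -> V -> G).
Hypothesis famT : tfamily T.
Local Notation N := (node_tr T).

Definition letter_tr (x : gen) : G := N (letter_node (x.1.*2 + x.2)).

Lemma letter_nodes k : (k < 24)%N -> letter_node k \in nodes.
Proof.
have /allP h : all (fun k => letter_node k \in nodes) (iota 0 24).
  by vm_cast_no_check (erefl true).
by move=> k24; apply: h; rewrite mem_iota.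
Qed.

Lemma letter_tr_lt (x : gen) : (x.1.*2 + x.2 < 24)%N.
Proof.
case: x => k e /=; have : (k.*2.+1 < 12.*2)%N by rewrite -doubleS leq_double.
by case: e; rewrite ?addn1 ?addn0// => /ltnW.
Qed.

Lemma letter_tr_vertex (i j k l : 'I_12) : (i.+1, j.+1, k.+1, l.+1) \in vertex_edges ->
  vertex_relations (letter_tr (i, false)) (letter_tr (i, true))
    (letter_tr (j, false)) (letter_tr (j, true)) (letter_tr (k, false))
    (letter_tr (k, true)) (letter_tr (l, false)) (letter_tr (l, true)).
Proof.
pose ln (x : gen) := letter_node (x.1.*2 + x.2).
pose at_edges chk (t : nat * nat * nat * nat) : bool :=
  let: (i, j, k, l) := t in
  chk (letter_node (i.-1.*2 + false)%N) (letter_node (i.-1.*2 + true)%N)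
    (letter_node (j.-1.*2 + false)%N) (letter_node (j.-1.*2 + true)%N)
    (letter_node (k.-1.*2 + false)%N) (letter_node (k.-1.*2 + true)%N)
    (letter_node (l.-1.*2 + false)%N) (letter_node (l.-1.*2 + true)%N).
(* The predicate is abstracted to keep it from being evaluated symbolically. *)
have key chk : all (at_edges chk) vertex_edges -> (i.+1, j.+1, k.+1, l.+1) \in vertex_edges ->
    chk (ln (i, false)) (ln (i, true)) (ln (j, false)) (ln (j, true))
      (ln (k, false)) (ln (k, true)) (ln (l, false)) (ln (l, true)).
  by move=> /allP h /h.
have all_checks : all (at_edges vertex_check) vertex_edges by vm_cast_no_check (erefl true).
move=> /(key _ all_checks) h.
rewrite /letter_tr. apply: (vertex_check_relations famT _ h).
by rewrite /= !letter_nodes ?(letter_tr_lt (_, false)) ?(letter_tr_lt (_, true)).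
Qed.

Lemma letter_tr_disjoint (i j : 'I_12) : disjoint_edges i j ->
  forall s t : bool, commw (letter_tr (i, s)) (letter_tr (j, t)) = 1.
Proof.
pose chk_at (chk : node -> node -> bool) i j := has (mem (nth [::] edges j)) (nth [::] edges i) ||
  all (fun s : bool => all (fun t : bool =>
    chk (letter_node (i.*2 + s)) (letter_node (j.*2 + t)))%N [:: false; true]) [:: false; true].
have key chk : all (fun i => all (chk_at chk i) (iota 0 12)) (iota 0 12) -> disjoint_edges i j ->
    forall s t : bool, chk (letter_node (i.*2 + s)%N) (letter_node (j.*2 + t)%N).
  move=> /allP/(_ i)+ ij s t; rewrite mem_iota => /(_ (ltn_ord i))/allP/(_ j).
  rewrite mem_iota => /(_ (ltn_ord j)); rewrite /chk_at.
  rewrite (_ : has _ _ = false); last exact: negbTE.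
  move=> /allP/(_ s)+; move=> /(_ _)/allP/(_ t); apply.
    by case: s.
  by case: t.
have all_checks : all (fun i => all (chk_at (fun n m => act n m == m) i) (iota 0 12)) (iota 0 12).
  by vm_cast_no_check (erefl true).
move=> /(key _ all_checks) {}key s t; have /eqP e := key s t; apply/commw_commute.
have [_ _ J] := node_tr_conj famT (letter_nodes (letter_tr_lt (i, s))) (letter_nodes (letter_tr_lt (j, t))).
have [_ n1 _] := node_tr_conj famT (letter_nodes (letter_tr_lt (i, s))) (letter_nodes (letter_tr_lt (i, s))).
by move: J; rewrite e /commute /letter_tr => J; rewrite -{2}J -!mulgA n1 mulg1.
Qed.

(** Identifies the elements defined by paths in any group with a family; used for [S_8] and for the
    model modulo [r]. *)
Lemma node_elt_tr (g : gen -> G) : (forall x, g x = letter_tr x) ->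
  forall p q a, p != q -> node_elt g (label_node p q a) = T p q a.
Proof.
move=> gE.
have hE k : (k < 24)%N -> letter_gen g k = N (letter_node k).
  move=> k24; rewrite /letter_gen gE /letter_tr /= inordK ?ltn_half_double//.
  by rewrite addnC odd_double_half.
have main w : all (fun k => k < 24)%N w -> 
    conj_word (letter_gen g) (letter_gen g 2) w =
      N (foldl (fun m k => act (letter_node k) m) (letter_node 2) w) /\
    foldl (fun m k => act (letter_node k) m) (letter_node 2) w \in nodes.
  elim/last_ind: w => [_|w k IH]; first by rewrite letter_nodes// -hE.
  rewrite all_rcons /conj_word !foldl_rcons => /andP[k24 /IH[IH1 IH2]].
  have [mn _ J] := node_tr_conj famT (letter_nodes k24) IH2; split=> //.
  by rewrite -J -IH1 -(hE _ k24).
move=> p q a pq; have /allP/(_ _ (label_node_in a pq))/eqP e := paths_reach.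
have /allP/(_ _ (label_node_in a pq))/main[] := paths_letters.
by rewrite e (node_tr_label famT) /node_elt.
Qed.
End LetterElements.

Definition rp_product (G : groupType) (g : gen -> G) : G :=
  (\big[mulg/1]_(i < 12) (g (rev_ord i, true) * g (rev_ord i, false)))%g.

Definition rp_twisted : twisted := rp_product (letter_tr tw_tr).

Lemma tw_big (I : Type) (s : seq I) (P : pred I) (F : I -> twisted) :
  (forall i, P i -> twp (F i) = 1%g) ->
  twp (\big[mulg/1%g]_(i <- s | P i) F i) = 1%g /\
  forall j, twv (\big[mulg/1%g]_(i <- s | P i) F i) j = (\sum_(i <- s | P i) twv (F i) j)%R.
Proof.
move=> F1; elim: s => [|i s [IHp IHv]].
  by rewrite big_nil; split=> // j; rewrite big_nil /twv /= ffunE.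
rewrite big_cons; case: ifP => Pi; last by split=> // j; rewrite big_cons Pi.
rewrite twpM F1// mul1g IHp; split=> // j.
by rewrite twvM IHp invg1 perm1 IHv big_cons Pi.
Qed.

Lemma letter_nodeE (k : nat) (e : bool) : letter_node (k.*2 + e) =
  (ends k, if e then xor3 (nth 0%N base_labels k) (nth 0%N delta_labels k)
           else nth 0%N base_labels k).
Proof.
by case: e; rewrite ?addn1 ?addn0 /letter_node /= ?uphalf_double ?doubleK ?odd_double.
Qed.

(** The label at a triangle is the sum of [delta_labels] over its three sides, which lie on
    different great circles: 1 + 2 + 4 = 7 everywhere. *)
Lemma rp_twistedE : twp rp_twisted = 1%g /\ forall i, twv rp_twisted i = code_label 7.
Proof.
have pairE (k : 'I_12) : let x := (letter_tr tw_tr (k, true) * letter_tr tw_tr (k, false))%g in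
    twp x = 1%g /\ forall i : 'I_8, twv x i = (code_label (nth 0%N delta_labels k) *+
      ((i == (ends k).1 :> nat) || (i == (ends k).2 :> nat)))%R.
  move=> x; pose p : 'I_8 := inord (ends k).1; pose q : 'I_8 := inord (ends k).2.
  pose a := nth 0%N base_labels k; pose a' := xor3 a (nth 0%N delta_labels k).
  have /allP/(_ (k : nat)) : all (fun k => [&& (ends k).1 < 8, (ends k).2 < 8 &
    ((ends k).1 != (ends k).2) && (nth 0 base_labels k < 8) &&
     (nth 0 delta_labels k < 8)])%N (iota 0 12) by [].
  rewrite mem_iota ltn_ord => /(_ isT)/and3P[p8 q8 /andP[/andP[pq a8] d8]].
  have npq : p != q by rewrite -(inj_eq val_inj) /= !inordK.
  have -> : x = tw_pair p q (code_label (nth 0%N delta_labels k))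
      (beta (code_label a') (code_label a') + beta (code_label a) (code_label a))%R.
    rewrite /x /letter_tr !letter_nodeE /node_tr tw_tr_pair//; congr tw_pair.
    by rewrite -(@code_labelD _ _ a' d8 a8 erefl) -addrA addvv addr0.
  split=> // i; rewrite /twv /= ffunE /meets -!(inj_eq val_inj) /= !inordK//.
have [|-> vE] := @tw_big _ (index_enum 'I_12) xpredT
  (fun i => letter_tr tw_tr (rev_ord i, true) * letter_tr tw_tr (rev_ord i, false))%g.
  by move=> i _; have [] := pairE (rev_ord i).
split=> // i; rewrite vE (reindex_inj rev_ord_inj) /=.
under eq_bigr => k _ do rewrite rev_ordK (proj2 (pairE k) i).
rewrite -(big_mkord xpredT (fun k => code_label (nth 0%N delta_labels k) *+
      ((i == (ends k).1 :> nat) || (i == (ends k).2 :> nat)))%R).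
rewrite /index_iota /= !big_cons big_nil.
have := ltn_ord i; move: (nat_of_ord i) => {}i i8.
by apply: row3P => k k3; do 8 (case: i i8 => [_|i i8];
  first by case: k k3 => [|[|[|//]]] _; rewrite !(mxE, inordK)//; exact/val_inj).
Qed.

(** * The elements of the model above the identity permutation *)

Section TwistedKernel.
Local Open Scope ring_scope.
Implicit Types x y z h : twisted.

Lemma beta_suml (F : 'I_8 -> V) a : \sum_i beta (F i) a = beta (\sum_i F i) a.
Proof. by rewrite (big_morph (beta^~ a) (fun b c => betaDl b c a) (beta0l a)). Qed.

Lemma beta_sumr (F : 'I_8 -> V) a : \sum_i beta a (F i) = beta a (\sum_i F i).
Proof. by rewrite (big_morph (beta a) (betaDr a) (beta0r a)). Qed.

(** Both cocycle terms apply [beta] to [d] and the sum of the labels of [x], in either order, and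
    that sum is 0. *)
Lemma tw_const_commute z x d : twp z = 1%g -> (forall i, twv z i = d) ->
  \sum_i twv x i = 0 -> (z * x)%g = (x * z)%g.
Proof.
move=> zp zv xv; apply: tw_eq => [|i|]; first by rewrite !twpM zp mulg1 mul1g.
  by rewrite !twvM zp invg1 perm1 !zv addrC.
rewrite !twcM zp; under eq_bigr => i _ do rewrite zv.
under [in RHS]eq_bigr => i _ do rewrite zv invg1 perm1.
by rewrite beta_sumr beta_suml xv beta0l beta0r !addr0 addrC.
Qed.

Lemma tw_const_sq z d : twp z = 1%g -> (forall i, twv z i = d) -> (z * z)%g = 1%g.
Proof.
move=> zp zv; apply: tw_eq => [|i|]; first by rewrite twpM zp mulg1.
  by rewrite twvM !zv addvv /twv /= ffunE.
rewrite twcM addvv add0r; under eq_bigr => i _ do rewrite !zv.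
by rewrite big_const_ord /= !(addrA, addvv, add0r).
Qed.

Lemma sum_twvM x y : \sum_i twv (x * y)%g i = \sum_i twv x i + \sum_i twv y i.
Proof.
under eq_bigr => i _ do rewrite twvM.
by rewrite big_split /=; congr (_ + _); rewrite [RHS](reindex_perm (twp y)^-1%g).
Qed.

Lemma sum_twv_tr p q a : p != q -> \sum_i twv (tw_tr p q a) i = 0.
Proof.
move=> pq; under eq_bigr => i _ do rewrite twv_tr.
by rewrite (sum_meets (fun=> a))// addvv.
Qed.

Let tgen8 p q a : p != q -> tgen tw_tr 8 (tw_tr p q a).
Proof. by move=> pq; apply: tgen1. Qed.

(** The products of the form [pair_center] realize all [beta a b + beta b a]; on pairs of basis
    vectors these are again the basis vectors. *)
Lemma tgen_center p q c : p != q -> tgen tw_tr 8 (tw_pair p q 0 c).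
Proof.
move=> pq; have D (x y : V) : tgen tw_tr 8 (tw_pair p q 0 x) ->
    tgen tw_tr 8 (tw_pair p q 0 y) -> tgen tw_tr 8 (tw_pair p q 0 (x + y)).
  by move=> gx gy; rewrite -[X in tw_pair p q X](addr0 0) -tw_pairD//; exact: tgen_mul.
have B a b : tgen tw_tr 8 (tw_pair p q 0 (beta a b + beta b a)).
  have : tgen tw_tr 8 (tw_tr p q 0 * tw_tr p q a * (tw_tr p q b * tw_tr p q (a + b)))%g.
    by apply: tgen_mul; apply: tgen_mul; exact: tgen8.
  rewrite !tw_tr_pair// tw_pairD//.
  congr (tgen _ _ (tw_pair _ _ _ _)).
    by rewrite add0r [b + _]addrCA addvv addr0 addvv.
  rewrite beta0l add0r betaDl !betaDr; set x := beta a a; set y := beta b b.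
  by rewrite !addrA [LHS](ACl ((1*3)*(2*6)*(4*5))%AC) /= !addvv !add0r.
have E i : (i < 3)%N -> code_label (2 ^ i) =
    beta (code_label (nth 0%N [:: 1; 1; 2]%N i)) (code_label (nth 0%N [:: 2; 4; 4]%N i)) +
    beta (code_label (nth 0%N [:: 2; 4; 4]%N i)) (code_label (nth 0%N [:: 1; 1; 2]%N i)).
  by case: i => [|[|[|//]]] _; apply: row3P => -[|[|[|//]]] _; rewrite !(mxE, inordK)//; exact/val_inj.
have sum s : {subset s <= iota 0 3} ->
    tgen tw_tr 8 (tw_pair p q 0 (\sum_(i <- s) code_label (2 ^ i))).
  elim: s => [_|i s IH s3].
    by have := B 0 0; rewrite big_nil !beta0l addr0.
  rewrite big_cons; apply: D; last by apply: IH => j js; apply: s3; rewrite inE js orbT.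
  by rewrite E ?B//; have := s3 i (mem_head _ _); rewrite mem_iota.
by rewrite -(sum_basis c); apply: sum => i; rewrite mem_filter => /andP[].
Qed.

(** Translations over the pairs [0, i] produce the labels at all other points; the label at 0 is
    then right because the sum is 0, and a central element corrects the last entry. *)
Lemma tgen_kernel h : twp h = 1%g -> \sum_i twv h i = 0 -> tgen tw_tr 8 h.
Proof.
move=> hp hv; have o01 : ord0 != ord_max :> 'I_8 by [].
pose y : twisted := (\big[mulg/1]_(i < 8 | i != ord0) tw_pair ord0 i (twv h i) 0)%g.
have [yp yv] : twp y = 1%g /\ forall j, twv y j =
    \sum_(i | i != ord0) twv (tw_pair ord0 i (twv h i) 0) j.
  exact: tw_big.
have -> : h = (y * tw_pair ord0 ord_max 0 (twc h - twc y))%g.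
  apply: tw_eq => [|j|]; first by rewrite twpM yp mulg1.
    rewrite twvM invg1 perm1 yv [twv (tw_pair _ _ _ _) j]ffunE mul0rn addr0.
    under eq_bigr => i i0 do rewrite /twv ffunE.
    have [->|j0] := eqVneq j ord0.
      under eq_bigr => i i0 do rewrite /meets eqxx.
      by apply/eqP; rewrite -subr_eq0 oppvv -(bigD1 ord0 (P := xpredT))//; exact/eqP.
    rewrite (bigD1 j)//= big1 ?addr0; first by rewrite /meets eqxx orbT.
    move=> i /andP[i0 ij]; rewrite /meets (negPf j0) /=.
    by rewrite eq_sym (negPf ij).
  rewrite twcM big1 ?addr0 => [|j _]; first by rewrite [twc (tw_pair _ _ _ _)]/twc /= addrC subrK.
  by rewrite [twv (tw_pair _ _ _ _) j]ffunE mul0rn beta0r.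
apply: tgen_mul; last exact: tgen_center.
rewrite /y; elim/big_rec: _ => [|i x i0 gx]; first exact: TGen1.
apply: tgen_mul => //; have i0' : ord0 != i by rewrite eq_sym.
have -> : tw_pair ord0 i (twv h i) 0 = (tw_tr ord0 i (twv h i) * tw_tr ord0 i 0 *
    tw_pair ord0 i 0 (beta (twv h i) (twv h i)))%g.
  by rewrite tw_tr_pair// tw_pairD// !addr0 beta0l addr0 addvv.
by apply: tgen_mul; [apply: tgen_mul; exact: tgen8 | exact: tgen_center].
Qed.
End TwistedKernel.

Section Morphisms.
Local Open Scope group_scope.
Variables (G H : groupType) (f : {multiplicative G -> H}).

Lemma multV x : f x^-1 = (f x)^-1.
Proof. by apply: (mulgI (f x)); rewrite -gmulfM !mulgV mult1. Qed.

Lemma node_elt_morph (g : gen -> G) n : f (node_elt g n) = node_elt (f \o g) n.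
Proof.
rewrite /node_elt /conj_word; move: (path_to tree n) => w.
have : f (letter_gen g 2) = letter_gen (f \o g) 2 by [].
elim: w (letter_gen g 2) (letter_gen (f \o g) 2) => [|k w IH] x y xy; first exact: xy.
by apply: IH; rewrite !gmulfM xy.
Qed.

Lemma rp_product_morph (g : gen -> G) : f (rp_product g) = rp_product (f \o g).
Proof.
rewrite /rp_product (big_morph f (gmulfM (s:=f)) (mult1 f)).
by apply: eq_bigr => i _; rewrite gmulfM.
Qed.

Lemma branch_relations_morph (g : gen -> G) : branch_relations g -> branch_relations (f \o g).
Proof.
case=> R1 R2 R3; split; last by rewrite -[LHS]rp_product_morph [rp_product g]R3 mult1.
  move=> i j k l /R1; rewrite /vertex_relations /braidw /commw /=.
  have E u v : u = v -> f u = f v by move=> ->.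
  have E1 u : u = 1 -> f u = 1 by move=> ->; rewrite mult1.
  move=> [[a1 [a2 a3]] [[b1 [b2 b3]] [c1 [c2 [[d1 [d2 d3]] [[e1 [e2 e3]]
    [f1 [f2 [g1 [g2 [g3 g4]]]]]]]]]]].
  do 3 (rewrite -?multV -?gmulfM).
  by repeat match goal with |- _ /\ _ => split end;
    first [apply: E1; assumption | apply: E; assumption].
by move=> i j /R2 R s t; rewrite /commw /= -!multV -!gmulfM [X in f X]R mult1.
Qed.
End Morphisms.

Section FamilyPairs.
Local Open Scope group_scope.

Lemma pair_family (G H : groupType) (T : 'I_8 -> 'I_8 -> V -> G)
    (U : 'I_8 -> 'I_8 -> V -> H) : tfamily T -> tfamily U ->
  @tfamily (G * H)%type (fun p q a => (T p q a, U p q a)).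
Proof.
move=> [TC TT TJ] [UC UU UJ]; split=> [p q a|p q a pq|p q r s a b pq rs].
- by rewrite TC UC.
- by apply: (congr2 pair); [exact: TT | exact: UU].
- by apply: (congr2 pair); [exact: TJ | exact: UJ].
Qed.

Lemma fst_mult (G H : groupType) : {morph (fst : (G * H)%type -> G) : x y / x * y}.
Proof. by []. Qed.
HB.instance Definition _ (G H : groupType) :=
  isMultiplicative.Build (G * H)%type G fst (@fst_mult G H).

Lemma snd_mult (G H : groupType) : {morph (snd : (G * H)%type -> H) : x y / x * y}.
Proof. by []. Qed.
HB.instance Definition _ (G H : groupType) :=
  isMultiplicative.Build (G * H)%type H snd (@snd_mult G H).

Lemma perm_family : tfamily (fun p q (_ : V) => tperm p q).
Proof.
split=> [p q _|p q _ _|p q r s _ _ _ _]; [exact: tpermC | exact: tperm2 |].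
by rewrite -tpermJ conjgE tpermV mulgA.
Qed.
End FamilyPairs.

(** * Comparison of the model with the quotient *)

Section CosetFamily.
Local Open Scope group_scope.
Local Notation r := rp_twisted.

Lemma rp_twisted_commute x : (\sum_i twv x i = 0)%R -> r * x = x * r.
Proof. by have [rp rv] := rp_twistedE; exact: tw_const_commute rp rv. Qed.

Lemma rp_twisted_norm p q a : p != q -> tw_tr p q a \in 'N(<[r]>).
Proof.
move=> pq; apply: (fintype.subsetP (cent_sub _)); rewrite cent_cycle; apply/cent1P.
by rewrite /commute rp_twisted_commute ?sum_twv_tr.
Qed.

Definition coset_tr p q a : coset_of <[r]> := coset <[r]> (tw_tr p q a).

Lemma coset_family : tfamily coset_tr.
Proof.
have [TC TT TJ] := tw_tr_family; split=> [p q a|p q a pq|p q s t a b pq st].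
- by rewrite /coset_tr TC.
- by rewrite /coset_tr -morphM ?rp_twisted_norm// TT// morph1.
- by rewrite /coset_tr -!morphM ?groupM ?rp_twisted_norm// TJ.
Qed.

Lemma letter_edge (x : gen) : let k := letter_node (x.1.*2 + x.2) in
  (inord k.1.1 : 'I_8) != inord k.1.2.
Proof.
have [p [q [a [pq -> _]]]] := nodes_label (letter_nodes (letter_tr_lt x)).
by rewrite /= !inord_val.
Qed.

(** (R4) and (R5) hold for every family; (RP) holds because its value [r] is precisely what the
    quotient kills. *)
Lemma coset_relations : branch_relations (letter_tr coset_tr).
Proof.
split; [by move=> i j k l; exact: (letter_tr_vertex coset_family) |
        by move=> i j ij s t; exact: (letter_tr_disjoint coset_family) |].
have tn x : letter_tr tw_tr x \in 'N(<[r]>) by apply: rp_twisted_norm; exact: letter_edge.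
transitivity (coset <[r]> r); last by apply: coset_id; exact: cycle_id.
rewrite /rp_twisted /rp_product morph_prod => [|i _]; last by rewrite groupM.
by apply: eq_bigr => i _; rewrite morphM.
Qed.
End CosetFamily.

Section Quotient.
Local Open Scope group_scope.
Local Open Scope classical_set_scope.
Variables (G : groupType) (gamma : gen -> G).
Hypothesis hgamma : presented_by branch_relations gamma.
Variables (Q : groupType) (q : {multiplicative G -> Q}).
Hypothesis hq : quotient_by [set (gamma i * gamma i)%g | i in [set: gen]] q.

Let gQ := q \o gamma.

Let gQ_invol x : gQ x * gQ x = 1.
Proof.
rewrite /gQ /= -gmulfM; case: hq => _ /(_ (gamma x * gamma x))[_]; apply.
by move=> K _; apply; exists x.
Qed.

Let gQ_rel : branch_relations gQ.
Proof. by apply: branch_relations_morph; case: hgamma. Qed.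

Let TQ := class_elt gQ.

Let TQ_letter x : gQ x = letter_tr TQ x.
Proof.
pose k := (x.1.*2 + x.2)%N; have k24 : (k < 24)%N by exact: letter_tr_lt.
have [u [v [c [uv kE]]]] := letter_node_label k24.
have := letter_class gQ_invol gQ_rel k24 uv kE.
rewrite /letter_tr -/k kE /node_tr /= !inord_val label_codeK /TQ => <-.
rewrite /letter_gen /k; congr gQ; case: x {k k24 kE} => i e /=.
by rewrite addnC half_bit_double oddD odd_double addbF oddb inord_val.
Qed.

Definition model_family p s a : (twisted * Q)%type := (tw_tr p s a, TQ p s a).

Lemma model_family_tfamily : tfamily model_family.
Proof.
by apply: pair_family; [exact: tw_tr_family | exact: class_family].
Qed.

(* The graph of a correspondence between the model and Q; its projection to
   Q turns out to be two-to-one. *)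
Definition model_graph (h : twisted) (y : Q) : Prop := tgen model_family 8 (h, y).

Lemma model_graphM h y h' y' : model_graph h y -> model_graph h' y' ->
  model_graph (h * h') (y * y').
Proof. exact: tgen_mul. Qed.

Lemma model_graph1 : model_graph 1 1.
Proof. exact: TGen1. Qed.

Lemma model_graph_ind (R : twisted -> Q -> Prop) : R 1 1 ->
  (forall p s a h y, p != s -> model_graph h y -> R h y -> R (tw_tr p s a * h) (TQ p s a * y)) ->
  forall h y, model_graph h y -> R h y.
Proof.
move=> R1 RM h y; rewrite /model_graph; set z := (h, y).
have -> : R h y = R z.1 z.2 by [].
elim=> [|p s a [h' y'] _ _ ps ghy IH]; [exact: R1 | exact: RM].
Qed.

Lemma model_graph_tr p s a : p != s -> model_graph (tw_tr p s a) (TQ p s a).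
Proof. by move=> ps; exact: (tgen1 model_family). Qed.

Lemma model_graphV h y : model_graph h y -> model_graph h^-1 y^-1.
Proof.
elim/model_graph_ind => [|p s a {}h {}y ps _ IH]; first by rewrite !invg1; exact: model_graph1.
rewrite !invMg; apply: model_graphM => //.
have [_ TT _] := tw_tr_family; have [_ UU _] := class_family gQ_invol gQ_rel.
by rewrite (invol_inv (TT _ _ _ ps)) (invol_inv (UU _ _ _ ps)); exact: model_graph_tr.
Qed.

(** The pairs form a family in [twisted * Q], to which the normal form applies with the first
    projection as [f]. This takes the place of a presentation of the model. *)
Lemma model_graph_inj y : model_graph 1 y -> y = 1.
Proof.
move=> gy; have : (1, y) = 1 :> (twisted * Q)%type.
  exact: (tgen_inj model_family_tfamily (f := fst) _ (n := 8) _ gy).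
by case.
Qed.

Lemma model_graph_surj y : exists h, model_graph h y.
Proof.
have [x <-] := (proj1 hq) y.
have [gen_by _ _] := hgamma.
pose K := [set x | exists h, model_graph h (q x)].
have K_all : K = [set: G].
  apply: gen_by => [|i].
    split=> [|u v [h gh] [h' gh']|u [h gh]].
    - by exists 1; rewrite mult1; exact: model_graph1.
    - by exists (h * h'); rewrite gmulfM; exact: model_graphM.
    - by exists h^-1; rewrite multV; exact: model_graphV.
  by exists (letter_tr tw_tr i); rewrite -[q _]/(gQ i) TQ_letter; apply: model_graph_tr;
    exact: letter_edge.
by have : K x by rewrite K_all.
Qed.

Lemma model_graph_letter x : model_graph (letter_tr tw_tr x) (gQ x).
Proof. by rewrite TQ_letter; apply: model_graph_tr; exact: letter_edge. Qed.

Lemma model_graph_rp : model_graph rp_twisted 1.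
Proof.
have [_ _ <-] := gQ_rel; rewrite /rp_twisted /rp_product.
elim/big_rec2: _ => [|i y h _ IH]; first exact: model_graph1.
by do ! apply: model_graphM => //; exact: model_graph_letter.
Qed.

(** The presentation of [G] gives [psi] from [G] to the model modulo [r]. A pair [(h, y)] lifts to
    an element of [G] above [y] that [psi] sends to the coset of [h]; if [y = 1], this element is in
    the normal closure of the squares, which [psi] kills. *)
Lemma model_graph_kernel h : model_graph h 1 -> h \in <[rp_twisted]>.
Proof.
have [_ _ univ] := hgamma.
have [psi psiE] := univ _ _ coset_relations.
have lift h' y : model_graph h' y -> h' \in 'N(<[rp_twisted]>) /\
    exists2 x, q x = y & psi x = coset <[rp_twisted]> h'.
  elim/model_graph_ind => [|p s a {}h' {}y ps _ [hn [x <- xE]]].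
    by split; [exact: group1 | exists 1; rewrite ?mult1 ?morph1].
  split; first by rewrite groupM ?rp_twisted_norm.
  exists (class_elt gamma p s a * x).
    by rewrite gmulfM; congr (_ * _); exact: node_elt_morph.
  rewrite gmulfM morphM ?rp_twisted_norm// xE; congr (_ * _).
  by rewrite /class_elt node_elt_morph; apply: (node_elt_tr coset_family).
move=> /lift[hn [x /(proj2 hq) xN xh]]; apply: coset_idr => //; rewrite -xh.
apply: (xN [set x | psi x = 1]) => [|_ [i _ <-] /=].
  split=> [|u v /= u1]; last by rewrite !gmulfM u1 mulg1 -gmulfM mulgV mult1.
  split=> [|u v /= u1 v1|u /= u1]; first exact: mult1.
    by rewrite gmulfM u1 v1 mulg1.
  by rewrite multV u1 invg1.
rewrite gmulfM psiE; have [_ TT _] := coset_family.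
by apply: TT; exact: letter_edge.
Qed.

Variable phi : {multiplicative Q -> 'S_8}.
Hypothesis hphi : forall (i : 'I_12) (e : bool) (s t : 'I_8), s != t ->
  edge_of_triangle i s -> edge_of_triangle i t ->
  phi (q (gamma (i, e))) = tperm s t.

Lemma phi_class p s a : p != s -> phi (TQ p s a) = tperm p s.
Proof.
rewrite /TQ /class_elt node_elt_morph => ps.
apply: (node_elt_tr perm_family) => // -[i e].
have /allP/(_ (i : nat)) : all (fun i => let: (p, s) := ends i in [&& p < 8, s < 8,
    all (mem (nth [::] triangles p)) (nth [::] edges i) &
    all (mem (nth [::] triangles s)) (nth [::] edges i)])%N (iota 0 12) by [].
rewrite mem_iota ltn_ord => /(_ isT).
case iE: (ends i) => [u v] /and4P[u8 v8 iu iv].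
rewrite /letter_tr letter_nodeE /node_tr iE /=; apply: hphi.
- by have := letter_edge (i, e); rewrite letter_nodeE iE.
- by rewrite /edge_of_triangle /triangle inordK.
- by rewrite /edge_of_triangle /triangle inordK.
Qed.

Lemma model_graph_phi h y : model_graph h y -> phi y = twp h.
Proof.
elim/model_graph_ind => [|p s a {}h {}y ps _ IH]; first exact: mult1.
by rewrite gmulfM phi_class// IH.
Qed.

Lemma model_graph_sum h y : model_graph h y -> (\sum_i twv h i = 0)%R.
Proof.
elim/model_graph_ind => [|p s a {}h {}y ps _ IH].
  by rewrite big1// => i _; rewrite /twv /= ffunE.
by rewrite sum_twvM sum_twv_tr// IH addr0.
Qed.

Lemma model_graph_total h : twp h = 1 -> (\sum_i twv h i = 0)%R -> exists y, model_graph h y.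
Proof.
move=> hp /(tgen_kernel hp); elim=> [|p s a x _ _ ps _ [y gy]].
  by exists 1; exact: model_graph1.
by exists (TQ p s a * y); apply: model_graphM => //; exact: model_graph_tr.
Qed.
End Quotient.

(** * Coordinates on the labels of sum 0 modulo the constant family of [r] *)

Section KernelCoordinates.
Local Open Scope ring_scope.

Definition tw_coord (h : twisted) (m : nat) : 'Z_2 :=
  twv h (inord (m %/ 3)) ord0 (inord (m %% 3)).

(* Comparison with the last of 21 coordinates kills the constant family
   twv rp_twisted. *)
Definition tw_coords (h : twisted) : 'rV['Z_2]_20 :=
  \row_j (tw_coord h j + tw_coord h 20).

Lemma tw_coordsM h k : twp k = 1%g -> tw_coords (h * k)%g = tw_coords h + tw_coords k.
Proof.
move=> k1; have E m : tw_coord (h * k)%g m = tw_coord h m + tw_coord k m.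
  by rewrite /tw_coord twvM k1 invg1 perm1 mxE.
by apply/rowP=> j; rewrite !mxE !E addrACA.
Qed.

Lemma tw_coords_const h a : (forall i, twv h i = const_mx a) -> tw_coords h = 0.
Proof.
move=> hv; apply/rowP=> j; rewrite !mxE /tw_coord !hv !mxE.
by case: (Z2_cases a) => ->; exact/val_inj.
Qed.

Lemma tw_coords_ker h : \sum_i twv h i = 0 -> tw_coords h = 0 ->
  exists a, forall i, twv h i = const_mx a.
Proof.
move=> hv h0; exists (tw_coord h 20).
have small m : (m < 7)%N -> twv h (inord m) = const_mx (tw_coord h 20).
  move=> m7; apply: row3P => k k3; rewrite mxE.
  have -> : twv h (inord m) ord0 (inord k) = tw_coord h (m * 3 + k).
    by rewrite /tw_coord divnMDl// divn_small// addn0 modnMDl modn_small.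
  have : (m * 3 + k <= 20)%N by exact: (@leq_add _ _ (6 * 3) 2 (leq_mul (m7 : m <= 6)%N (leqnn 3)) k3).
  rewrite leq_eqVlt => /orP[/eqP->//|mk20].
  have := congr1 (fun u : 'rV_20 => u ord0 (Ordinal mk20)) h0; rewrite !mxE /=.
  by move/eqP; rewrite addr_eq0 => /eqP->; case: (Z2_cases (tw_coord h 20)) => ->; exact/val_inj.
move=> i; have [i7|i7] := ltnP i 7; first by rewrite -(inord_val i) small.
(* The last label is determined by the vanishing sum: seven equal labels, an odd number, add up to
   that label. *)
have -> : i = ord_max by apply/val_inj/eqP; rewrite eqn_leq i7 -ltnS ltn_ord.
move: hv; rewrite big_ord_recr /= => /eqP; rewrite addr_eq0 => /eqP/esym/(congr1 -%R).
rewrite opprK oppvv => ->.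
under eq_bigr => j _.
  have -> : widen_ord (leqnSn 7) j = inord j by apply/val_inj; rewrite /= inordK// (ltn_trans (ltn_ord j)).
  rewrite small ?ltn_ord//; over.
by rewrite big_const_ord /= !(addrA, addvv, add0r) addr0.
Qed.

Lemma tw_coords_surj w : exists h, [/\ twp h = 1%g, \sum_i twv h i = 0 & tw_coords h = w].
Proof.
(* The preimage is normalized so that coordinate 20 is 0; the last point receives the sum of the
   other labels. *)
pose v0 (i : nat) : V := \row_k (if (i * 3 + k < 20)%N then w ord0 (inord (i * 3 + k)) else 0).
pose v (i : 'I_8) : V := if i == ord_max then \sum_(j < 7) v0 j else v0 i.
exists ((1%g, finfun v, 0) : twisted); split=> //.
  rewrite big_ord_recr /= /twv /= ffunE {2}/v eqxx -[RHS](addvv (\sum_(j < 7) v0 j)).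
  congr (_ + _); apply: eq_bigr => j _.
  by rewrite ffunE /v -(inj_eq val_inj) /= ltn_eqF.
have E m : (m < 21)%N -> tw_coord (1%g, finfun v, 0) m = if (m < 20)%N then w ord0 (inord m) else 0.
  move=> m21; have m7 : (m %/ 3 < 7)%N by rewrite ltn_divLR.
  rewrite /tw_coord /twv /= ffunE /v -(inj_eq val_inj) /= (inordK (ltnW m7 : (_ < 8)%N)) ltn_eqF//.
  by rewrite mxE inordK ?ltn_mod// -divn_eq.
apply/rowP=> j; rewrite mxE !E// ?ltn_ord; last by rewrite ltnS ltnW.
by rewrite addr0 inord_val.
Qed.
End KernelCoordinates.

Lemma card_fin_bij (T : Type) (F : finType) (f : T -> F) : bijective f ->
  ([set: T] #= `I_#|F|)%card.
Proof.
move=> [g fK gK]; apply/card_set_bijP; exists (fun x => nat_of_ord (enum_rank (f x))); split.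
- by move=> x _ /=.
- by move=> x y _ _ /val_inj/enum_rank_inj/(can_inj fK).
- by move=> k /= kF; exists (g (enum_val (Ordinal kF))) => //; rewrite gK enum_valK.
Qed.

Lemma short_exact_card (A B : finGroupType) (E : groupType)
    (i : {multiplicative A -> E}) (p : {multiplicative E -> B}) :
  short_exact i p -> ([set: E] #= `I_(#|A| * #|B|))%card.
Proof.
move=> [i_inj p_surj ker_p]; have [s sK] := choice p_surj.
pose f (u : A * B) : E := (i u.1 * s u.2)%g.
have pi a : p (i a) = 1%g by apply/ker_p; exists a.
have pf u : p (f u) = u.2 by rewrite gmulfM pi mul1g sK.
have fS x : exists u, f u = x.
  have [a ax] : exists a, i a = (x * (s (p x))^-1)%g.
    by apply/ker_p; rewrite gmulfM multV sK mulgV.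
  by exists (a, p x); rewrite /f ax mulgVK.
have [g gK] := choice fS.
rewrite -card_prod; apply: (@card_fin_bij _ _ g); exists f => // -[a b].
have := gK (f (a, b)); case: (g _) => a' b' e.
have bb : b' = b by rewrite -[b'](pf (a', b')) e pf.
by move: e; rewrite bb /f /= => /mulIg/i_inj->.
Qed.

Lemma central_extension_metabelian (A G B : groupType) : abelian_group A ->
  abelian_group B -> central_extension A G B -> metabelian G.
Proof. by move=> AA BB [i [p [ip _]]]; exists A, B, i, p. Qed.

Lemma row_abelian n : abelian_group 'rV['Z_2]_n.
Proof. by move=> x y; exact: addrC. Qed.

(** * The central extension *)

Section GaloisGroup.
Local Open Scope group_scope.
Local Open Scope classical_set_scope.
Variables (G : groupType) (gamma : gen -> G).
Hypothesis hgamma : presented_by branch_relations gamma.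
Variables (Pi Q : groupType) (q : {multiplicative G -> Q}).
Hypothesis hq : quotient_by [set (gamma i * gamma i)%g | i in [set: gen]] q.
Variables (iota : {multiplicative Pi -> Q}) (phi : {multiplicative Q -> 'S_8}).
Hypothesis hexact : short_exact iota phi.
Hypothesis hphi : forall (i : 'I_12) (e : bool) (s t : 'I_8), s != t ->
  edge_of_triangle i s -> edge_of_triangle i t ->
  phi (q (gamma (i, e))) = tperm s t.

Let gr h x := model_graph gamma q h (iota x).

Let gr_perm h x : gr h x -> twp h = 1.
Proof.
move=> /(model_graph_phi hphi) <-; have [_ _ ker] := hexact.
by apply/ker; exists x.
Qed.

Let gr_sum h x : gr h x -> (\sum_i twv h i = 0)%R.
Proof. exact: model_graph_sum. Qed.

Let grM h x k y : gr h x -> gr k y -> gr (h * k) (x * y).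
Proof. by rewrite /gr gmulfM; exact: model_graphM. Qed.

Let grV h x : gr h x -> gr h^-1 x^-1.
Proof. by rewrite /gr multV; exact: model_graphV. Qed.

Let gr_exists x : exists h, gr h x.
Proof. exact: model_graph_surj. Qed.

Let gr_total h : twp h = 1 -> (\sum_i twv h i = 0)%R -> exists x, gr h x.
Proof.
move=> hp hv; have [y gy] := model_graph_total gamma q hp hv.
have [_ _ ker] := hexact; have [|x xy] := (ker y).1.
  by rewrite (model_graph_phi hphi gy).
by exists x; rewrite /gr xy.
Qed.

Let gr_eq h x y : gr h x -> gr h y -> x = y.
Proof.
move=> gx gy; have := grM (grV gx) gy; rewrite mulVg => /(model_graph_inj hgamma hq) e.
have [inj _ _] := hexact; apply: (mulgI x^-1); apply: inj.
by rewrite e mulVg mult1.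
Qed.

Let r := rp_twisted.

Let gr_rp : gr r 1.
Proof. by rewrite /gr mult1; exact: model_graph_rp. Qed.

Let gr1 h : gr h 1 -> h = 1 \/ h = r.
Proof.
rewrite /gr mult1 => /(model_graph_kernel hgamma hq)/cycleP[n ->].
have rr : r * r = 1 by have [rp rv] := rp_twistedE; exact: tw_const_sq rp rv.
elim: n => [|n]; first by left.
by rewrite expgS; case=> ->; [right; rewrite mulg1 | left].
Qed.

Let lift x := projT1 (cid (gr_exists x)).
Let gr_lift x : gr (lift x) x. Proof. exact: projT2 (cid (gr_exists x)). Qed.

Let tw_center c : twisted := tw_pair ord0 ord_max 0%R c.

Let center_exists c : exists x, gr (tw_center c) x.
Proof.
apply: gr_total => //; apply: big1 => i _.
by rewrite /twv /= ffunE mul0rn.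
Qed.

Let center c := projT1 (cid (center_exists c)).
Let gr_center c : gr (tw_center c) (center c).
Proof. exact: projT2 (cid (center_exists c)). Qed.

Let r_coords : tw_coords r = 0%R.
Proof.
have [_ rv] := rp_twistedE; apply: (@tw_coords_const _ 1%R) => i; rewrite rv.
by apply: row3P => -[|[|[|//]]] _; rewrite !mxE inordK//; exact/val_inj.
Qed.

(** Two elements of the model over the same [x] differ by 1 or [r], and both have vanishing
    coordinates. *)
Let coords_eq h k x : gr h x -> gr k x -> tw_coords h = tw_coords k.
Proof.
move=> hx kx; have := grM hx (grV kx); rewrite mulgV => /gr1 e.
rewrite -[h](mulgVK k) tw_coordsM; last exact: gr_perm kx.
case: e => ->; last by rewrite r_coords add0r.
rewrite (@tw_coords_const _ 0%R) ?add0r// => i; rewrite /twv /= ffunE.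
by apply/rowP=> j; rewrite !mxE.
Qed.

Let p x := tw_coords (lift x).

Let p_coords h x : gr h x -> p x = tw_coords h.
Proof. exact: coords_eq. Qed.

Let pM : {morph p : x y / x * y}.
Proof.
move=> x y; rewrite (p_coords (grM (gr_lift x) (gr_lift y))) tw_coordsM//.
exact: gr_perm.
Qed.

Let centerM : {morph center : c d / c * d}.
Proof.
move=> c d; apply: (gr_eq (gr_center _)).
have := grM (gr_center c) (gr_center d).
by rewrite /tw_center tw_pairD// add0r.
Qed.

HB.instance Definition _ := isMultiplicative.Build _ _ p pM.
HB.instance Definition _ := isMultiplicative.Build _ _ center centerM.

Theorem galois_group_extension : central_extension 'rV['Z_2]_3 Pi 'rV['Z_2]_20.
Proof.
have pE h x : gr h x -> p x = tw_coords h by exact: p_coords.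
have cE h c : gr h (center c) -> tw_center c = h \/ r * tw_center c = h.
  move=> gh; have := grM gh (grV (gr_center c)); rewrite mulgV => /gr1.
  by case=> e; [left | right]; rewrite -[RHS](mulgVK (tw_center c)) e ?mul1g.
exists (center : {multiplicative _ -> _}), (p : {multiplicative _ -> _}).
split; last first.
  move=> c x /=; apply: (gr_eq (grM (gr_center c) (gr_lift x))).
  have -> : tw_center c * lift x = lift x * tw_center c.
    by apply: (@tw_const_commute _ _ 0%R); rewrite ?(gr_sum (gr_lift x))// => i;
      rewrite /twv /= ffunE mul0rn.
  exact: grM (gr_lift x) (gr_center c).
split.
- move=> c d /= cd; have := gr_center d; rewrite -cd => /cE[/(congr1 twc)//|].
  (* The case of [r * tw_center c] is excluded by the label at the point 0, which is 7 there and 0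
     for [tw_center d]. *)
  move=> /(congr1 (fun h => twv h ord0)).
  have [_ rv] := rp_twistedE; rewrite twvM invg1 perm1 rv /twv /= !ffunE !mul0rn addr0.
  by move=> /(congr1 label_code); rewrite code_labelK// /label_code !mxE.
- move=> w; have [h [hp hv <-]] := tw_coords_surj w.
  by have [x hx] := gr_total hp hv; exists x; exact: pE.
- move=> x; split=> [x1|[c <-]] /=; last first.
    rewrite (pE _ _ (gr_center c)); apply: (@tw_coords_const _ 0%R) => i.
    by rewrite /twv /= ffunE mul0rn; apply/rowP=> j; rewrite !mxE.
  have [a hv] := tw_coords_ker (gr_sum (gr_lift x)) x1.
  have x_center h : gr h x -> (forall i, twv h i = 0%R) -> exists c, center c = x.
    move=> gh hv0; exists (twc h); apply: (gr_eq (gr_center _)).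
    rewrite (_ : tw_center _ = h)//; apply: tw_eq => [|i|//].
      by rewrite (gr_perm gh).
    by rewrite hv0 /twv /= ffunE mul0rn.
  have [a0|a1] := Z2_cases a.
    apply: (x_center _ (gr_lift x)) => i; rewrite hv a0.
    by apply/rowP=> j; rewrite !mxE.
  (* If the lift has label (1,1,1) everywhere, multiplying it by [r] gives another element over [x],
     with all labels 0. *)
  have := grM gr_rp (gr_lift x); rewrite mul1g => /x_center; apply=> i.
  have [_ rv] := rp_twistedE; rewrite twvM rv hv a1.
  by apply: row3P => -[|[|[|//]]] _; rewrite !mxE inordK//; exact/val_inj.
Qed.
End GaloisGroup.

Lemma for_generic_all (R : realType) (m n : nat) (P : 'M[Cplx R]_(m, n) -> Prop) :
  (forall A, P A) -> for_generic P.
Proof.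
move=> PA; exists (mpoly.mpolyC _ 1%R) => [|A _]; last exact: PA.
by rewrite mpoly.mpolyC_eq0 oner_neq0.
Qed.

Local Open Scope classical_set_scope.

Theorem theorem3p4 (R : realType) (N : nat) (X : set (CP R N)) :
  smooth_projective_surface X ->
  surface_degree 8 X ->
  for_generic (fun A : 'M[Cplx R]_(N.+1, 3) =>
    degenerates_to_X4 X A ->
    forall
      (* G = pi_1(CP^2 \ S) *)
      (b0 : ~` branch_curve X A) (G : groupType)
      (clG : (R -> ~` branch_curve X A) -> G)
      (hG : is_fundamental_group b0 clG)
      (* Pi = pi_1(X_Gal) *)
      (x0 : @galois_cover R N 8 X A) (Pi : groupType)
      (clPi : (R -> @galois_cover R N 8 X A) -> Pi)
      (hPi : is_fundamental_group x0 clPi)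
      (* Van Kampen presentation of G *)
      (gamma : gen -> G)
      (hgamma : presented_by branch_relations gamma)
      (* Q = G / <<gamma^2>> and 1 -> Pi -> Q -> S_8 -> 1 *)
      (Q : groupType) (q : {multiplicative G -> Q})
      (hq : quotient_by [set (gamma i * gamma i)%g | i in [set: gen]] q)
      (iota : {multiplicative Pi -> Q}) (phi : {multiplicative Q -> 'S_8})
      (hexact : short_exact iota phi)
      (hphi : forall (i : 'I_12) (e : bool) (s t : 'I_8), s != t ->
        edge_of_triangle i s -> edge_of_triangle i t ->
        phi (q (gamma (i, e))) = tperm s t),
    [/\ metabelian Pi,
        ([set: Pi] #= `I_(2 ^ 23))%card &
        central_extension 'rV['Z_2]_3 Pi 'rV['Z_2]_20]).
Proof.
move=> _ _; apply: for_generic_all => A _ b0 G clG _ x0 Pi clPi _ gamma hgamma Q q hq iota phi hexact hphi.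
have ext := galois_group_extension hgamma hq hexact hphi.
split=> //; first by apply: central_extension_metabelian ext; exact: row_abelian.
have <- : (#|'rV['Z_2]_3| * #|'rV['Z_2]_20| = 2 ^ 23)%N.
  by rewrite !card_mx card_ord -expnD.
by case: ext => i [p [/short_exact_card]].
Qed.
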